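(* Let $\kappa\in\{-1,1\}$. For each $\mathcal{H}\in\mathfrak{C}^1_\kappa$ there exists a rotational, embedded $\mathcal{H}$-sphere $S_{\mathcal{H}}$ in $\mathbb{M}^2(\kappa)\times\mathbb{R}$.
   Context: $\mathbb{M}^2(\kappa)$ is the complete simply connected surface of constant curvature $\kappa$: the hyperbolic plane $\mathbb{H}^2$ if $\kappa=-1$ and the unit sphere $\mathbb{S}^2$ if $\kappa=1$. $\mathbb{M}^2(\kappa)\times\mathbb{R}$ carries the product metric, and $\partial_z$ is the unit vertical Killing field, the gradient of the height function (projection onto $\mathbb{R}$). Given $\mathcal{H}\in C^1([-1,1])$, an immersed oriented surface $\Sigma$ in $\mathbb{M}^2(\kappa)\times\mathbb{R}$ with unit normal $\eta$ is an $\mathcal{H}$-surface if its mean curvature $H_\Sigma$ with respect to $\eta$ (half the sum of the principal curvatures) satisfies $H_\Sigma(p)=\mathcal{H}(\nu(p))$ for all $p\in\Sigma$, where $\nu(p)=\langle\eta_p,\partial_z\rangle$ is the angle function. Sign convention: a vertical graph $z=u$ oriented by its upward unit normal has $2H_\Sigma=\mathrm{div}(\nabla u/\sqrt{1+|\nabla u|^2})$, divergence and gradient being taken in $\mathbb{M}^2(\kappa)$. The class of functions is $$\mathfrak{C}^1_\kappa=\{\mathcal{H}\in C^1([-1,1]):\ \mathcal{H}(y)=\mathcal{H}(-y)\ \forall y\in[-1,1],\ \text{and } 2|\mathcal{H}(y)|>\sqrt{1-y^2}\ \forall y\in[-1,1]\ \text{if } \kappa=-1\}.$$ Standing assumption: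 the (possible) zeros of $\mathcal{H}$ are isolated and of finite multiplicity. A sphere is a closed (compact, without boundary) surface of genus zero; an $\mathcal{H}$-sphere is an $\mathcal{H}$-surface that is a sphere. Rotational means invariant under the rotations of $\mathbb{M}^2(\kappa)\times\mathbb{R}$ that fix pointwise some vertical line $\{p\}\times\mathbb{R}$. *)

(* Defs.v *)
From HB Require Import structures.
From mathcomp Require Import all_boot all_order all_algebra.
From mathcomp Require Import all_classical all_reals all_analysis.

Set Implicit Arguments.
Unset Strict Implicit.
Unset Printing Implicit Defensive.

Import Order.TTheory GRing.Theory Num.Theory.
Import numFieldNormedType.Exports.

Local Open Scope classical_set_scope.
Local Open Scope ring_scope.

(** * The ambient space M^2(kappa) x R, for kappa = 1 or kappa = -1 *)

(* M^2(kappa) is realized in R^3 with the bilinear form below: as the unit     *)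
(* sphere of Euclidean space (kappa = 1), or as the upper sheet of the         *)
(* hyperboloid of Minkowski space (kappa = -1). Thus M^2(kappa) x R sits in    *)
(* R^3 x R, and its product metric is the restriction of [form4].              *)
Notation ambient R := ('rV[R]_3 * R)%type.

Definition form3 (R : realType) (kappa : R) (x y : 'rV[R]_3) : R :=
  x 0 0 * y 0 0 + x 0 1 * y 0 1 + kappa * (x 0 2 * y 0 2).

Definition M2 (R : realType) (kappa : R) : set 'rV[R]_3 :=
  [set x | form3 kappa x x = kappa /\ (kappa = -1 -> 0 < x 0 2)].

Definition M2xR (R : realType) (kappa : R) : set (ambient R) :=
  [set q | M2 kappa q.1].

Definition form4 (R : realType) (kappa : R) (v w : ambient R) : R :=
  form3 kappa v.1 w.1 + v.2 * w.2.

(* Tangent space of M^2(kappa) x R at q. *)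
Definition tangent_M2xR (R : realType) (kappa : R) (q : ambient R) :
    set (ambient R) :=
  [set v | form3 kappa v.1 q.1 = 0].

Definition d_z (R : realType) : ambient R := (0, 1).

(** * Immersed surfaces *)

Definition partial (R : realType) (V : normedModType R) (i : 'I_2)
    (X : 'rV[R]_2 -> V) : 'rV[R]_2 -> V :=
  'D_(delta_mx 0 i) X.

(* X is of class C^k on the open set U. *)
Fixpoint class_C (R : realType) (V : normedModType R) (k : nat)
    (U : set 'rV[R]_2) (X : 'rV[R]_2 -> V) : Prop :=
  (forall u, U u -> {for u, continuous X}) /\
  if k is k'.+1 then
    forall i : 'I_2,
      (forall u, U u -> derivable X u (delta_mx 0 i)) /\
      class_C k' U (partial i X)
  else True.

(* A parametrization phi, over the open set U, of an open subset of the        *)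
(* surface S, in which f is a C^2 immersion. Two such parametrizations differ  *)
(* by a C^2 change of variables because f is an immersion in both, so that     *)
(* they form a C^2 atlas on S.                                                 *)
Definition local_param (R : realType) (S : topologicalType)
    (f : S -> ambient R) (U : set 'rV[R]_2) (phi : 'rV[R]_2 -> S) : Prop :=
  [/\ open U,
      forall u, U u -> {for u, continuous phi},
      set_inj U phi,
      forall V, open V -> V `<=` U -> open (phi @` V) &
      class_C 2 U (f \o phi) /\
      forall u, U u -> forall a b : R,
        a *: partial 0 (f \o phi) u + b *: partial 1 (f \o phi) u = 0 ->
        a = 0 /\ b = 0].

Definition immersed_surface (R : realType) (kappa : R) (S : topologicalType)
    (f : S -> ambient R) : Prop :=
  [/\ hausdorff_space S,
      @second_countable S,
      forall q, M2xR kappa (f q) &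
      forall q, exists U phi, local_param f U phi /\ (phi @` U) q].

(** * Unit normal, angle function and mean curvature *)

(* v is orthogonal to the tangent plane of the surface at q. This does not     *)
(* depend on the parametrization.                                              *)
Definition normal_at (R : realType) (kappa : R) (S : topologicalType)
    (f : S -> ambient R) (q : S) (v : ambient R) : Prop :=
  exists U phi u, [/\ local_param f U phi, U u, phi u = q &
    forall i, form4 kappa (partial i (f \o phi) u) v = 0].

Definition unit_normal (R : realType) (kappa : R) (S : topologicalType)
    (f eta : S -> ambient R) : Prop :=
  continuous eta /\
  forall q, [/\ tangent_M2xR kappa (f q) (eta q),
    form4 kappa (eta q) (eta q) = 1 & normal_at kappa f q (eta q)].

Definition angle (R : realType) (kappa : R) (S : topologicalType)
    (eta : S -> ambient R) (q : S) : R :=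
  form4 kappa (eta q) (d_z R).

Definition first_form (R : realType) (kappa : R)
    (X : 'rV[R]_2 -> ambient R) (u : 'rV[R]_2) : 'M[R]_2 :=
  \matrix_(i, j) form4 kappa (partial i X u) (partial j X u).

(* The covariant derivative of partial j X along partial i X in M^2(kappa) x R *)
(* is the tangential part of the second derivative of X in R^3 x R; the other  *)
(* part is orthogonal to v when v is tangent to M^2(kappa) x R.                *)
Definition second_form (R : realType) (kappa : R)
    (X : 'rV[R]_2 -> ambient R) (v : ambient R) (u : 'rV[R]_2) : 'M[R]_2 :=
  \matrix_(i, j) form4 kappa (partial i (partial j X) u) v.

(* The eigenvalues of the shape operator are the principal curvatures. With    *)
(* this sign, a graph z = w oriented upwards has trace                         *)
(* div (grad w / sqrt (1 + |grad w|^2)).                                       *)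
Definition shape_operator (R : realType) (kappa : R)
    (X : 'rV[R]_2 -> ambient R) (v : ambient R) (u : 'rV[R]_2) : 'M[R]_2 :=
  invmx (first_form kappa X u) *m second_form kappa X v u.

(* h is the mean curvature at q with respect to eta. The value h does not      *)
(* depend on the parametrization.                                              *)
Definition mean_curvature_at (R : realType) (kappa : R) (S : topologicalType)
    (f eta : S -> ambient R) (q : S) (h : R) : Prop :=
  exists U phi u, [/\ local_param f U phi, U u, phi u = q &
    h = \tr (shape_operator kappa (f \o phi) (eta q) u) / 2].

Definition H_surface (R : realType) (kappa : R) (H : R -> R)
    (S : topologicalType) (f eta : S -> ambient R) : Prop :=
  [/\ immersed_surface kappa f, unit_normal kappa f eta &
      forall q, mean_curvature_at kappa f eta q (H (angle kappa eta q))].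

(** * Embedded rotational spheres *)

(* f is a homeomorphism onto its image. *)
Definition topological_embedding (S T : topologicalType) (f : S -> T) : Prop :=
  [/\ continuous f, injective f &
      forall A, open A -> exists2 B, open B & f @^-1` B = A].

(* S is homeomorphic to the unit sphere M2 1 of R^3. *)
Definition is_sphere (R : realType) (S : topologicalType) : Prop :=
  exists2 g : S -> 'rV[R]_3, topological_embedding g & range g = M2 1.

(* x |-> x *m A is a rotation of M^2(kappa) about p; the corresponding         *)
(* rotation of M^2(kappa) x R about {p} x R is (x, t) |-> (x *m A, t).         *)
Definition rotation_about (R : realType) (kappa : R) (p : 'rV[R]_3)
    (A : 'M[R]_3) : Prop :=
  [/\ forall x y, form3 kappa (x *m A) (y *m A) = form3 kappa x y,
      \det A = 1 & p *m A = p].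

Definition rotational (R : realType) (kappa : R) (D : set (ambient R)) : Prop :=
  exists2 p, M2 kappa p & forall A, rotation_about kappa p A ->
    [set (q.1 *m A, q.2) | q in D] = D.

(** * The prescribed functions *)

(* H is of class C^1 on the closed interval [-1, 1], with one-sided            *)
(* derivatives at the endpoints; its values outside [-1, 1] are irrelevant.    *)
Definition C1_on_I (R : realType) (H : R -> R) : Prop :=
  exists2 dH : R -> R, {within `[-1, 1], continuous dH} &
    forall y, -1 <= y <= 1 ->
      (H x - H y) / (x - y) @[x --> within `[-1, 1] y^'] --> dH y.

Definition class_C1_kappa (R : realType) (kappa : R) (H : R -> R) : Prop :=
  [/\ C1_on_I H,
      forall y, -1 <= y <= 1 -> H y = H (- y) &
      kappa = -1 ->
        forall y, -1 <= y <= 1 -> Num.sqrt (1 - y ^+ 2) < 2 * `|H y|].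

(* A zero y has infinite multiplicity when H x = o((x - y)^n) as x tends to y, *)
(* for every n.                                                                *)
Definition isolated_finite_zeros (R : realType) (H : R -> R) : Prop :=
  forall y, -1 <= y <= 1 -> H y = 0 ->
    (\forall x \near within `[-1, 1] y^', H x != 0) /\
    exists n : nat, ~ (H x / (x - y) ^+ n @[x --> within `[-1, 1] y^'] --> 0).

(* Main.v *)
Require Import Defs.
From HB Require Import structures.
From mathcomp Require Import all_boot all_order all_algebra.
From mathcomp Require Import all_classical all_reals all_analysis.
From mathcomp Require Import ring lra.

Set Implicit Arguments.
Unset Strict Implicit.
Unset Printing Implicit Defensive.

Import Order.TTheory GRing.Theory Num.Theory.
Import numFieldNormedType.Exports.

Local Open Scope classical_set_scope.
Local Open Scope ring_scope.

Implicit Types (R : realType).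

(** The sphere is a surface of revolution about the third axis of the first
    factor, and everything rests on one scalar differential equation for its
    profile. Let [rho] be the distance to the axis, [theta] the angle of the
    profile with the horizontal, [v = kappa (1 - cos_kappa rho)] and
    [S = sin_kappa rho]. In the variable [v], the function [y = S sin theta]
    satisfies [dy/dv = 2 H(cos theta)], [cos theta] being the angle function of
    the surface. The right-hand side is bounded, so that Peano's theorem
    ([peano], [phase_equation]) gives a solution starting at the axis.
    Reversing the normal if necessary, one may suppose [H(1) > 0]; when
    [H(1) = 0], a horizontal slice is a solution, and only [kappa = 1] occurs.

    Starting at the axis, the profile stays ascending because [H(1) > 0] keeps
    [y] positive ([phase_positive]), and it becomes vertical: on the sphere it
    cannot reach the opposite axis ([phase_vertical_sphere]), and in the
    hyperbolic plane the inequality [2 |H(s)| > sqrt (1 - s^2)] makes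
    [sin theta] reach [1] ([phase_vertical_hyperbolic]). At the first vertical
    point the profile has nonzero curvature: otherwise it would touch a vertical
    cylinder which is itself a solution, and since [H] is even, hence flat at
    [0], such a cylinder is a centre of the phase plane ([phase_turns]).
    Therefore the vertical point has finite height ([height_exists]). Reflecting
    the profile at that height changes the sign of the angle function, which the
    even function [H] does not see, and closes it up ([profile_exists]).

    It remains to check that the surface swept out is a C^2 embedded sphere with
    the right mean curvature. Away from the poles it is parametrized by the
    height and the angle of rotation ([tube_patch], [tube_curvature]). At a
    pole, in Lambert's equal-area coordinates, half the squared norm of the
    parameter is exactly [v], so the height is a radial function whose
    regularity can be read off the equation ([radial_class_C2], [cap_patch],
    [capX_curvature]). Compactness turns the obvious bijection with the round
    sphere into a homeomorphism ([revolution_is_sphere]). *)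

(** * Difference quotients and limits along ultrafilters *)

Lemma is_derive1_eps R (f : R -> R) (t l : R) :
  (forall e, 0 < e -> exists2 r, 0 < r & forall h, `|h| < r ->
     `|f (t + h) - f t - h * l| <= e * `|h|) ->
  is_derive t 1 f l.
Proof.
move=> fl.
have cvgl : h^-1 *: (f (h *: 1 + t) - f t) @[h --> 0^'] --> l.
  apply/cvgrPdist_le => e e0; have [r r0 fr] := fl _ e0.
  exists r => //= h; rewrite /= distrC subr0 => hr h0.
  have hp : 0 < `|h| by rewrite normr_gt0.
  have -> : l - h^-1 *: (f (h *: 1 + t) - f t) =
      - (h^-1 * (f (t + h) - f t - h * l)).
    rewrite /GRing.scale /= mulr1 (addrC h t) [in RHS]mulrBr mulrA mulVf //.
    by rewrite mul1r opprB.
  rewrite normrN normrM normfV mulrC ler_pdivrMr //; exact: fr.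
by apply: DeriveDef; [apply/cvg_ex; exists l | exact/cvg_lim].
Qed.

Lemma ultra_bounded_cvg R (T : Type) (G : set_system T)
    (f : T -> R) (B : R) :
  UltraFilter G -> (forall n, `|f n| <= B) -> exists l : R, f @ G --> l.
Proof.
move=> GU fB; have PG : ProperFilter G := @ultra_proper _ _ GU.
have GB : G (f @^-1` `[- B, B]%classic).
  by apply: filterE => n /=; rewrite in_itv /= -ler_norml.
have [p [_ clp]] := @segment_compact R (- B) B (f @ G) _ GB.
exists p; apply/cvgrPdist_lt => e e0.
have [//|Gc] := in_ultra_setVsetC [set n | `|p - f n| < e] GU.
have : (f @ G) [set x | ~ `|p - x| < e] by [].
have pb : @nbhs R R p (@ball R R p e) by exact: (nbhsx_ballx p e e0).
by move=> /clp - /(_ _ pb) [x [/= ]].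
Qed.

(** * Existence of solutions of a scalar differential equation *)

Fixpoint euler R (F : R -> R -> R) (h : R) (k : nat) : R :=
  if k is k'.+1 then
    euler F h k' + h * F (h * k'%:R) (euler F h k')
  else 0.

Definition grid R (h t : R) : nat := Num.truncn (t / h).

Lemma grid_itv R (h t : R) : 0 < h -> 0 <= t ->
  h * (grid h t)%:R <= t < h * (grid h t)%:R + h.
Proof.
move=> h0 t0; have := @truncn_itv _ (t / h); rewrite -/(grid h t).
rewrite divr_ge0 ?(ltW h0) // => /(_ isT) /andP[].
rewrite ler_pdivlMr // ltr_pdivrMr // -natr1 mulrDl mul1r => a b.
by rewrite mulrC a b.
Qed.

Lemma grid_le R (h s t : R) : 0 < h -> s <= t ->
  (grid h s <= grid h t)%N.
Proof.
move=> h0 st; have [s0|s0] := leP 0 s; last first.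
  by rewrite /grid truncn_floor leNgt pmulr_llt0 ?invr_gt0 // s0.
have t0 := le_trans s0 st.
rewrite /grid truncn_ge_nat ?divr_ge0 ?(ltW h0) //.
apply: (@le_trans _ _ (s / h)); last by rewrite ler_pM2r // invr_gt0.
by rewrite truncn_le divr_ge0 ?(ltW h0).
Qed.

(** The estimate behind the method: as long as the slopes of the polygon stay
    within [e] of [l], so do its chords. *)
Lemma euler_chord R (F : R -> R -> R) (h e l : R) (i n : nat) :
  0 <= h ->
  (forall k, (i <= k < i + n)%N -> `|F (h * k%:R) (euler F h k) - l| <= e) ->
  `|euler F h (i + n) - euler F h i - h * n%:R * l| <= e * (h * n%:R).
Proof.
move=> h0; elim: n => [|n IH] Fe.
  by rewrite addn0 subrr !mulr0 mul0r subr0 normr0.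
rewrite addnS /= -natr1.
have -> : euler F h (i + n) + h * F (h * (i + n)%:R) (euler F h (i + n)) -
   euler F h i - h * (n%:R + 1) * l =
   (euler F h (i + n) - euler F h i - h * n%:R * l) +
   h * (F (h * (i + n)%:R) (euler F h (i + n)) - l) by ring.
rewrite (le_trans (ler_normD _ _)) //.
have -> : e * (h * (n%:R + 1)) = e * (h * n%:R) + e * h by ring.
apply: lerD.
  by apply: IH => k /andP[ik kn]; apply: Fe; rewrite ik addnS ltnW.
rewrite normrM ger0_norm // mulrC ler_wpM2r //; apply: Fe.
by rewrite leq_addr addnS ltnSn.
Qed.

Lemma euler_lip R (F : R -> R -> R) (h M : R) (i j : nat) :
  0 <= h -> (forall t y, `|F t y| <= M) -> (i <= j)%N ->
  `|euler F h j - euler F h i| <= M * (h * j%:R - h * i%:R).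
Proof.
move=> h0 FM ij; rewrite -mulrBr -natrB //.
have := @euler_chord R F h M 0 i (j - i) h0; rewrite subnKC // !mulr0 subr0.
by apply=> k _; rewrite subr0.
Qed.

(** The solution is the limit, along a free ultrafilter on the step numbers, of
    Euler's polygons. The chord estimate is a closed condition, so it passes to
    the limit and becomes a statement about the difference quotients of [y]. *)
Lemma peano_halfline R (F : R -> R -> R) (M : R) :
  (forall t y, `|F t y| <= M) ->
  exists y : R -> R, [/\ y 0 = 0,
    forall s t, 0 <= s -> s <= t -> `|y t - y s| <= M * (t - s) &
    forall t, 0 < t ->
      {for (t, y t), continuous (fun q : R * R => F q.1 q.2)} ->
      is_derive t 1 y (F t (y t))].
Proof.
move=> FM; have M0 : 0 <= M by apply: le_trans (FM 0 0).
pose h (n : nat) : R := n.+1%:R^-1.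
have h0 n : 0 < h n by rewrite invr_gt0 ltr0Sn.
have hge0 n := ltW (h0 n).
have h1 n : h n <= 1 by rewrite invf_le1 ?ltr0Sn // ler1n.
have [G [GU ooG]] := ultraFilterLemma eventually_filter.
have PG : ProperFilter G := @ultra_proper _ _ GU.
have hG : h @ G --> 0 by move=> A /(@cvg_harmonic R) /ooG.
pose gr n t := h n * (grid (h n) t)%:R.
have gr_itv n t : 0 <= t -> gr n t <= t < gr n t + h n by exact: grid_itv.
have grD t : 0 <= t -> gr ^~ t @ G --> t.
  move=> t0; apply/cvgrPdist_lt => e e0.
  move/cvgrPdist_lt: hG => /(_ e e0); apply: filterS => n /=.
  rewrite sub0r normrN gtr0_norm // => he.
  have /andP[a b] := gr_itv n t t0.
  rewrite ger0_norm ?subr_ge0 //; lra.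
pose Y n t := euler F (h n) (grid (h n) t).
have Ylip n s t : s <= t -> `|Y n t - Y n s| <= M * (gr n t - gr n s).
  by move=> st; apply: euler_lip => //; exact: grid_le.
have Yneg n t : t <= 0 -> Y n t = 0.
  rewrite /Y /grid => t0; suff -> : Num.truncn (t / h n) = 0%N by [].
  apply/eqP; rewrite -leqn0 -(@truncn0 R) -/(grid _ _).
  by rewrite -(mul0r (h n)^-1); exact: (@grid_le R (h n) t 0).
have Y0 n : Y n 0 = 0 by exact: Yneg.
have gr0 n : gr n 0 = 0 by rewrite /gr /grid mul0r truncn0 mulr0.
have Yb t n : `|Y n t| <= M * `|t|.
  have [t0|t0] := leP t 0; first by rewrite Yneg // normr0 mulr_ge0.
  have := Ylip n _ _ (ltW t0); rewrite Y0 gr0 !subr0 => /le_trans; apply.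
  have /andP[a _] := gr_itv n t (ltW t0).
  by rewrite ler_wpM2l // (gtr0_norm t0).
pose y t := projT1 (cid (ultra_bounded_cvg GU (Yb t))).
have yP t : Y ^~ t @ G --> y t by exact: (projT2 (cid (ultra_bounded_cvg GU (Yb t)))).
exists y; split.
- have := yP 0; have -> : Y ^~ 0 = fun=> 0 by apply/funext => n; rewrite Y0.
  by move=> /cvg_lim <- //; rewrite lim_cst.
- move=> s t s0 st; have t0 := le_trans s0 st.
  apply: (@ler_cvg_to _ G _ R (fun n => `|Y n t - Y n s|)
    (fun n => M * (gr n t - gr n s))).
  + by apply: cvg_norm; apply: cvgB; exact: yP.
  + by apply: cvgMr; apply: cvgB; exact: grD.
  + by apply: filterE => n; exact: Ylip.
- move=> t t0 Fc; set l := F t (y t).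
  have chord e : 0 < e -> exists2 r, 0 < r & forall s1 s2,
      t - r < s1 -> s1 <= s2 -> s2 < t + r ->
      `|y s2 - y s1 - (s2 - s1) * l| <= e * (s2 - s1).
    move=> e0.
    have /cvgrPdist_le /(_ e e0) := Fc; rewrite -nbhs_ballE /= => -[d /= d0 dF].
    (* within r of t the polygons, being M-Lipschitz, stay within d of (t, y t) *)
    pose r := Num.min (t / 2) (Num.min (d / 4) (d / (8 * (M + 1)))).
    have r0 : 0 < r by rewrite !lt_min !divr_gt0 ?mulr_gt0 //; lra.
    have rt : r <= t / 2 by rewrite ge_min lexx.
    have rd : r <= d / 4 by rewrite !ge_min lexx orbT.
    have rM : r * (8 * (M + 1)) <= d.
      by rewrite -ler_pdivlMr ?mulr_gt0 //; [rewrite !ge_min lexx !orbT | lra].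
    exists r => // s1 s2 ts s12 st.
    have s10 : 0 <= s1 by lra.
    have s20 := le_trans s10 s12.
    apply: (@ler_cvg_to _ G _ R
      (fun n => `|Y n s2 - Y n s1 - (gr n s2 - gr n s1) * l|)
      (fun n => e * (gr n s2 - gr n s1))).
    + apply: cvg_norm; apply: cvgB; first by apply: cvgB; exact: yP.
      by apply: cvgMl; apply: cvgB; exact: grD.
    + by apply: cvgMr; apply: cvgB; exact: grD.
    + have hr : \forall n \near G, h n < r.
        move/cvgrPdist_lt: hG => /(_ r r0); apply: filterS => n /=.
        by rewrite sub0r normrN gtr0_norm.
      have yr : \forall n \near G, `|y t - Y n t| < d / 2.
        by move/cvgrPdist_lt: (yP t); apply; rewrite divr_gt0.
      apply: filterS2 hr yr => n hr yr.
      have ij := grid_le (h0 n) s12.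
      have -> : gr n s2 - gr n s1 = h n * (grid (h n) s2 - grid (h n) s1)%:R.
        by rewrite natrB // mulrBr.
      rewrite /Y -{1}(subnKC ij); apply: euler_chord => // k.
      rewrite subnKC // => /andP[ik kj]; rewrite distrC.
      have ab : gr n s1 <= h n * k%:R <= gr n s2.
        by rewrite /gr !ler_pM2l // !ler_nat ik ltnW.
      case/andP: ab => a b.
      have /andP[s1a s1b] := gr_itv n s1 s10.
      have /andP[s2a s2b] := gr_itv n s2 s20.
      have /andP[ta tb] := gr_itv n t (ltW t0).
      apply: (dF (h n * k%:R, euler F (h n) k)); split => /=.
        by rewrite /ball /= ltr_norml; apply/andP; split; lra.
      have kY : `|euler F (h n) k - Y n t| <= M * (3 * r).
        have [kt|tk] := leqP k (grid (h n) t).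
          rewrite distrC; apply: le_trans (euler_lip (hge0 n) FM kt) _.
          rewrite ler_wpM2l // -/(gr n t); lra.
        apply: le_trans (euler_lip (hge0 n) FM (ltnW tk)) _.
        rewrite ler_wpM2l // -/(gr n t); lra.
      rewrite /ball /= -(subrK (Y n t) (y t)) -addrA.
      rewrite (le_lt_trans (ler_normD _ _)) // (distrC (Y n t)).
      apply: (@lt_le_trans _ _ (d / 2 + M * (3 * r))); first exact: ltr_leD.
      nra.
  apply: is_derive1_eps => e e0; have [r r0 yr] := chord e e0.
  exists r => // k; rewrite ltr_norml => /andP[k1 k2].
  have [kp|kn] := leP 0 k.
    rewrite (ger0_norm kp); have := yr t (t + k).
    by rewrite (addrC t k) addrK; apply; lra.
  have := yr (t + k) t; have -> : t - (t + k) = - k by ring.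
  rewrite (ltr0_norm kn) distrC.
  have -> : y (t + k) - y t - k * l = - (y t - y (t + k) - - k * l) by ring.
  by rewrite normrN distrC; apply; lra.
Qed.

(** * Elementary calculus *)

Lemma continuous1_eps R (f : R -> R) (t : R) :
  {for t, continuous f} <->
  forall e, 0 < e -> exists2 r, 0 < r & forall x, `|x - t| < r ->
    `|f x - f t| < e.
Proof.
split=> [/cvgrPdist_lt fc e /fc|fc].
  rewrite -nbhs_ballE => -[r /= r0 rf]; exists r => // x xt.
  by rewrite distrC; apply: rf; rewrite /ball /= distrC.
apply/cvgrPdist_lt => e /fc [r r0 rf]; exists r => //= x /=.
by rewrite distrC => /rf; rewrite distrC.
Qed.

Lemma is_derive1_epsE R (f : R -> R) (t l : R) :
  is_derive t 1 f l ->
  forall e, 0 < e -> exists2 r, 0 < r & forall h, `|h| < r ->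
     `|f (t + h) - f t - h * l| <= e * `|h|.
Proof.
case=> /= dft; rewrite /derive => lE e e0.
have /cvgrPdist_le/(_ e e0) :
    h^-1 *: (f (h *: 1 + t) - f t) @[h --> 0^'] --> l by rewrite -lE.
case=> r /= r0 rf; exists r => // h hr.
have [->|h0] := eqVneq h 0.
  by rewrite addr0 subrr mul0r subr0 normr0 mulr0.
have := rf h; rewrite /= sub0r normrN => /(_ hr h0) le.
have -> : f (t + h) - f t - h * l =
   - h * (l - h^-1 *: (f (h *: 1 + t) - f t)).
  rewrite /GRing.scale /= mulr1 (addrC h t) mulNr mulrBr mulrA mulfV //.
  by rewrite mul1r opprB.
by rewrite normrM normrN mulrC ler_wpM2r.
Qed.

Lemma is_derive1_continuous R (f : R -> R) (t l : R) :
  is_derive t 1 f l -> {for t, continuous f}.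
Proof. by move=> [df _]; apply/differentiable_continuous/derivable1_diffP. Qed.

Lemma mvt R (f df : R -> R) (a b : R) : a < b ->
  (forall x, a <= x <= b -> {for x, continuous f}) ->
  (forall x, a < x < b -> is_derive x 1 f (df x)) ->
  exists2 c, a < c < b & f b - f a = df c * (b - a).
Proof.
move=> ab fc fd.
have fd' x : x \in `]a, b[ -> is_derive x 1 f (df x).
  by rewrite in_itv; exact: fd.
have fc' : {within `[a, b], continuous f}.
  by apply: continuous_in_subspaceT => x; rewrite inE /= in_itv; exact: fc.
have [c cab ->] := MVT ab fd' fc'.
by exists c => //; rewrite in_itv in cab.
Qed.

(** A derivative has no removable discontinuity. *)
Lemma is_derive1_limit R (f df : R -> R) (t r : R) : 0 < r ->
  (forall s, `|s - t| < r -> s != t -> is_derive s 1 f (df s)) ->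
  {for t, continuous f} -> {for t, continuous df} ->
  is_derive t 1 f (df t).
Proof.
move=> r0 fd fc /continuous1_eps dfc; apply: is_derive1_eps => e e0.
have [d d0 dd] := dfc e e0; exists (Num.min r d); first by rewrite lt_min r0.
move=> h; rewrite lt_min => /andP[hr hd].
have near_cont s : `|s - t| < r -> {for s, continuous f}.
  have [->//|st] := eqVneq s t => sr.
  exact: is_derive1_continuous (fd s sr st).
have close c : `|df c - df t| <= e ->
   `|df c * h - h * df t| <= e * `|h|.
  by move=> ?; rewrite mulrC -mulrBr normrM mulrC ler_wpM2r.
have [h0|h0|->] := ltgtP h 0.
- rewrite ltr0_norm // in hr hd.
  have [|x|x|c /andP[c1 c2] E] := @mvt R f df (t + h) t.
  + lra.
  + by move=> /andP[a b]; apply: near_cont; rewrite ltr_norml; lra.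
  + move=> /andP[a b]; apply: fd; last by rewrite lt_eqF.
    by rewrite ltr_norml; lra.
  + have -> : f (t + h) - f t = df c * h by nra.
    apply: close; apply/ltW/dd; rewrite ltr_norml; lra.
- rewrite gtr0_norm // in hr hd.
  have [|x|x|c /andP[c1 c2] E] := @mvt R f df t (t + h).
  + lra.
  + by move=> /andP[a b]; apply: near_cont; rewrite ltr_norml; lra.
  + move=> /andP[a b]; apply: fd; last by rewrite gt_eqF.
    by rewrite ltr_norml; lra.
  + have -> : f (t + h) - f t = df c * h by nra.
    apply: close; apply/ltW/dd; rewrite ltr_norml; lra.
- by rewrite addr0 subrr mul0r subr0 normr0 mulr0.
Qed.

Lemma first_zero R (f : R -> R) (a b : R) : a <= b ->
  (forall x, a <= x <= b -> {for x, continuous f}) ->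
  f a < 0 -> 0 <= f b ->
  exists2 c, a < c <= b & f c = 0 /\ forall x, a <= x < c -> f x < 0.
Proof.
move=> ab fc fa fb; pose A := [set x | a <= x <= b /\ 0 <= f x].
have Ab : A b by split=> //; rewrite ab lexx.
have Al : lbound A a by move=> x [/andP[]].
have Ai : has_inf A by split; [exists b | exists a].
pose c := inf A; have ac : a <= c by apply: lb_le_inf => //; exists b.
have cb : c <= b by apply: ge_inf => //; exists a.
have lt0 x : a <= x < c -> f x < 0.
  move=> /andP[ax xc]; rewrite ltNge; apply/negP => fx.
  have : c <= x; last by rewrite leNgt xc.
  by apply: ge_inf; [exists a | split=> //; rewrite ax /=; lra].
have /continuous1_eps cc : {for c, continuous f} by apply: fc; rewrite ac.
have fc0 : f c = 0.
  apply/eqP; rewrite eq_le; apply/andP; split; rewrite leNgt; apply/negP => f0.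
  - have {}ac : a < c.
      rewrite lt_neqAle ac andbT; apply/eqP => E.
      by rewrite -E ltNge (ltW fa) in f0.
    have [d d0 dd] := cc _ f0; pose x := Num.max a (c - d / 2).
    have x1 : a <= x by rewrite le_max lexx.
    have x2 : c - d / 2 <= x by rewrite le_max lexx orbT.
    have x3 : x < c by rewrite gt_max ac /=; lra.
    have := lt0 x; rewrite x1 x3 => /(_ isT) fx.
    have := dd x; rewrite ltr_norml ltr_norml.
    have -> : - d < x - c < d by apply/andP; split; lra.
    by move=> /(_ isT) /andP[]; lra.
  - have /cc [d d0 dd] : 0 < - f c by rewrite oppr_gt0.
    have [x [xab fx] xd] := inf_adherent d0 Ai.
    have cx : c <= x by apply: ge_inf => //; exists a.
    have := dd x; rewrite ltr_norml ltr_norml.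
    have -> : - d < x - c < d by rewrite -/c in xd; apply/andP; split; lra.
    by move=> /(_ isT) /andP[]; lra.
exists c => //; rewrite cb andbT lt_neqAle ac andbT; apply/eqP => E.
by rewrite -E in fc0; rewrite fc0 ltxx in fa.
Qed.

Lemma continuous_le0_right R (f : R -> R) (a b : R) : a < b ->
  {for b, continuous f} -> (forall x, a < x < b -> f x <= 0) -> f b <= 0.
Proof.
move=> ab /continuous1_eps fc f0; rewrite leNgt; apply/negP => /fc [d d0 dd].
pose x := Num.max ((a + b) / 2) (b - d / 2).
have x1 : (a + b) / 2 <= x by rewrite le_max lexx.
have x2 : b - d / 2 <= x by rewrite le_max lexx orbT.
have x3 : x < b by rewrite gt_max; apply/andP; split; lra.
have := f0 x; have -> : a < x < b by apply/andP; split; lra.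
have := dd x; rewrite !ltr_norml.
have -> : - d < x - b < d by apply/andP; split; lra.
by move=> /(_ isT) /andP[a1 a2] /(_ isT); lra.
Qed.

Lemma continuous_itv_min R (f : R -> R) (a b : R) : a <= b ->
  (forall x, a <= x <= b -> {for x, continuous f}) ->
  exists2 c, a <= c <= b & forall x, a <= x <= b -> f c <= f x.
Proof.
move=> ab fc; have [|c] := @EVT_min R f a b ab.
  by apply: continuous_in_subspaceT => x; rewrite inE /= in_itv; exact: fc.
by rewrite in_itv => cab fm; exists c => // x xab; apply: fm; rewrite in_itv.
Qed.

(** The derivative gives the bound close to [b], and compactness elsewhere. *)
Lemma linear_lower_bound R (f : R -> R) (a b d : R) : a < b ->
  (forall x, a <= x <= b -> {for x, continuous f}) ->
  (forall x, a <= x < b -> 0 < f x) -> f b = 0 ->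
  is_derive b 1 f d -> d < 0 ->
  exists2 m, 0 < m & forall x, a <= x <= b -> m * (b - x) <= f x.
Proof.
move=> ab fc f0 fb /is_derive1_epsE fd d0.
have [r r0 rf] := fd (- d / 2) ltac:(lra).
pose a' := Num.max a (b - r / 2).
have a1 : a <= a' by rewrite le_max lexx.
have a2 : b - r / 2 <= a' by rewrite le_max lexx orbT.
have a3 : a' < b by rewrite gt_max ab /=; lra.
have [|c /andP[ac ca] fm] := @continuous_itv_min R f a a' a1.
  by move=> x /andP[? ?]; apply: fc; lra.
have fc0 : 0 < f c by apply: f0; lra.
have fcb : 0 < f c / (b - a) by rewrite divr_gt0 // subr_gt0.
exists (Num.min (- d / 2) (f c / (b - a))).
  by rewrite lt_min fcb andbT; lra.
move=> x /andP[ax xb]; have [xa|xa] := leP x a'.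
  apply: (@le_trans _ _ (f c)); last by apply: fm; rewrite ax.
  apply: (@le_trans _ _ (f c / (b - a) * (b - x))).
    by rewrite ler_wpM2r ?subr_ge0 // ge_min lexx orbT.
  by rewrite -mulrA ler_piMr ?(ltW fc0) // ler_pdivrMl ?subr_gt0 //; lra.
apply: (@le_trans _ _ (- d / 2 * (b - x))).
  by rewrite ler_wpM2r ?subr_ge0 // ge_min lexx.
have := rf (x - b); rewrite (addrC b) subrK fb subr0 ler0_norm ?subr_le0 //.
by move=> /(_ ltac:(lra)); rewrite ler_norml => /andP[]; nra.
Qed.

(** * Differentiation and continuity of expressions *)

Lemma is_derive1_line R (V W : normedModType R) (f : V -> W)
    (u e : V) (l : W) :
  is_derive u e f l <-> is_derive (0 : R) 1 (fun h => f (h *: e + u)) l.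
Proof.
have E : (fun h => h^-1 *: (((fun k : R => f (k *: e + u)) \o shift 0) (h *: 1)
    - f (0 *: e + u))) = (fun h : R => h^-1 *: ((f \o shift u) (h *: e) - f u)).
  apply/funext => h /=.
  by rewrite addr0 scale0r add0r /GRing.scale /= mulr1.
split; case=> df dE; apply: DeriveDef.
- by rewrite /derivable E.
- by rewrite /derive E.
- by move: df; rewrite /derivable E.
- by move: dE; rewrite /derive E.
Qed.

Lemma der_eq (R : numFieldType) (V W : normedModType R) (f : V -> W)
    (u e : V) (a b : W) : is_derive u e f a -> a = b -> is_derive u e f b.
Proof. by move=> ? <-. Qed.

Lemma der_cst (R : numFieldType) (V W : normedModType R) (u e : V) (a : W) :
  is_derive u e (fun=> a) 0.
Proof. exact: is_derive_cst. Qed.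

Lemma der_id (R : numFieldType) (V : normedModType R) (u e : V) :
  is_derive u e (fun x => x) e.
Proof. exact: is_derive_id. Qed.

Lemma der_add (R : numFieldType) (V W : normedModType R) (f g : V -> W)
    (u e : V) (a b : W) : is_derive u e f a -> is_derive u e g b ->
  is_derive u e (fun x => f x + g x) (a + b).
Proof. by move=> ? ?; exact: is_deriveD. Qed.

Lemma der_opp (R : numFieldType) (V W : normedModType R) (f : V -> W)
    (u e : V) (a : W) : is_derive u e f a ->
  is_derive u e (fun x => - f x) (- a).
Proof. by move=> ?; exact: is_deriveN. Qed.

Lemma der_mul R (V : normedModType R) (f g : V -> R)
    (u e : V) (a b : R) : is_derive u e f a -> is_derive u e g b ->
  is_derive u e (fun x => f x * g x) (a * g u + f u * b).
Proof.
move=> df dg; have -> : (fun x => f x * g x) = f * g.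
  by apply/funext => x; rewrite fctE.
refine (der_eq (is_deriveM df dg) _).
by rewrite /GRing.scale /= addrC mulrC.
Qed.

Lemma der_exp R (V : normedModType R) (f : V -> R)
    (u e : V) (a : R) n : is_derive u e f a ->
  is_derive u e (fun x => f x ^+ n.+1) (n.+1%:R * f u ^+ n * a).
Proof.
move=> df; have -> : (fun x => f x ^+ n.+1) = f ^+ n.+1.
  by apply/funext => x; rewrite fctE.
refine (der_eq (is_deriveX n.+1 df) _).
by rewrite /= -mulr_natl /GRing.scale /=.
Qed.

Lemma der_comp R (V : normedModType R) (f : V -> R) (g : R -> R)
    (u e : V) (a b : R) : is_derive (f u) 1 g a -> is_derive u e f b ->
  is_derive u e (fun x => g (f x)) (a * b).
Proof.
move=> dg /is_derive1_line df; apply/is_derive1_line.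
apply: (@is_derive1_comp R g (fun h : R => f (h *: e + u)) 0 a b) => //.
by rewrite scale0r add0r.
Qed.

Lemma der_inv R (V : normedModType R) (f : V -> R)
    (u e : V) (a : R) : f u != 0 -> is_derive u e f a ->
  is_derive u e (fun x => (f x)^-1) (- f u ^- 2 * a).
Proof.
move=> f0 df; apply: (@der_comp _ _ f (fun x => x^-1)) => //.
apply: der_eq; first exact: (is_deriveV (f := id)).
by rewrite /GRing.scale /= mulr1.
Qed.

Lemma der_sqrt R (V : normedModType R) (f : V -> R)
    (u e : V) (a : R) : 0 < f u -> is_derive u e f a ->
  is_derive u e (fun x => Num.sqrt (f x)) ((2 * Num.sqrt (f u))^-1 * a).
Proof. by move=> f0 df; apply: der_comp => //; exact: is_derive1_sqrt. Qed.

(** Differentiates an expression built from functions whose derivatives are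
    in the context; side conditions are left to the user. *)
Ltac der :=
  cbv beta;
  first
  [ eassumption
  | lazymatch goal with
    | |- is_derive _ _ (fun x => x) _ => eapply der_id
    | |- is_derive _ _ (fun x => @?f x + @?g x) _ => eapply der_add; der
    | |- is_derive _ _ (fun x => - @?f x) _ => eapply der_opp; der
    | |- is_derive _ _ (fun x => @?f x * @?g x) _ => eapply der_mul; der
    | |- is_derive _ _ (fun x => @?f x ^+ _) _ => eapply der_exp; der
    | |- is_derive _ _ (fun x => (@?f x)^-1) _ => eapply der_inv; [ | der]
    | |- is_derive _ _ (fun x => Num.sqrt (@?f x)) _ =>
        eapply der_sqrt; [ | der]
    | |- is_derive _ _ (fun x => _) _ => eapply der_cst
    | |- is_derive _ _ (GRing.mul ?k) _ =>
        eapply (@der_mul _ _ (fun=> k) (fun x => x)); der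
    | |- is_derive _ _ (GRing.add ?k) _ =>
        eapply (@der_add _ _ _ (fun=> k) (fun x => x)); der
    | |- is_derive _ _ GRing.opp _ => eapply (@der_opp _ _ _ (fun x => x)); der
    | |- is_derive _ _ GRing.inv _ =>
        eapply (@der_inv _ _ (fun x => x)); [ | der]
    | |- is_derive _ _ Num.sqrt _ =>
        eapply (@der_sqrt _ _ (fun x => x)); [ | der]
    | |- _ => idtac
    end ].

Lemma der_locally R (f g : R -> R) (t r l : R) : 0 < r ->
  (forall s, `|s - t| < r -> f s = g s) ->
  is_derive t 1 f l -> is_derive t 1 g l.
Proof.
move=> r0 fg; apply: near_eq_is_derive.
by exists r => //= s; rewrite /= distrC; exact: fg.
Qed.

Lemma continuous1_locally R (f g : R -> R) (t r : R) : 0 < r ->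
  (forall s, `|s - t| < r -> f s = g s) ->
  {for t, continuous f} -> {for t, continuous g}.
Proof.
move=> r0 fg /continuous1_eps fc; apply/continuous1_eps => e /fc [d d0 dd].
exists (Num.min r d) => [|x]; first by rewrite lt_min r0.
by rewrite lt_min => /andP[xr xd]; rewrite -!fg ?subrr ?normr0 //; exact: dd.
Qed.

Lemma ct_add R (T : topologicalType) (f g : T -> R) (t : T) :
  continuous_at t f -> continuous_at t g ->
  continuous_at t (fun x => f x + g x).
Proof. exact: cvgD. Qed.

Lemma ct_opp R (T : topologicalType) (f : T -> R) (t : T) :
  continuous_at t f -> continuous_at t (fun x => - f x).
Proof. exact: cvgN. Qed.

Lemma ct_mul R (T : topologicalType) (f g : T -> R) (t : T) :
  continuous_at t f -> continuous_at t g ->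
  continuous_at t (fun x => f x * g x).
Proof. exact: cvgM. Qed.

Lemma ct_exp R (T : topologicalType) (f : T -> R) (t : T) n :
  continuous_at t f -> continuous_at t (fun x => f x ^+ n).
Proof.
move=> fc; apply: (@continuous_comp _ _ _ f (fun x => x ^+ n)) => //.
exact: exprn_continuous.
Qed.

Lemma ct_inv R (T : topologicalType) (f : T -> R) (t : T) :
  f t != 0 -> continuous_at t f -> continuous_at t (fun x => (f x)^-1).
Proof. by move=> f0 fc; exact: cvgV. Qed.

Lemma ct_comp R (T : topologicalType) (f : T -> R) (g : R -> R)
    (t : T) : continuous_at (f t) g -> continuous_at t f ->
  continuous_at t (fun x => g (f x)).
Proof. by move=> gc fc; apply: (@continuous_comp _ _ _ f g). Qed.

Lemma ct_sqrt R (T : topologicalType) (f : T -> R) (t : T) :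
  continuous_at t f -> continuous_at t (fun x => Num.sqrt (f x)).
Proof. by move=> fc; apply: ct_comp => //; exact: sqrt_continuous. Qed.

Lemma ct_norm R (T : topologicalType) (f : T -> R) (t : T) :
  continuous_at t f -> continuous_at t (fun x => `|f x|).
Proof. exact: cvg_norm. Qed.

Lemma ct_cst (T U : topologicalType) (c : U) (t : T) :
  continuous_at t (fun=> c).
Proof. exact: cst_continuous. Qed.

Lemma ct_id (T : topologicalType) (t : T) : continuous_at t (fun x => x).
Proof. exact: cvg_id. Qed.

Ltac ct :=
  unfold prop_for; cbv beta;
  first
  [ eassumption
  | match goal with
    | H : forall x, continuous_at x ?f |- continuous_at ?t ?f => exact (H t)
    | H : forall x, continuous_at x ?g |- continuous_at ?t (fun x => ?g (@?f x))
      => eapply (@ct_comp _ _ f g); [exact (H _) | ct]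
    end
  | lazymatch goal with
    | |- continuous_at _ (fun x => x) => eapply ct_id
    | |- continuous_at _ (fun x => @?f x + @?g x) => eapply ct_add; ct
    | |- continuous_at _ (fun x => - @?f x) => eapply ct_opp; ct
    | |- continuous_at _ (fun x => @?f x * @?g x) => eapply ct_mul; ct
    | |- continuous_at _ (fun x => @?f x ^+ _) => eapply ct_exp; ct
    | |- continuous_at _ (fun x => (@?f x)^-1) => eapply ct_inv; [ | ct]
    | |- continuous_at _ (fun x => Num.sqrt (@?f x)) => eapply ct_sqrt; ct
    | |- continuous_at _ (fun x => `| @?f x |) => eapply ct_norm; ct
    | |- continuous_at _ (fun x => ?c) => eapply ct_cst
    | |- continuous_at _ GRing.opp => eapply (@ct_opp _ _ (fun x => x)); ct
    | |- continuous_at _ GRing.inv =>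
        eapply (@ct_inv _ _ (fun x => x)); [ | ct]
    | |- continuous_at _ Num.sqrt => eapply (@ct_sqrt _ _ (fun x => x)); ct
    | |- continuous_at _ Num.norm => eapply (@ct_norm _ _ (fun x => x)); ct
    | |- continuous_at _ (GRing.mul ?k) =>
        eapply (@ct_mul _ _ (fun=> k) (fun x => x)); ct
    | |- continuous_at _ (GRing.add ?k) =>
        eapply (@ct_add _ _ (fun=> k) (fun x => x)); ct
    | |- _ => idtac
    end ].

Lemma lipschitz_continuous R (f : R -> R) (M : R) :
  (forall s t, `|f t - f s| <= M * `|t - s|) -> continuous f.
Proof.
move=> fM t; apply/continuous1_eps => e e0; have M0 : 0 <= M.
  have := le_trans (normr_ge0 _) (fM 0 1).
  by rewrite subr0 normr1 mulr1.
exists (e / (M + 1)) => [|x xt]; first by rewrite divr_gt0 //; lra.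
apply: le_lt_trans (fM t x) _.
rewrite ltr_pdivlMr in xt; last lra.
by apply: le_lt_trans xt; rewrite mulrC ler_wpM2l //; lra.
Qed.

(** Peano's theorem for a bounded right-hand side, with a pointwise
    conclusion: continuity of [F] is asked only where the equation is wanted,
    so that equations that are singular at the initial time are covered. *)
Lemma peano R (F : R -> R -> R) (M : R) :
  (forall t y, `|F t y| <= M) ->
  exists y : R -> R, [/\ forall t, t <= 0 -> y t = 0,
    forall s t, `|y t - y s| <= M * `|t - s| &
    forall t, 0 < t ->
      {for (t, y t), continuous (fun q : R * R => F q.1 q.2)} ->
      is_derive t 1 y (F t (y t))].
Proof.
move=> FM; have [y [y0 ylip yd]] := peano_halfline FM.
have M0 : 0 <= M by apply: le_trans (FM 0 0).
pose z t := y (Num.max 0 t).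
have zE t : 0 <= t -> z t = y t by move=> t0; rewrite /z; congr y; exact/max_idPr.
have zlip s t : s <= t -> `|z t - z s| <= M * `|t - s|.
  move=> st; have m0 : 0 <= Num.max 0 s by rewrite le_max lexx.
  have mst : Num.max 0 s <= Num.max 0 t.
    by rewrite ge_max !le_max lexx st orbT.
  apply: le_trans (ylip _ _ m0 mst) _; rewrite ler_wpM2l // ger0_norm ?subr_ge0 //.
  by case: (leP 0 s) => ?; case: (leP 0 t) => ?; lra.
exists z; split.
- by move=> t t0; rewrite /z max_l.
- move=> s t; have [st|/ltW ts] := leP s t; first exact: zlip.
  by rewrite distrC (distrC t); exact: zlip.
- move=> t t0; rewrite zE ?ltW // => Fc.
  apply: (der_locally t0 _ (yd t t0 Fc)) => s; rewrite ltr_norml => /andP[a _].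
  rewrite zE //; lra.
Qed.

(** * The phase curve *)

(** In the variable [v = kappa (1 - cos_kappa rho)], where [rho] is the distance
    to the axis, the functions [cos_kappa rho] and [sin_kappa rho] become
    [1 - kappa v] and [sn kappa v]; no trigonometry is left. *)
Definition sn2 R (kappa v : R) : R := v * (2 - kappa * v).

Definition sn R (kappa v : R) : R := Num.sqrt (sn2 kappa v).

Lemma sn2_gt0 R (kappa v : R) :
  0 < v -> kappa * v < 2 -> 0 < sn2 kappa v.
Proof. by move=> v0 v2; rewrite mulr_gt0 // subr_gt0. Qed.

Lemma sn_gt0 R (kappa v : R) :
  0 < v -> kappa * v < 2 -> 0 < sn kappa v.
Proof. by move=> v0 v2; rewrite sqrtr_gt0 sn2_gt0. Qed.

Lemma sqr_sn R (kappa v : R) :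
  0 <= sn2 kappa v -> sn kappa v ^+ 2 = sn2 kappa v.
Proof. exact: sqr_sqrtr. Qed.

Lemma der_sn2 R (kappa v : R) :
  is_derive v 1 (sn2 kappa) (2 - 2 * kappa * v).
Proof. by rewrite /sn2; eapply der_eq; [der | rewrite /=; ring]. Qed.

Lemma der_sn R (kappa v : R) : 0 < v -> kappa * v < 2 ->
  is_derive v 1 (sn kappa) ((1 - kappa * v) / sn kappa v).
Proof.
move=> v0 v2; have s0 : sn kappa v != 0 by rewrite gt_eqF // sn_gt0.
apply: der_eq; first exact: (der_sqrt (sn2_gt0 v0 v2) (der_sn2 kappa v)).
by rewrite -/(sn kappa v); field.
Qed.

Lemma ct_sn2 R (kappa : R) : continuous (sn2 kappa).
Proof. by move=> v; exact: is_derive1_continuous (der_sn2 kappa v). Qed.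

Lemma ct_sn R (kappa : R) : continuous (sn kappa).
Proof. by move=> v; apply: ct_sqrt; exact: ct_sn2. Qed.

(** What the existence proof needs to know about the prescribed function [H],
    seen through [g x = H (sqrt (1 - x^2))], where [x] is the sine of the angle
    between the profile curve and the horizontal. In [adm_flat], the square root
    is the cosine of that angle: this is how the flatness of the even function
    [H] at [0] enters. *)
Record admissible R (kappa : R) (g : R -> R) : Prop := Admissible {
  adm_kappa : kappa = -1 \/ kappa = 1;
  adm_cont : continuous g;
  adm_bound : exists B, forall x, `|g x| <= B;
  adm_pos : 0 < g 0;
  adm_flat : forall e, 0 < e -> exists2 d, 0 < d & forall x, 0 <= x <= 1 ->
    1 - x ^+ 2 < d -> `|g x - g 1| <= e * Num.sqrt (1 - x ^+ 2);
  adm_hyp : kappa = -1 -> exists2 d, 0 < d & forall x, 0 <= x <= 1 ->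
    x + d <= 2 * g x }.

Arguments adm_cont {R kappa g} _ _.

Lemma admissible_near0 R (kappa : R) (g : R -> R) :
  admissible kappa g ->
  forall e, 0 < e -> exists2 d, 0 < d & forall x, x ^+ 2 < d ->
    `|g x - g 0| < e.
Proof.
move=> ga e e0; have gc : {for 0, continuous g} by exact: (adm_cont ga 0).
have [d d0 dd] := (continuous1_eps g 0).1 gc e e0.
exists (d ^+ 2) => [|x xd]; first exact: exprn_gt0.
apply: dd; rewrite subr0 -(ltr_pXn2r (n := 2)) ?nnegrE ?normr_ge0 ?ltW //.
by rewrite real_normK // num_real.
Qed.

Lemma phase_equation R (kappa : R) (g : R -> R) :
  admissible kappa g ->
  exists (y : R -> R) (M : R), [/\ 0 < M, y 0 = 0,
    forall s t, `|y t - y s| <= M * `|t - s| &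
    forall v, 0 < v -> kappa * v < 2 ->
      is_derive v 1 y (2 * g (y v / sn kappa v))].
Proof.
move=> ga; have [B gB] := adm_bound ga.
have B0 : 0 < B.
  by apply: lt_le_trans (gB 0); rewrite normr_gt0 gt_eqF // (adm_pos ga).
have [|y [y0 ylip yd]] :=
    @peano R (fun v y => 2 * g (y / sn kappa v)) (2 * B).
  by move=> t y; rewrite normrM ger0_norm // ler_wpM2l.
exists y, (2 * B); split; [by rewrite mulr_gt0|exact: y0|exact: ylip|].
move=> v v0 v2; apply: yd => //.
have c1 : continuous_at (v, y v) (fun q : R * R => q.1) by exact: cvg_fst.
have c2 : continuous_at (v, y v) (fun q : R * R => q.2) by exact: cvg_snd.
have cs : continuous_at (v, y v) (fun q : R * R => sn kappa q.1).
  by apply: ct_comp => //; exact: ct_sn.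
have cg : continuous g by exact: (adm_cont ga).
ct; rewrite gt_eqF //; exact: sn_gt0.
Qed.

(** Near the axis [sin theta = y / sn] is small, because [y] is Lipschitz in
    [v] while [sn] is of the order of [sqrt v]. *)
Lemma near_axis R (kappa M y v : R) :
  kappa = -1 \/ kappa = 1 -> 0 < v <= 1 -> `|y| <= M * v ->
  [/\ v <= sn2 kappa v, kappa * v < 2 & (y / sn kappa v) ^+ 2 <= M ^+ 2 * v].
Proof.
move=> k1 /andP[v0 v1] yM; have kv : kappa * v <= 1 by case: k1 => ->; lra.
have s2 : v <= sn2 kappa v by rewrite /sn2; nra.
have s0 := lt_le_trans v0 s2.
split=> //; first lra.
rewrite expr_div_n (sqr_sn (ltW s0)) ler_pdivrMr //.
have yy : y ^+ 2 <= (M * v) ^+ 2.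
  by rewrite -(real_normK (num_real y)) ler_pXn2r ?nnegrE // (le_trans _ yM).
apply: le_trans yy _.
have -> : (M * v) ^+ 2 = M ^+ 2 * v * v by ring.
by apply: ler_wpM2l s2; rewrite mulr_ge0 ?sqr_ge0 // ltW.
Qed.

(** [y] stays positive: at a zero of [y] the surface would be horizontal and
    there [y' = 2 H(1) > 0]. *)
Lemma phase_positive R (kappa M : R) (g y : R -> R) :
  admissible kappa g -> 0 < M -> y 0 = 0 ->
  (forall s t, `|y t - y s| <= M * `|t - s|) ->
  (forall v, 0 < v -> kappa * v < 2 ->
    is_derive v 1 y (2 * g (y v / sn kappa v))) ->
  forall v, 0 < v -> kappa * v < 2 -> 0 < y v.
Proof.
move=> ga M0 y0 ylip yd; have yc := lipschitz_continuous ylip.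
have yM v : 0 <= v -> `|y v| <= M * v.
  by move=> v0; have := ylip 0 v; rewrite y0 !subr0 (ger0_norm v0).
have g0 := adm_pos ga.
have [d d0 dd] := admissible_near0 ga g0.
pose r := Num.min 1 (d / (2 * M ^+ 2)).
have M2 : 0 < 2 * M ^+ 2 by rewrite mulr_gt0 ?exprn_gt0.
have r0 : 0 < r by rewrite lt_min ltr01 divr_gt0.
have r1 : r <= 1 by rewrite ge_min lexx.
have rd : r * (2 * M ^+ 2) <= d.
  by rewrite -ler_pdivlMr // ge_min lexx orbT.
have ypos v : 0 < v -> v <= r -> 0 < y v.
  move=> v0 vr; have [c /andP[c0 cv]] := @mvt R y
      (fun v => 2 * g (y v / sn kappa v)) 0 v v0 (fun x _ => yc x)
      (fun x xv => yd x ltac:(case/andP: xv => //) ltac:(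
         case: (adm_kappa ga) => -> ; case/andP: xv; lra)).
  rewrite y0 !subr0 => ->; rewrite mulr_gt0 // mulr_gt0 //.
  have c01 : 0 < c <= 1 by rewrite c0 /=; lra.
  have [_ _ xc] := near_axis (adm_kappa ga) c01 (yM c (ltW c0)).
  have /dd : (y c / sn kappa c) ^+ 2 < d by nra.
  by rewrite ltr_norml => /andP[]; lra.
move=> v v0 v2; have [vr|rv] := leP v r; first exact: ypos.
rewrite ltNge; apply/negP => yv.
have [||||c /andP[c1 c2] [yc0 cmin]] := @first_zero R (fun x => - y x) r v.
- exact: ltW.
- by move=> x _; ct.
- by rewrite oppr_lt0; exact: ypos.
- by rewrite oppr_ge0.
have c0 : 0 < c := lt_trans r0 c1.
have kc : kappa * c < 2.
  by case: (adm_kappa ga) v2 => -> v2; lra.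
have yc1 : y c = 0 by apply/eqP; rewrite -oppr_eq0 yc0.
have := yd c c0 kc; rewrite yc1 mul0r => /is_derive1_epsE /(_ _ g0) [e e0 ee].
pose h := Num.min (e / 2) (c - r).
have h0 : 0 < h by rewrite lt_min; apply/andP; split; lra.
have h1 : h <= e / 2 by rewrite ge_min lexx.
have h2 : h <= c - r by rewrite ge_min lexx orbT.
have := ee (- h); rewrite normrN (gtr0_norm h0) => /(_ ltac:(lra)).
rewrite yc1 subr0 ler_norml => /andP[_].
have := cmin (c - h) ltac:(apply/andP; split; lra).
nra.
Qed.

(** In the spherical case the curve cannot run up to the antipodal axis
    [v = 2] with [y < sn]: it would have [y 2 = 0], hence [sin theta -> 0] there
    and again [y' > 0], against [y > 0]. *)
Lemma phase_vertical_sphere R (M : R) (g y : R -> R) :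
  admissible 1 g -> 0 < M -> (forall s t, `|y t - y s| <= M * `|t - s|) ->
  (forall v : R, 0 < v -> 1 * v < 2 -> is_derive v 1 y (2 * g (y v / sn 1 v))) ->
  (forall v : R, 0 < v -> 1 * v < 2 -> 0 < y v) ->
  exists b, [/\ 0 < b, 1 * b < 2 & sn 1 b <= y b].
Proof.
move=> ga M0 ylip yd yp; apply: contrapT => none.
have ys (v : R) : 0 < v -> v < 2 -> y v < sn 1 v.
  move=> v0 v2; rewrite ltNge; apply/negP => ?; apply: none; exists v.
  by split=> //; lra.
have yc := lipschitz_continuous ylip; have sc := @ct_sn R 1.
have s2 : sn 1 2 = 0 :> R by rewrite /sn /sn2 mul1r subrr mulr0 sqrtr0.
have y2 : y 2 = 0.
  apply/eqP; rewrite eq_le; apply/andP; split.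
    have := @continuous_le0_right R (fun x => y x - sn 1 x) 0 2 ltac:(lra).
    rewrite s2 subr0; apply; first by ct.
    by move=> x /andP[x0 x2]; rewrite subr_le0 ltW // ys.
  have := @continuous_le0_right R (fun x => - y x) 0 2 ltac:(lra).
  rewrite oppr_le0; apply; first by ct.
  by move=> x /andP[x0 x2]; rewrite oppr_le0 ltW // yp // mul1r.
have g0 := adm_pos ga.
have [d d0 dd] := admissible_near0 ga g0.
pose v := Num.max 1 (2 - d / (2 * M ^+ 2)).
have M2 : 0 < 2 * M ^+ 2 by rewrite mulr_gt0 ?exprn_gt0.
have dM : 0 < d / (2 * M ^+ 2) by rewrite divr_gt0.
have v1 : 1 <= v by rewrite le_max lexx.
have v2 : v < 2 by rewrite gt_max; apply/andP; split; lra.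
have vd : (2 - v) * (2 * M ^+ 2) <= d.
  rewrite -ler_pdivlMr //.
  have : 2 - d / (2 * M ^+ 2) <= v by rewrite le_max lexx orbT.
  lra.
have [c /andP[cv c2]] := @mvt R y (fun v => 2 * g (y v / sn 1 v)) v 2 v2
  (fun x _ => yc x) (fun x xv => yd x ltac:(case/andP: xv; lra)
    ltac:(case/andP: xv; lra)).
have : 0 < g (y c / sn 1 c).
  have c0 : 0 < c by lra.
  have s0 : 0 < sn2 1 c by apply: sn2_gt0; lra.
  have yM : `|y c| <= M * (2 - c).
    by have := ylip c 2; rewrite y2 sub0r normrN (gtr0_norm (x := 2 - c)) //; lra.
  have /dd : (y c / sn 1 c) ^+ 2 < d.
    rewrite expr_div_n (sqr_sn (ltW s0)) ltr_pdivrMr //.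
    have : y c ^+ 2 <= (M * (2 - c)) ^+ 2.
      by rewrite -(real_normK (num_real (y c))) ler_pXn2r ?nnegrE // (le_trans _ yM).
    move=> /le_lt_trans; apply; rewrite /sn2 mul1r.
    have -> : (M * (2 - c)) ^+ 2 = (2 - c) * (M ^+ 2 * (2 - c)) by ring.
    have -> : d * (c * (2 - c)) = (2 - c) * (d * c) by ring.
    rewrite ltr_pM2l; last lra.
    nra.
  by rewrite ltr_norml => /andP[]; lra.
rewrite y2 /= => gc E; have yv : 0 < y v by apply: yp; lra.
have : 0 < 2 * g (y c / sn 1 c) * (2 - v).
  by rewrite !mulr_gt0 //; lra.
by lra.
Qed.

(** In the hyperbolic case [2 H >= sin theta + delta] makes [y / (v + 1)] grow
    at least like a multiple of [ln (v + 1)], whereas [sn < v + 1]. *)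
Lemma phase_vertical_hyperbolic R (g y : R -> R) :
  admissible (-1) g -> y 0 = 0 -> continuous y ->
  (forall v : R, 0 < v -> -1 * v < 2 ->
     is_derive v 1 y (2 * g (y v / sn (-1) v))) ->
  (forall v : R, 0 < v -> -1 * v < 2 -> 0 < y v) ->
  exists b, [/\ 0 < b, -1 * b < 2 & sn (-1) b <= y b].
Proof.
move=> ga y0 yc yd yp; apply: contrapT => none.
have ys (v : R) : 0 < v -> y v < sn (-1) v.
  move=> v0; rewrite ltNge; apply/negP => ?; apply: none; exists v.
  by split=> //; lra.
have [d d0 dd] := adm_hyp ga erefl.
have sv (v : R) : 0 < v -> sn (-1) v < v + 1.
  move=> v0; rewrite -(ltr_pXn2r (n := 2)) ?nnegrE ?sqrtr_ge0 //; last lra.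
  by rewrite sqr_sn /sn2; nra.
(* chosen so that [d * ln (b + 1) = 1] *)
pose b := expR d^-1 - 1.
have b0 : 0 < b by rewrite subr_gt0 expR_gt1 invr_gt0.
pose f (v : R) := y v / (v + 1) - d * ln (v + 1).
pose df (v : R) :=
  (2 * g (y v / sn (-1) v) * (v + 1) - y v) / (v + 1) ^+ 2 - d / (v + 1).
have [|v vb|c /andP[c0 cb] E] := @mvt R f df 0 b b0.
- move=> x /andP[x0 _]; rewrite /f.
  have lc : continuous_at x (fun v : R => ln (v + 1)).
    apply: ct_comp; first by apply: continuous_ln; lra.
    by ct.
  by ct; rewrite gt_eqF //; lra.
- case/andP: vb => v0 vb; rewrite /f /df.
  have v1 : v + 1 != 0 by rewrite gt_eqF //; lra.
  have dy := yd v v0 ltac:(lra).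
  have dln : is_derive v 1 (fun v : R => ln (v + 1)) ((v + 1)^-1 * (1 + 0)).
    eapply (@der_comp _ _ (fun v : R => v + 1) (@ln R)).
      by apply: is_derive1_ln; lra.
    by eapply der_eq; [der | rewrite /=].
  eapply der_eq; first by der.
  by rewrite /=; field.
have s0 : 0 < sn (-1) c by apply: sn_gt0; lra.
have yc0 : 0 < y c by apply: yp; lra.
have yx : y c / sn (-1) c * sn (-1) c = y c by rewrite divfK // gt_eqF.
have x0 : 0 < y c / sn (-1) c by rewrite divr_gt0.
have x1 : y c / sn (-1) c <= 1 by rewrite ler_pdivrMr // mul1r ltW // ys.
have := dd (y c / sn (-1) c); rewrite (ltW x0) x1 => /(_ isT) gx.
have df0 : 0 <= df c.
  rewrite /df.
  have -> : d / (c + 1) = d * (c + 1) / (c + 1) ^+ 2.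
    by field; rewrite gt_eqF //; lra.
  rewrite -mulrBl; apply: divr_ge0; last by rewrite sqr_ge0.
  have := sv c c0; nra.
have : 0 <= f b.
  have f0 : f 0 = 0 by rewrite /f y0 mul0r !add0r ln1 mulr0 oppr0.
  by have := E; rewrite f0 !subr0 => ->; exact: mulr_ge0 df0 (ltW b0).
rewrite /f subrK expRK mulfV ?gt_eqF // subr_ge0 ler_pdivlMr ?expR_gt0 // mul1r.
have := ys b b0; have := sv b b0; rewrite /b subrK; lra.
Qed.

(** The curve [y = sn * sin theta] from the axis to the first point [v1] where
    the profile is vertical. *)
Record phase R (kappa : R) (g : R -> R) := Phase {
  ph_y : R -> R;
  ph_v1 : R;
  ph_M : R;
  ph_v1_gt0 : 0 < ph_v1;
  ph_v1_lt2 : kappa * ph_v1 < 2;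
  ph_M_gt0 : 0 < ph_M;
  ph_y0 : ph_y 0 = 0;
  ph_lip : forall s t, `|ph_y t - ph_y s| <= ph_M * `|t - s|;
  ph_der : forall v, 0 < v -> kappa * v < 2 ->
    is_derive v 1 ph_y (2 * g (ph_y v / sn kappa v));
  ph_gt0 : forall v, 0 < v -> kappa * v < 2 -> 0 < ph_y v;
  ph_lt : forall v, 0 < v < ph_v1 -> ph_y v < sn kappa v;
  ph_eq : ph_y ph_v1 = sn kappa ph_v1;
  ph_turn : 1 - kappa * ph_v1 < 2 * g 1 * sn kappa ph_v1 }.

(** At the first vertical point the profile really turns. Otherwise [v1] would
    be the radius of a vertical cylinder of the prescribed mean curvature, and
    such a cylinder is a centre of the phase plane, which no orbit reaches. In
    the estimates, [e = sn^2 - y^2 = sn^2 cos^2 theta]: since [H] is even, hence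
    flat at [0], first [sqrt e <= 2 eps t], where [t = v1 - v], and then
    [e' >= a t / 4], so that [e] would be negative. *)
Lemma phase_turns R (kappa v1 M : R) (g y : R -> R) :
  admissible kappa g -> 0 < v1 -> kappa * v1 < 2 ->
  (forall s t, `|y t - y s| <= M * `|t - s|) ->
  (forall v : R, 0 < v -> kappa * v < 2 ->
    is_derive v 1 y (2 * g (y v / sn kappa v))) ->
  (forall v : R, 0 < v -> kappa * v < 2 -> 0 < y v) ->
  (forall v : R, 0 < v < v1 -> y v < sn kappa v) -> y v1 = sn kappa v1 ->
  1 - kappa * v1 < 2 * g 1 * sn kappa v1.
Proof.
move=> ga v10 v12 ylip yd yp ys y1.
have yc := lipschitz_continuous ylip.
have sc := @ct_sn R kappa; have s2c := @ct_sn2 R kappa.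
have kv (v : R) : 0 < v -> v <= v1 -> kappa * v < 2.
  by move=> v0 vv; case: (adm_kappa ga) v12 => -> v12; lra.
set s1 := sn kappa v1; have s10 : 0 < s1 by exact: sn_gt0.
have s1E : s1 ^+ 2 = sn2 kappa v1 by rewrite sqr_sn // ltW // sn2_gt0.
pose e (v : R) := sn2 kappa v - y v ^+ 2.
have e1 : e v1 = 0 by rewrite /e y1 s1E subrr.
have e0 (v : R) : 0 < v < v1 -> 0 < e v.
  move=> /andP[v0 vv]; have v2 := kv v v0 (ltW vv).
  rewrite subr_gt0 -sqr_sn; last by rewrite ltW // sn2_gt0.
  have := ys v; rewrite v0 vv => /(_ isT); have := yp v v0 v2; nra.
pose de (v : R) := 2 * (1 - kappa * v) - 4 * y v * g (y v / sn kappa v).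
have ed (v : R) : 0 < v -> kappa * v < 2 -> is_derive v 1 e (de v).
  move=> v0 v2; have dy := yd v v0 v2; have ds := der_sn2 kappa v.
  by rewrite /e /de; eapply der_eq; [der | rewrite /=; ring].
have x1 : y v1 / sn kappa v1 = 1 by rewrite y1 divff // gt_eqF.
rewrite ltNge; apply/negP => c1.
(* e is positive before v1 and vanishes at v1, so its slope there is not positive *)
have c2 : 1 - kappa * v1 <= 2 * g 1 * s1.
  rewrite leNgt; apply/negP => c2.
  have d0 : 0 < de v1 by rewrite /de x1 y1 -/s1; lra.
  have [r r0 rf] := is_derive1_epsE (ed v1 v10 v12) d0.
  pose h := Num.min (r / 2) (v1 / 2).
  have h0 : 0 < h by rewrite lt_min !divr_gt0.
  have h1 : h <= r / 2 by rewrite ge_min lexx.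
  have h2 : h <= v1 / 2 by rewrite ge_min lexx orbT.
  have := rf (- h); rewrite normrN (gtr0_norm h0) => /(_ ltac:(lra)).
  rewrite e1 subr0 ler_norml => /andP[_].
  have := e0 (v1 - h) ltac:(apply/andP; split; lra).
  nra.
have {c1 c2}cE : 1 - kappa * v1 = 2 * g 1 * s1.
  by apply/eqP; rewrite eq_le c2.
set a := 2 * kappa + 8 * g 1 ^+ 2.
have a0 : 0 < a.
  have : a * s1 ^+ 2 = 2.
    have -> : a * s1 ^+ 2 = 2 * (kappa * s1 ^+ 2 + (2 * g 1 * s1) ^+ 2).
      by rewrite /a; ring.
    rewrite -cE s1E /sn2; case: (adm_kappa ga) => ->; ring.
  have : 0 < s1 ^+ 2 by rewrite exprn_gt0.
  nra.
pose eps := Num.min 1 (a / 32).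
have eps0 : 0 < eps by rewrite lt_min ltr01 /=; lra.
have eps1 : eps <= 1 by rewrite ge_min lexx.
have epsa : eps <= a / 32 by rewrite ge_min lexx orbT.
have [d d0 dflat] := adm_flat ga eps0.
have xc : {for v1, continuous (fun v => 1 - (y v / sn kappa v) ^+ 2)}.
  by ct; rewrite gt_eqF //.
have [r1 r10 xr] := (continuous1_eps _ _).1 xc d d0.
pose eps' := a / (8 * (`|g 1| + 1)).
have n1 : 0 < 8 * (`|g 1| + 1) by have := normr_ge0 (g 1); lra.
have eps'0 : 0 < eps' by rewrite divr_gt0.
have [r2 r20 yr] := is_derive1_epsE (yd v1 v10 v12) eps'0.
pose r := Num.min (v1 / 2) (Num.min r1 r2).
have r0 : 0 < r by rewrite !lt_min r10 r20 divr_gt0.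
have rv : r <= v1 / 2 by rewrite ge_min lexx.
have rr1 : r <= r1 by rewrite !ge_min lexx orbT.
have rr2 : r <= r2 by rewrite !ge_min lexx !orbT.
have deB (v : R) : v1 - r < v < v1 ->
    a / 2 * (v1 - v) - 4 * eps * Num.sqrt (e v) <= de v.
  move=> /andP[vr vv]; have v0 : 0 < v by lra.
  have v2 := kv v v0 (ltW vv); have sv0 := sn_gt0 v0 v2.
  have yv0 := yp v v0 v2.
  have yv1 : y v < sn kappa v by apply: ys; rewrite v0.
  set x := y v / sn kappa v; set w := Num.sqrt (1 - x ^+ 2).
  have x0 : 0 <= x by rewrite divr_ge0 ?ltW.
  have xle : x <= 1 by rewrite ler_pdivrMr // mul1r ltW.
  have gx : `|g x - g 1| <= eps * w.
    apply: dflat; first by rewrite x0.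
    have := xr v; rewrite x1 expr1n subrr subr0 -/x => H.
    have := H ltac:(rewrite ltr_norml; lra); rewrite ltr_norml => /andP[].
    by [].
  have sw : sn kappa v * w = Num.sqrt (e v).
    have -> : e v = sn kappa v ^+ 2 * (1 - x ^+ 2).
      rewrite mulrBr mulr1 -exprMn (mulrC _ x) /x divfK ?gt_eqF //.
      by rewrite sqr_sn // ltW // sn2_gt0.
    by rewrite sqrtrM ?sqr_ge0 // sqrtr_sqr gtr0_norm.
  have w0 : 0 <= w by exact: sqrtr_ge0.
  have yw : y v * w <= Num.sqrt (e v) by rewrite -sw ler_wpM2r // ltW.
  have yt : g 1 * y v <= g 1 * s1 - 2 * g 1 ^+ 2 * (v1 - v) + a / 8 * (v1 - v).
    have := yr (v - v1); rewrite (addrC v1) subrK x1 y1 -/s1.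
    rewrite distrC (gtr0_norm (x := v1 - v)) ?subr_gt0 // => H.
    have {}H := H ltac:(lra).
    have : `|g 1 * (y v - s1 - (v - v1) * (2 * g 1))| <=
       (`|g 1| + 1) * (eps' * (v1 - v)).
      rewrite normrM ler_pM // ?normr_ge0 //; lra.
    have -> : (`|g 1| + 1) * (eps' * (v1 - v)) = a / 8 * (v1 - v).
      by rewrite /eps'; field; apply/eqP; lra.
    rewrite ler_norml => /andP[_]; lra.
  have yg : y v * g x <= y v * g 1 + eps * Num.sqrt (e v).
    have : g x - g 1 <= eps * w by apply: le_trans gx; exact: ler_norm.
    nra.
  rewrite /de -/x /a in yt *; nra.
pose v := v1 - r / 2.
have sqrt_le (u : R) : v1 - r < u < v1 -> Num.sqrt (e u) <= 2 * eps * (v1 - u).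
  move=> /andP[ur uv].
  have [|w /andP[uw wv]|w /andP[uw wv]] := @mvt R (fun x => Num.sqrt (e x))
      (fun x => (2 * Num.sqrt (e x))^-1 * de x) u v1 uv.
  - by move=> w _; rewrite /e; ct.
  - eapply der_sqrt; first by apply: e0; rewrite wv andbT; lra.
    by apply: ed; [lra | apply: kv; lra].
  rewrite e1 sqrtr0 sub0r => E.
  have se0 : 0 < Num.sqrt (e w).
    by rewrite sqrtr_gt0; apply: e0; apply/andP; split; lra.
  have := deB w ltac:(apply/andP; split; lra) => dew.
  have : - (2 * eps) <= (2 * Num.sqrt (e w))^-1 * de w.
    rewrite ler_pdivlMl ?mulr_gt0 //; nra.
  nra.
have vv1 : v < v1 by rewrite /v; lra.
have [|w /andP[uw wv]|w /andP[uw wv]] := @mvt R e de v v1 vv1.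
- by move=> w _; rewrite /e; ct.
- by apply: ed; [rewrite /v in uw; lra | apply: kv; rewrite /v in uw; lra].
rewrite e1 sub0r => E.
have ev : 0 < e v by apply: e0; rewrite /v; apply/andP; split; lra.
have := deB w ltac:(rewrite /v in uw; apply/andP; split; lra).
have := sqrt_le w ltac:(rewrite /v in uw; apply/andP; split; lra).
have : 0 < v1 - w by lra.
have : 0 < v1 - v by lra.
have := sqrtr_ge0 (e w) => q1 q2 q3 q4 q5.
have e2 : eps * eps <= a / 32 by nra.
have : 0 < de w by nra.
nra.
Qed.

Lemma phase_exists R (kappa : R) (g : R -> R) :
  admissible kappa g -> inhabited (phase kappa g).
Proof.
move=> ga; have [y [M [M0 y0 ylip yd]]] := phase_equation ga.
have yp := phase_positive ga M0 y0 ylip yd.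
have yc := lipschitz_continuous ylip; have sc := @ct_sn R kappa.
have [b [b0 b2 yb]] : exists b, [/\ 0 < b, kappa * b < 2 & sn kappa b <= y b].
  case: (adm_kappa ga) => kE; rewrite kE in ga yd yp *.
    exact: (phase_vertical_hyperbolic ga).
  exact: (phase_vertical_sphere ga M0).
pose a := Num.min b (Num.min 1 (2 * M ^+ 2)^-1).
have M2 : 0 < 2 * M ^+ 2 by rewrite mulr_gt0 ?exprn_gt0.
have a0 : 0 < a by rewrite !lt_min b0 ltr01 invr_gt0.
have ab : a <= b by rewrite ge_min lexx.
have a1 : a <= 1 by rewrite !ge_min lexx orbT.
have aM : M ^+ 2 * a < 1.
  have : a <= (2 * M ^+ 2)^-1 by rewrite !ge_min lexx !orbT.
  rewrite -(ler_pM2l M2) mulfV ?gt_eqF //; lra.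
have small v : 0 < v <= a -> y v < sn kappa v.
  move=> /andP[v0 va]; have v01 : 0 < v <= 1 by rewrite v0 (le_trans va).
  have yM : `|y v| <= M * v.
    by have := ylip 0 v; rewrite y0 !subr0 (gtr0_norm v0).
  have [_ v2 xM] := near_axis (adm_kappa ga) v01 yM.
  have s0 := sn_gt0 v0 v2.
  have : (y v / sn kappa v) ^+ 2 < 1 ^+ 2.
    rewrite expr1n; apply: le_lt_trans xM _; apply: le_lt_trans aM.
    by rewrite ler_wpM2l // sqr_ge0.
  rewrite ltr_pXn2r ?nnegrE ?ler01 //; last first.
    by rewrite divr_ge0 // ltW // yp.
  by rewrite ltr_pdivrMr // mul1r.
have [|||v1 /andP[av1 v1b] [v1E v1lt]] :=
    @first_zero R (fun v => y v - sn kappa v) a b ab.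
- by move=> v _; ct.
- by rewrite subr_lt0 small // a0 lexx.
- by rewrite subr_ge0.
have v10 : 0 < v1 := lt_trans a0 av1.
have v12 : kappa * v1 < 2 by case: (adm_kappa ga) b2 => -> b2; lra.
have ys v : 0 < v < v1 -> y v < sn kappa v.
  move=> /andP[v0 vv]; have [va|/ltW av] := leP v a; first by rewrite small ?v0.
  by rewrite -subr_lt0 v1lt // av.
have y1 : y v1 = sn kappa v1 by apply/eqP; rewrite -subr_eq0 v1E.
constructor; apply: (@Phase R kappa g y v1 M) => //.
exact: (phase_turns ga v10 v12 ylip yd yp ys y1).
Qed.

(** [ph_k = sin theta / sn = y / sn^2] extends continuously to the axis, where
    its value is the curvature of the profile at the pole. *)
Definition ph_k R (kappa : R) (g : R -> R) (p : phase kappa g)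
    (v : R) : R :=
  if v <= 0 then g 0 else ph_y p v / sn2 kappa v.

(** [cos^2 theta], continuous up to the axis. *)
Definition ph_cos2 R (kappa : R) (g : R -> R)
    (p : phase kappa g) (v : R) : R :=
  1 - ph_k p v ^+ 2 * sn2 kappa v.

Lemma ph_lt2 R (kappa : R) (g : R -> R) (p : phase kappa g)
    (v : R) : admissible kappa g -> 0 <= v -> v <= ph_v1 p -> kappa * v < 2.
Proof.
move=> ga v0 vv; have h := ph_v1_lt2 p.
by case: (adm_kappa ga) => kE; rewrite {1}kE; rewrite {1}kE in h; lra.
Qed.

Lemma ct_ph_y R (kappa : R) (g : R -> R) (p : phase kappa g) :
  continuous (ph_y p).
Proof. exact: lipschitz_continuous (ph_lip p). Qed.
Arguments ct_ph_y {R kappa g} p _.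

Lemma ph_kE R (kappa : R) (g : R -> R) (p : phase kappa g) v :
  0 < v -> ph_k p v = ph_y p v / sn2 kappa v.
Proof. by move=> v0; rewrite /ph_k leNgt v0. Qed.

Lemma ph_k_gt0 R (kappa : R) (g : R -> R) (p : phase kappa g) v :
  admissible kappa g -> v <= ph_v1 p -> 0 < ph_k p v.
Proof.
move=> ga vv; have [v0|v0] := leP v 0; first by rewrite /ph_k v0 (adm_pos ga).
have v2 := ph_lt2 ga (ltW v0) vv.
by rewrite ph_kE // divr_gt0 ?sn2_gt0 // ph_gt0.
Qed.

Lemma ph_sin R (kappa : R) (g : R -> R) (p : phase kappa g) v :
  admissible kappa g -> 0 < v -> v <= ph_v1 p ->
  ph_k p v * sn kappa v = ph_y p v / sn kappa v.
Proof.
move=> ga v0 vv; have v2 := ph_lt2 ga (ltW v0) vv.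
have s0 : sn kappa v != 0 by rewrite gt_eqF // sn_gt0.
rewrite ph_kE // -sqr_sn ?(ltW (sn2_gt0 v0 v2)) //.
by field.
Qed.

Lemma ph_cos2E R (kappa : R) (g : R -> R) (p : phase kappa g) v :
  admissible kappa g -> 0 < v -> v <= ph_v1 p ->
  ph_cos2 p v = (sn2 kappa v - ph_y p v ^+ 2) / sn2 kappa v.
Proof.
move=> ga v0 vv; have v2 := ph_lt2 ga (ltW v0) vv.
have s0 : sn2 kappa v != 0 by rewrite gt_eqF // sn2_gt0.
by rewrite /ph_cos2 ph_kE //; field.
Qed.

Lemma ph_cos2_gt0 R (kappa : R) (g : R -> R) (p : phase kappa g)
    v : admissible kappa g -> 0 <= v < ph_v1 p -> 0 < ph_cos2 p v.
Proof.
move=> ga /andP[]; rewrite le_eqVlt => /predU1P[<- _|v0 vv].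
  by rewrite /ph_cos2 /sn2 mul0r mulr0 subr0.
have v2 := ph_lt2 ga (ltW v0) (ltW vv); have s0 := sn2_gt0 v0 v2.
rewrite (ph_cos2E ga v0 (ltW vv)) divr_gt0 // subr_gt0 -sqr_sn ?(ltW s0) //.
rewrite ltr_pXn2r ?nnegrE ?sqrtr_ge0 //; first by apply: ph_lt; rewrite v0.
by rewrite ltW // ph_gt0.
Qed.

Lemma ph_cos2_v1 R (kappa : R) (g : R -> R) (p : phase kappa g) :
  admissible kappa g -> ph_cos2 p (ph_v1 p) = 0.
Proof.
move=> ga; have v0 := ph_v1_gt0 p; have s0 := sn2_gt0 v0 (ph_v1_lt2 p).
by rewrite ph_cos2E // ph_eq sqr_sn ?(ltW s0) // subrr mul0r.
Qed.

Lemma ph_cos2_le1 R (kappa : R) (g : R -> R) (p : phase kappa g)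
    v : admissible kappa g -> 0 <= v <= ph_v1 p -> 0 <= ph_cos2 p v <= 1.
Proof.
move=> ga /andP[v0 vv]; apply/andP; split.
  move: vv; rewrite le_eqVlt => /predU1P[->|vv]; first by rewrite ph_cos2_v1.
  by rewrite ltW // ph_cos2_gt0 // v0.
have v2 := ph_lt2 ga v0 vv.
by rewrite gerBl mulr_ge0 ?sqr_ge0 // /sn2 mulr_ge0 // subr_ge0 ltW.
Qed.

Lemma ct_ph_k R (kappa : R) (g : R -> R) (p : phase kappa g) v :
  admissible kappa g -> v <= ph_v1 p -> {for v, continuous (ph_k p)}.
Proof.
move=> ga; have yc := ct_ph_y p; have s2c := @ct_sn2 R kappa.
have [v0|v0|-> _] := ltgtP v 0.
- move=> _; apply: (@continuous1_locally R (fun=> g 0) _ v (- v)).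
  + by rewrite oppr_gt0.
  + move=> x; rewrite ltr_norml => /andP[_ xv]; rewrite /ph_k ltW //.
    by move: xv; rewrite ltrBlDr addNr.
  + exact: ct_cst.
- move=> vv; have v2 := ph_lt2 ga (ltW v0) vv.
  apply: (@continuous1_locally R (fun v => ph_y p v / sn2 kappa v) _ v v v0).
    move=> x; rewrite ltr_norml => /andP[xv _]; rewrite ph_kE //.
    by move: xv; rewrite ltrBrDr addNr.
  by ct; rewrite gt_eqF // sn2_gt0.
- apply/continuous1_eps => e e0.
  have g0 := adm_pos ga.
  have [d d0 dd] := admissible_near0 ga (e := e / 4) ltac:(lra).
  have M0 := ph_M_gt0 p; have M2 : 0 < 2 * ph_M p ^+ 2.
    by rewrite mulr_gt0 ?exprn_gt0.
  pose r := Num.min 1 (Num.min (d / (2 * ph_M p ^+ 2)) (e / (4 * g 0))).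
  have r0 : 0 < r by rewrite !lt_min ltr01 !divr_gt0 ?mulr_gt0.
  have r1 : r <= 1 by rewrite ge_min lexx.
  have rd : r * (2 * ph_M p ^+ 2) <= d.
    by rewrite -ler_pdivlMr // !ge_min lexx !orbT.
  have re : r * (4 * g 0) <= e.
    by rewrite -ler_pdivlMr ?mulr_gt0 // !ge_min lexx !orbT.
  exists r => // x; rewrite subr0 => xr.
  have -> : ph_k p 0 = g 0 by rewrite /ph_k lexx.
  have [x0|x0] := leP x 0; first by rewrite /ph_k x0 subrr normr0.
  rewrite (gtr0_norm x0) in xr.
  have yM t : 0 < t -> `|ph_y p t| <= ph_M p * t.
    by move=> t0; have := ph_lip p 0 t; rewrite ph_y0 !subr0 (gtr0_norm t0).
  have x01 : 0 < x <= 1 by rewrite x0 (le_trans (ltW xr)).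
  have [sx x2 _] := near_axis (adm_kappa ga) x01 (yM x x0).
  have [|c /andP[c0 cx]] := @mvt R (ph_y p)
      (fun v => 2 * g (ph_y p v / sn kappa v)) 0 x x0 (fun x _ => yc x).
    move=> t /andP[t0 tx]; apply: ph_der => //.
    by case: (adm_kappa ga) => ->; lra.
  rewrite ph_y0 !subr0 => yx.
  have c01 : 0 < c <= 1 by rewrite c0 (le_trans (ltW cx)) //; case/andP: x01.
  have [_ _ xc] := near_axis (adm_kappa ga) c01 (yM c c0).
  have gc : `|g (ph_y p c / sn kappa c) - g 0| < e / 4.
    apply: dd; apply: le_lt_trans xc _; nra.
  rewrite ph_kE // yx.
  set G := g _ in gc *.
  have s0 := lt_le_trans x0 sx.
  have -> : 2 * G * x / sn2 kappa x - g 0 =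
     (2 * (G - g 0) * x + g 0 * kappa * x ^+ 2) / sn2 kappa x.
    have n0 : sn2 kappa x != 0 by rewrite gt_eqF.
    by rewrite -{1}(mulfK n0 (g 0)) -mulrBl /sn2; congr (_ / _); ring.
  rewrite normrM normfV (gtr0_norm s0) ltr_pdivrMr //.
  apply: (@lt_le_trans _ _ (e * x)); last by rewrite ler_pM2l.
  apply: le_lt_trans (ler_normD _ _) _.
  have -> : `|2 * (G - g 0) * x| = 2 * `|G - g 0| * x.
    by rewrite !normrM (gtr0_norm x0) ger0_norm.
  have -> : `|g 0 * kappa * x ^+ 2| = g 0 * x * x.
    rewrite 2!normrM (gtr0_norm g0) (ger0_norm (sqr_ge0 x)).
    have -> : `|kappa| = 1 by case: (adm_kappa ga) => ->; rewrite ?normrN1 ?normr1.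
    by rewrite mulr1 expr2 mulrA.
  have gx : g 0 * x <= e / 4 by clear -re xr g0; nra.
  have -> : 2 * `|G - g 0| * x + g 0 * x * x = (2 * `|G - g 0| + g 0 * x) * x.
    by ring.
  rewrite ltr_pM2r //; clear -gx gc e0; lra.
Qed.

Lemma ct_ph_cos2 R (kappa : R) (g : R -> R) (p : phase kappa g) v :
  admissible kappa g -> v <= ph_v1 p -> {for v, continuous (ph_cos2 p)}.
Proof.
move=> ga vv; have kc := ct_ph_k ga vv; have s2c := @ct_sn2 R kappa.
by rewrite /ph_cos2; ct.
Qed.

(** * The height of the profile *)

Lemma der_ph_k R (kappa : R) (g : R -> R) (p : phase kappa g) v :
  0 < v -> kappa * v < 2 ->
  is_derive v 1 (ph_k p) (2 * (g (ph_y p v / sn kappa v) -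
    ph_k p v * (1 - kappa * v)) / sn2 kappa v).
Proof.
move=> v0 v2; have s0 : sn2 kappa v != 0 by rewrite gt_eqF // sn2_gt0.
have dy := ph_der p v0 v2; have ds := der_sn2 kappa v.
apply: (@der_locally R (fun v => ph_y p v / sn2 kappa v) _ v v _ v0).
  move=> x; rewrite ltr_norml => /andP[xv _]; rewrite ph_kE //.
  by move: xv; rewrite ltrBrDr addNr.
rewrite ph_kE //; eapply der_eq; [by der | rewrite /=; by field].
Qed.

Lemma der_ph_cos2 R (kappa : R) (g : R -> R) (p : phase kappa g)
    v : 0 < v -> kappa * v < 2 ->
  is_derive v 1 (ph_cos2 p) (2 * ph_k p v * (ph_k p v * (1 - kappa * v) -
    2 * g (ph_y p v / sn kappa v))).
Proof.
move=> v0 v2; have s0 : sn2 kappa v != 0 by rewrite gt_eqF // sn2_gt0.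
have dk := der_ph_k p v0 v2; have ds := der_sn2 kappa v.
rewrite /ph_cos2; eapply der_eq; [by der | rewrite /=; by field].
Qed.

(** The square of the cosine has a simple zero at [v1], because the profile
    turns there. *)
Lemma ph_cos2_lower R (kappa : R) (g : R -> R)
    (p : phase kappa g) : admissible kappa g ->
  exists2 m, 0 < m & forall v, 0 <= v <= ph_v1 p ->
    m * (ph_v1 p - v) <= ph_cos2 p v.
Proof.
move=> ga; have v10 := ph_v1_gt0 p; have v12 := ph_v1_lt2 p.
apply: (linear_lower_bound v10 _ _ (ph_cos2_v1 p ga) (der_ph_cos2 p v10 v12)).
- by move=> v /andP[_ vv]; exact: ct_ph_cos2.
- by move=> v vv; exact: ph_cos2_gt0.
- have k0 := @ph_k_gt0 _ _ _ p (ph_v1 p) ga (lexx _).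
  have s0 := sn_gt0 v10 v12.
  rewrite pmulr_rlt0 ?mulr_gt0 // subr_lt0.
  have x1 := @ph_sin _ _ _ p (ph_v1 p) ga v10 (lexx _).
  rewrite ph_eq divff ?gt_eqF // in x1 *.
  rewrite -(ltr_pM2r s0) mulrAC x1 mul1r; exact: ph_turn.
Qed.

(** The slope [dv/dz = sn cot theta], extended to all [v] by clamping. *)
Definition ph_slope R (kappa : R) (g : R -> R)
    (p : phase kappa g) (v : R) : R :=
  let w := Num.max 0 (Num.min v (ph_v1 p)) in
  Num.sqrt (ph_cos2 p w) / ph_k p w.

Lemma ph_slopeE R (kappa : R) (g : R -> R) (p : phase kappa g) v :
  0 <= v <= ph_v1 p -> ph_slope p v = Num.sqrt (ph_cos2 p v) / ph_k p v.
Proof. by move=> /andP[v0 vv]; rewrite /ph_slope min_l // max_r. Qed.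

Lemma clamp_itv R (b v : R) : 0 <= b ->
  0 <= Num.max 0 (Num.min v b) <= b.
Proof. by move=> b0; rewrite le_max lexx ge_max b0 ge_min lexx orbT. Qed.

Lemma ct_clamp R (b : R) :
  continuous (fun v => Num.max 0 (Num.min v b)).
Proof.
apply: (@lipschitz_continuous R _ 1) => s t; rewrite mul1r.
have mono x y : x <= y ->
    `|Num.max 0 (Num.min y b) - Num.max 0 (Num.min x b)| <= `|y - x|.
  move=> xy; rewrite (ger0_norm (x := y - x)) ?subr_ge0 //.
  rewrite ler_norml.
  by case: (leP x b) => ?; case: (leP y b) => ?; case: (leP 0 x) => ?;
    case: (leP 0 y) => ?; case: (leP 0 b) => ?; apply/andP; split; lra.
have [|/ltW] := leP s t; first exact: mono.
by rewrite distrC (distrC t); exact: mono.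
Qed.

Lemma ct_ph_slope R (kappa : R) (g : R -> R) (p : phase kappa g) :
  admissible kappa g -> continuous (ph_slope p).
Proof.
move=> ga v; have b0 := ltW (ph_v1_gt0 p).
have /andP[c0 c1] := clamp_itv v b0.
have cc := @ct_clamp R (ph_v1 p) v.
rewrite /ph_slope; apply: ct_mul.
  apply: ct_sqrt; apply: (@ct_comp _ _ _ (ph_cos2 p)) => //.
  exact: ct_ph_cos2.
apply: ct_inv; first by rewrite gt_eqF // ph_k_gt0.
by apply: (@ct_comp _ _ _ (ph_k p)) => //; exact: ct_ph_k.
Qed.

Lemma ph_slope_ge0 R (kappa : R) (g : R -> R) (p : phase kappa g)
    v : admissible kappa g -> 0 <= ph_slope p v.
Proof.
move=> ga; have /andP[_ c1] := clamp_itv v (ltW (ph_v1_gt0 p)).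
by rewrite divr_ge0 ?sqrtr_ge0 // ltW // ph_k_gt0.
Qed.

(** The height at which the profile becomes vertical is finite because the
    slope vanishes there only like the square root of [v1 - v]. The equation is
    solved for [v] as a function of the height, because in this form it is
    regular both at the axis and at the vertical point. *)
Lemma height_exists R (kappa : R) (g : R -> R)
    (p : phase kappa g) : admissible kappa g ->
  exists (V : R -> R) (z1 : R), [/\ 0 < z1, forall t, t <= 0 -> V t = 0,
    continuous V, V z1 = ph_v1 p &
    (forall t : R, 0 < t < z1 -> 0 < V t < ph_v1 p) /\
    forall t : R, 0 < t < z1 ->
      is_derive t 1 V (Num.sqrt (ph_cos2 p (V t)) / ph_k p (V t))].
Proof.
move=> ga; have v10 := ph_v1_gt0 p; set v1 := ph_v1 p in v10 *.
have kc (x : R) : 0 <= x <= v1 -> continuous_at x (ph_k p).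
  by move=> /andP[_ xv]; exact: ct_ph_k.
have kNc (x : R) : 0 <= x <= v1 -> continuous_at x (fun x => - ph_k p x).
  by move=> /kc ?; exact: ct_opp.
have [a a01 amin] := continuous_itv_min (ltW v10) kc.
have [b b01 bmax] := continuous_itv_min (ltW v10) kNc.
have ka : 0 < ph_k p a by apply: ph_k_gt0 => //; case/andP: a01.
have kb : 0 < ph_k p b by apply: ph_k_gt0 => //; case/andP: b01.
have bounded t : `|ph_slope p t| <= (ph_k p a)^-1.
  rewrite ger0_norm ?ph_slope_ge0 // /ph_slope.
  have w01 := clamp_itv t (ltW v10); set w := Num.max _ _ in w01 *.
  have /andP[c0 c1] := ph_cos2_le1 (p := p) ga w01.
  have kw : 0 < ph_k p w by apply: ph_k_gt0 => //; case/andP: w01.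
  rewrite ler_pdivrMr // ler_pdivlMl //.
  apply: (@le_trans _ _ (ph_k p a)); last exact: amin.
  rewrite ler_piMr ?(ltW ka) //.
  by rewrite -(sqrtr1 R) ler_wsqrtr.
have [V [V0 Vlip Vd]] := @peano R (fun _ v => ph_slope p v) _ (fun _ => bounded).
have Vc : continuous V := lipschitz_continuous Vlip.
have slc := ct_ph_slope (p := p) ga.
have {}Vd (t : R) : 0 < t -> is_derive t 1 V (ph_slope p (V t)).
  move=> t0; apply: Vd => //.
  have c2 : continuous_at (t, V t) (fun q : R * R => q.2) by exact: cvg_snd.
  by apply: (@ct_comp _ _ (fun q : R * R => q.2) (ph_slope p)).
have Vmono (s t : R) : 0 <= s -> s <= t -> V s <= V t.
  move=> s0; rewrite le_eqVlt => /predU1P[->//|st].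
  have [||c _ E] := @mvt R V (fun t => ph_slope p (V t)) s t st.
  - by move=> x _; exact: Vc.
  - by move=> x /andP[sx _]; apply: Vd; exact: le_lt_trans sx.
  rewrite -subr_ge0 E mulr_ge0 ?ph_slope_ge0 // subr_ge0 ltW //.
have Vge0 (t : R) : 0 <= t -> 0 <= V t by move=> t0; rewrite -(V0 0) ?Vmono.
have Vpos (t : R) : 0 < t -> 0 < V t.
  move=> t0; rewrite lt_neqAle (Vge0 t (ltW t0)) andbT; apply/eqP => Vt.
  have Vs (s : R) : 0 < s < t -> V s = 0.
    move=> /andP[s0 st]; apply/eqP; rewrite eq_le (Vge0 s (ltW s0)) andbT.
    by rewrite Vt; exact: Vmono (ltW s0) (ltW st).
  have [||c ct E] := @mvt R V (fun t => ph_slope p (V t)) 0 t t0.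
  - by move=> x _; exact: Vc.
  - by move=> x /andP[x0 _]; exact: Vd.
  have Vc0 := Vs c ct.
  rewrite Vc0 -Vt V0 // subrr subr0 ph_slopeE ?lexx ?(ltW v10) // in E.
  move: E; rewrite /ph_cos2 /sn2 mul0r mulr0 subr0 sqrtr1 mul1r.
  rewrite /ph_k lexx => /esym/eqP.
  by rewrite gt_eqF // mulr_gt0 ?invr_gt0 // (adm_pos ga).
have [T T0 VT] : exists2 T, 0 < T & v1 <= V T.
  apply: contrapT => none.
  have Vlt (t : R) : 0 < t -> V t < v1.
    by move=> t0; rewrite ltNge; apply/negP => ?; apply: none; exists t.
  have [m m0 mlow] := ph_cos2_lower p ga.
  pose c := Num.sqrt m / (2 * ph_k p b).
  have c0 : 0 < c by rewrite divr_gt0 ?sqrtr_gt0 // mulr_gt0.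
  pose f (t : R) := Num.sqrt (v1 - V t).
  (* sqrt (v1 - V) would decrease at a rate of at least c, hence be negative at T *)
  pose T := Num.sqrt v1 / c + 1.
  have T0 : 0 < T by rewrite ltr_wpDl // divr_ge0 ?sqrtr_ge0 // ltW.
  have [||t /andP[t0 tT] E] := @mvt R f
      (fun t => (2 * f t)^-1 * (0 + - ph_slope p (V t))) 0 T T0.
  - by move=> x _; rewrite /f; ct.
  - move=> x /andP[x0 _]; have dV := Vd x x0.
    by eapply der_sqrt; [rewrite subr_gt0 Vlt | der].
  have ft : 0 < f t by rewrite sqrtr_gt0 subr_gt0 Vlt.
  have V01 : 0 <= V t <= v1 by rewrite Vge0 ltW // Vlt.
  have sl : Num.sqrt m * f t / ph_k p b <= ph_slope p (V t).
    rewrite ph_slopeE //; have kV : 0 < ph_k p (V t).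
      by apply: ph_k_gt0 => //; case/andP: V01.
    apply: ler_pM; rewrite ?mulr_ge0 ?sqrtr_ge0 ?invr_ge0 ?(ltW kb) //.
      by rewrite -sqrtrM ?(ltW m0) // ler_wsqrtr // mlow.
    by rewrite lef_pV2 ?posrE // -lerN2 bmax.
  have fT : 0 < f T by rewrite sqrtr_gt0 subr_gt0 Vlt.
  have f0 : f 0 = Num.sqrt v1 by rewrite /f V0 // subr0.
  have : (2 * f t)^-1 * (0 + - ph_slope p (V t)) <= - c.
    rewrite ler_pdivrMl ?mulr_gt0 // sub0r lerNl.
    apply: le_trans sl; rewrite /c le_eqVlt; apply/orP; left; apply/eqP.
    by field; rewrite gt_eqF.
  rewrite subr0 f0 in E; move=> dc.
  have : f T - Num.sqrt v1 <= - c * T by rewrite E ler_pM2r.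
  have -> : - c * T = - Num.sqrt v1 - c.
    by rewrite /T; field; rewrite gt_eqF.
  clear -fT c0; lra.
have [|||z1 /andP[z10 z1T] [z1E z1lt]] :=
    @first_zero R (fun t => V t - v1) 0 T (ltW T0).
- by move=> x _; ct.
- by rewrite V0 // sub0r oppr_lt0.
- by rewrite subr_ge0.
have V01 (t : R) : 0 < t < z1 -> 0 < V t < v1.
  move=> /andP[t0 tz]; rewrite Vpos //= -subr_lt0; apply: z1lt.
  by rewrite ltW.
exists V, z1; split=> //.
- by apply/eqP; rewrite -subr_eq0 z1E.
- split=> // t tz; have /andP[Vt0 Vt1] := V01 t tz.
  rewrite -ph_slopeE; last by rewrite !ltW.
  by apply: Vd; case/andP: tz.
Qed.

(** * The profile curve *)

(** The closed profile curve, described over the height [t], which ranges over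
    [-z1, z1]. With [S = sn (v t)] and [C = 1 - kappa (v t)], the angle [theta]
    of the curve with the horizontal has [sin theta = k t * S] and
    [cos theta = c t], and [p = cot theta] is the slope of the distance to the
    axis. Near the lower pole the surface is also the graph of [W] in the
    variable [v], and [W' = q] is regular enough there: [v q'(v) = psi v]
    tends to [0], which is what makes the surface of class C^2 at the pole. *)
Record profile R (kappa : R) (g : R -> R) := Profile {
  pr_z1 : R;
  pr_v : R -> R;
  pr_k : R -> R;
  pr_c : R -> R;
  pr_z1_gt0 : 0 < pr_z1;
  pr_v_cont : continuous pr_v;
  pr_k_cont : continuous pr_k;
  pr_c_cont : continuous pr_c;
  pr_v_even : forall t : R, pr_v (- t) = pr_v t;
  pr_c_odd : forall t : R, pr_c (- t) = - pr_c t;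
  pr_v_pole : forall t : R, pr_z1 <= `|t| -> pr_v t = 0;
  pr_v_gt0 : forall t : R, `|t| < pr_z1 -> 0 < pr_v t;
  pr_v_lt2 : forall t : R, kappa * pr_v t < 2;
  pr_k_gt0 : forall t : R, 0 < pr_k t;
  pr_c_pole : pr_c (- pr_z1) = 1;
  pr_unit : forall t : R, pr_c t ^+ 2 + pr_k t ^+ 2 * sn2 kappa (pr_v t) = 1;
  pr_v_der : forall t : R, `|t| < pr_z1 -> is_derive t 1 pr_v (pr_c t / pr_k t);
  pr_p_der : forall t : R, `|t| < pr_z1 ->
    is_derive t 1 (fun t : R => pr_c t / (pr_k t * sn kappa (pr_v t)))
      ((pr_k t * (1 - kappa * pr_v t) - 2 * g (pr_k t * sn kappa (pr_v t))) /
       (pr_k t * sn kappa (pr_v t)) ^+ 3);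
  pr_v0 : R;
  pr_W : R -> R;
  pr_q : R -> R;
  pr_psi : R -> R;
  pr_v0_gt0 : 0 < pr_v0;
  pr_v0_lt : kappa * pr_v0 < 2;
  pr_W_lip : exists B, forall s t : R, `|pr_W t - pr_W s| <= B * `|t - s|;
  pr_q_cont : forall w : R, 0 <= w < pr_v0 -> {for w, continuous pr_q};
  pr_psi_cont : forall w : R, 0 <= w < pr_v0 -> {for w, continuous pr_psi};
  pr_q0 : pr_q 0 = g 0;
  pr_psi0 : pr_psi 0 = 0;
  pr_W_der : forall w : R, 0 < w < pr_v0 -> is_derive w 1 pr_W (pr_q w);
  pr_q_der : forall w : R, 0 < w < pr_v0 -> is_derive w 1 pr_q (pr_psi w / w);
  pr_Wv : forall t : R, - pr_z1 <= t < 0 -> pr_v t < pr_v0 ->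
    pr_W (pr_v t) = t + pr_z1;
  pr_vW : forall w : R, 0 <= w < pr_v0 -> exists2 t, - pr_z1 <= t < 0 & pr_v t = w }.

Lemma der_reflect R (f : R -> R) (t l : R) :
  is_derive (- t) 1 f l -> is_derive t 1 (fun s => f (- s)) (- l).
Proof.
move=> df; eapply der_eq.
  eapply (@der_comp _ _ (fun s : R => - s) f); first exact: df.
  by eapply der_opp; exact: der_id.
by rewrite mulrN1.
Qed.

Definition cap_psi R (kappa : R) (g : R -> R)
    (p : phase kappa g) (w : R) : R :=
  let k := ph_k p w in
  let G := g (k * sn kappa w) in
  let C := 1 - kappa * w in
  (2 / (2 - kappa * w) * (G - k * C) * ph_cos2 p w - w * k ^+ 2 * (k * C - 2 * G))
  / (ph_cos2 p w * Num.sqrt (ph_cos2 p w)).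

Lemma der_cap_q R (kappa : R) (g : R -> R) (p : phase kappa g) w :
  admissible kappa g -> 0 < w < ph_v1 p ->
  is_derive w 1 (fun v => ph_k p v / Num.sqrt (ph_cos2 p v)) (cap_psi p w / w).
Proof.
move=> ga /andP[w0 w1]; have w2 := ph_lt2 ga (ltW w0) (ltW w1).
have c0 : 0 < ph_cos2 p w by apply: ph_cos2_gt0 => //; rewrite ltW.
have dk := der_ph_k p w0 w2; have dc := der_ph_cos2 p w0 w2.
have sc0 : Num.sqrt (ph_cos2 p w) != 0 by rewrite gt_eqF // sqrtr_gt0.
eapply der_eq; first by der.
rewrite /cap_psi (ph_sin ga w0 (ltW w1)) /=.
set G := g _; set k := ph_k p w; set c := Num.sqrt _.
have -> : ph_cos2 p w = c ^+ 2 by rewrite sqr_sqrtr // ltW.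
rewrite /sn2; field; rewrite sc0 !gt_eqF //=; lra.
Qed.

Lemma ct_cap_psi R (kappa : R) (g : R -> R) (p : phase kappa g) w :
  admissible kappa g -> 0 <= w < ph_v1 p -> {for w, continuous (cap_psi p)}.
Proof.
move=> ga /andP[w0 w1]; have w2 := ph_lt2 ga w0 (ltW w1).
have c0 : 0 < ph_cos2 p w by apply: ph_cos2_gt0 => //; rewrite w0.
have kc := ct_ph_k ga (ltW w1); have cc := ct_ph_cos2 ga (ltW w1).
have sc := @ct_sn R kappa; have gc : continuous g by exact: (adm_cont ga).
have w20 : 2 - kappa * w != 0 by rewrite gt_eqF // subr_gt0.
have den : ph_cos2 p w * Num.sqrt (ph_cos2 p w) != 0.
  by rewrite gt_eqF // mulr_gt0 // sqrtr_gt0.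
have Gc : continuous_at w (fun w => g (ph_k p w * sn kappa w)).
  by apply: ct_comp; [exact: gc | ct].
by rewrite /cap_psi /=; ct.
Qed.

Lemma cap_psi_axis R (kappa : R) (g : R -> R) (p : phase kappa g) :
  cap_psi p 0 = 0.
Proof.
have k0 : ph_k p 0 = g 0 by rewrite /ph_k lexx.
have s0 : sn kappa 0 = 0 by rewrite /sn /sn2 mul0r sqrtr0.
rewrite /cap_psi k0 s0 !mulr0 !subr0 mulr1 subrr mulr0 !mul0r subr0.
by rewrite mul0r.
Qed.

(** The profile is the height solution followed by its mirror image. At the
    equator the slope [p] is continuous and its derivative, given by the mean
    curvature equation, has the same limit from both sides, so that the two
    halves fit together to second order. *)
Lemma profile_exists R (kappa : R) (g : R -> R) :
  admissible kappa g -> inhabited (profile kappa g).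
Proof.
move=> ga; have [ph] := phase_exists ga.
have [V [z1 [z10 V0 Vc Vz1 [V01 Vd]]]] := height_exists ph ga.
have v10 := ph_v1_gt0 ph; have v12 := ph_v1_lt2 ph.
set v1 := ph_v1 ph in v10 v12 Vz1 V01 Vd *.
have gc : continuous g by exact: (adm_cont ga).
have V01' (t : R) : t <= z1 -> 0 <= V t <= v1.
  rewrite le_eqVlt => /predU1P[->|tz]; first by rewrite Vz1 lexx ltW.
  have [t0|t0] := leP t 0; first by rewrite V0 // lexx ltW.
  by have /andP[a b] := V01 t ltac:(by rewrite t0); rewrite !ltW.
(* the profile is V at the height above the lower pole, folded at the equator *)
pose m (t : R) := Num.min (z1 + t) (z1 - t).
have mE (t : R) : t <= 0 -> m t = z1 + t by move=> t0; rewrite /m min_l //; lra.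
have mN (t : R) : m (- t) = m t by rewrite /m minC opprK.
have m0 : m 0 = z1 by rewrite mE // addr0.
have mz (t : R) : m t <= z1.
  have [t0|t0] := leP t 0; first by rewrite mE //; lra.
  by rewrite -mN mE; lra.
have mz' (t : R) : t != 0 -> m t < z1.
  rewrite neq_lt => /orP[]t0; first by rewrite mE ?ltW //; lra.
  by rewrite -mN mE; lra.
have mabs (t : R) : m t = z1 - `|t|.
  have [t0|t0] := leP t 0; first by rewrite mE // ler0_norm // opprK.
  by rewrite -mN mE ?oppr_le0 ?ltW // gtr0_norm.
have mc : continuous m.
  have -> : m = fun t => z1 - `|t| by apply/funext => t; exact: mabs.
  by move=> t; ct.
pose v (t : R) := V (m t).
have vc : continuous v by move=> t; rewrite /v; ct.
have v01 (t : R) : 0 <= v t <= v1 by apply: V01'.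
have vle (t : R) : v t <= v1 by case/andP: (v01 t).
have vN (t : R) : v (- t) = v t by rewrite /v mN.
have v0E : v 0 = v1 by rewrite /v m0.
have vpole (t : R) : z1 <= `|t| -> v t = 0.
  by move=> tz; apply: V0; rewrite mabs subr_le0.
have vgt0 (t : R) : `|t| < z1 -> 0 < v t.
  move=> tz; rewrite /v; have [->|t0] := eqVneq t 0; first by rewrite m0 Vz1.
  have mt : 0 < m t < z1 by rewrite mz' // andbT mabs subr_gt0.
  by have /andP[] := V01 _ mt.
have vlt (t : R) : t != 0 -> v t < v1.
  move=> t0; have [tz|/vpole->//] := ltP `|t| z1.
  have mt : 0 < m t < z1 by rewrite mz' // andbT mabs subr_gt0.
  by have /andP[] := V01 _ mt.
have v2 (t : R) : kappa * v t < 2 by apply: (ph_lt2 ga _ (vle t)); case/andP: (v01 t).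
pose k (t : R) := ph_k ph (v t).
have kc : continuous k.
  move=> t; apply: (@ct_comp _ _ v (ph_k ph)); last exact: vc.
  exact: ct_ph_k.
have kN (t : R) : k (- t) = k t by rewrite /k vN.
have k0 (t : R) : 0 < k t by exact: ph_k_gt0.
pose w (t : R) := Num.sqrt (ph_cos2 ph (v t)).
have wc : continuous w.
  move=> t; apply: ct_sqrt; apply: (@ct_comp _ _ v (ph_cos2 ph)); last exact: vc.
  exact: ct_ph_cos2.
have wN (t : R) : w (- t) = w t by rewrite /w vN.
have w0E : w 0 = 0 by rewrite /w v0E ph_cos2_v1 // sqrtr0.
have w2 (t : R) : w t ^+ 2 = ph_cos2 ph (v t).
  by rewrite sqr_sqrtr //; case/andP: (ph_cos2_le1 (p := ph) ga (v01 t)).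
pose c (t : R) := if t <= 0 then w t else - w t.
have cN (t : R) : c (- t) = - c t.
  rewrite /c oppr_le0 wN; case: (ltgtP 0 t) => [||<-] //; first by rewrite opprK.
  by rewrite w0E oppr0.
have c2 (t : R) : c t ^+ 2 = ph_cos2 ph (v t) by rewrite /c; case: (leP t 0); rewrite ?sqrrN.
have cc : continuous c.
  move=> t; case: (ltgtP t 0) => [t0|t0|->].
  - apply: (@continuous1_locally R w _ t (- t)); [lra| |exact: wc].
    move=> s; rewrite ltr_norml => /andP[_ st]; rewrite /c ifT //; lra.
  - apply: (@continuous1_locally R (fun t => - w t) _ t t t0); last by ct.
    move=> s; rewrite ltr_norml => /andP[st _]; rewrite /c ifF //.
    by apply/negbTE; rewrite -ltNge; lra.
  - apply/continuous1_eps => e e0.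
    have [r r0 rw] := (continuous1_eps w 0).1 (wc 0) e e0.
    exists r => // x /rw; rewrite w0E /c lexx w0E !subr0.
    by case: (leP x 0); rewrite ?normrN.
have s2 (t : R) : `|t| < z1 -> 0 < sn2 kappa (v t).
  by move=> tz; rewrite sn2_gt0 // vgt0.
have s0 (t : R) : `|t| < z1 -> 0 < sn kappa (v t) by move=> tz; rewrite sn_gt0 // vgt0.
(* on the lower half; reflection then gives the upper half *)
have vdn (t : R) : - z1 < t < 0 -> is_derive t 1 v (c t / k t).
  move=> /andP[zt t0].
  have mt : 0 < m t < z1 by rewrite mE ?ltW //; apply/andP; split; lra.
  have -> : c t / k t = Num.sqrt (ph_cos2 ph (V (m t))) / ph_k ph (V (m t)) * 1.
    by rewrite mulr1 /c ltW.
  apply: (@der_locally R (fun s => V (z1 + s)) _ t (- t)); first lra.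
    by move=> s; rewrite ltr_norml => /andP[_ st]; rewrite /v mE //; lra.
  eapply (@der_comp _ _ (fun s : R => z1 + s) V).
    by have := Vd (m t) mt; rewrite {1}mE // ltW.
  by eapply der_eq; [der | rewrite add0r].
pose pf (t : R) := c t / (k t * sn kappa (v t)).
pose pd (t : R) := (k t * (1 - kappa * v t) - 2 * g (k t * sn kappa (v t))) /
       (k t * sn kappa (v t)) ^+ 3.
have pdn (t : R) : - z1 < t < 0 -> is_derive t 1 pf (pd t).
  move=> tz; have dv := vdn t tz; case/andP: tz => zt t0.
  have tz : `|t| < z1 by rewrite ltr_norml zt /=; lra.
  have vt0 := vgt0 t tz; have vt1 : v t < v1 by apply: vlt; rewrite lt_eqF.
  apply: (@der_locally R (fun s => Num.sqrt (ph_cos2 ph (v s)) /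
     (ph_k ph (v s) * sn kappa (v s))) _ t (- t)); first lra.
    move=> s; rewrite ltr_norml => /andP[_ st]; rewrite /pf /c ifT //; lra.
  have C0 : 0 < ph_cos2 ph (v t) by apply: ph_cos2_gt0 => //; rewrite ltW.
  have K0 : 0 < ph_k ph (v t) := k0 t.
  have S0 := s0 t tz.
  have D1 := der_comp (der_ph_cos2 ph vt0 (v2 t)) dv.
  have D2 := der_comp (der_ph_k ph vt0 (v2 t)) dv.
  have D3 := der_comp (der_sn vt0 (v2 t)) dv.
  have w0 : 0 < w t by rewrite sqrtr_gt0.
  eapply der_eq.
    eapply der_mul; first by eapply der_sqrt; [exact: C0 | exact: D1].
    eapply der_inv; last by eapply der_mul; [exact: D2 | exact: D3].
    by rewrite mulf_neq0 // gt_eqF.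
  rewrite /pd /= -(ph_sin ga vt0 (vle t)) -/(k t) -/(w t).
  have -> : c t = w t by rewrite /c ltW.
  have W2 : k t ^+ 2 * sn kappa (v t) ^+ 2 = 1 - w t ^+ 2.
    by rewrite w2 /ph_cos2 sqr_sn ?(ltW (s2 t tz)) // /k; ring.
  set G := g _.
  rewrite -(sqr_sn (ltW (s2 t tz))).
  set K := k t in W2 *; set S := sn kappa (v t) in S0 W2 *.
  set X := w t in w0 W2 *; set Cv := 1 - kappa * v t.
  have K0' : 0 < K := k0 t.
  transitivity ((K * Cv - 2 * G) * (K ^+ 2 * S ^+ 2 + X ^+ 2) / (K * S) ^+ 3).
    by field; rewrite !gt_eqF.
  by rewrite W2 subrK mulr1.
have vd_pos (t : R) : 0 < t < z1 -> is_derive t 1 v (c t / k t).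
  move=> /andP[t0 tz]; have -> : v = fun s => v (- s) by apply/funext => s.
  have -> : c t / k t = - (c (- t) / k (- t)) by rewrite cN kN mulNr opprK.
  by apply/der_reflect/vdn; apply/andP; split; lra.
have pd_pos (t : R) : 0 < t < z1 -> is_derive t 1 pf (pd t).
  move=> /andP[t0 tz].
  have -> : pf = fun s => - pf (- s).
    by apply/funext => s; rewrite /pf cN kN vN mulNr opprK.
  have -> : pd t = - - pd (- t) by rewrite opprK /pd kN vN.
  by apply/der_opp/der_reflect/pdn; apply/andP; split; lra.
have off0 (P : R -> Prop) : (forall t : R, - z1 < t < 0 -> P t) ->
    (forall t : R, 0 < t < z1 -> P t) -> forall s : R, `|s - 0| < z1 -> s != 0 -> P s.
  move=> Pn Pp s; rewrite subr0 ltr_norml => /andP[sz zs].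
  rewrite neq_lt => /orP[]s0'; first by apply: Pn; rewrite sz.
  by apply: Pp; rewrite s0'.
have sc := @ct_sn R kappa.
have kS0 (t : R) : `|t| < z1 -> k t * sn kappa (v t) != 0.
  by move=> tz; rewrite mulf_neq0 // gt_eqF // s0.
have snv : continuous (fun t => sn kappa (v t)).
  by move=> t; apply: ct_comp; [exact: sc | exact: vc].
have pfc (t : R) : `|t| < z1 -> continuous_at t pf.
  by move=> /kS0 ?; rewrite /pf; ct.
have gkc : continuous (fun t => g (k t * sn kappa (v t))).
  by move=> t; apply: ct_comp; [exact: gc | ct].
have pdc (t : R) : `|t| < z1 -> continuous_at t pd.
  move=> /kS0 nz; rewrite /pd; ct; exact: expf_neq0.
have z0 : `|0 : R| < z1 by rewrite normr0.
have v_der (t : R) : `|t| < z1 -> is_derive t 1 v (c t / k t).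
  move=> tz; have [->|t0] := eqVneq t 0; last first.
    by move: tz t0; rewrite -{1}(subr0 t); move: t; exact: off0.
  apply: (@is_derive1_limit R v (fun t => c t / k t) 0 z1 z10 (off0 _ vdn vd_pos)).
    exact: vc.
  by ct; rewrite gt_eqF.
have p_der (t : R) : `|t| < z1 -> is_derive t 1 pf (pd t).
  move=> tz; have [->|t0] := eqVneq t 0; last first.
    by move: tz t0; rewrite -{1}(subr0 t); move: t; exact: off0.
  apply: (@is_derive1_limit R pf pd 0 z1 z10 (off0 _ pdn pd_pos)).
    exact: pfc.
  exact: pdc.
(* near the pole, W is an antiderivative of q, cut off where q is still bounded *)
pose v0 := v1 / 2; have v00 : 0 < v0 by rewrite divr_gt0.
have v0v1 : v0 < v1 by rewrite /v0; lra.
pose q (w : R) := ph_k ph w / Num.sqrt (ph_cos2 ph w).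
have qc (x : R) : 0 <= x < v1 -> continuous_at x q.
  move=> /andP[x0 xv]; have kx := ct_ph_k ga (ltW xv).
  have cx := ct_ph_cos2 ga (ltW xv); rewrite /q; ct.
  by rewrite gt_eqF // sqrtr_gt0 ph_cos2_gt0 // x0.
pose cl (x : R) := Num.max 0 (Num.min x v0).
have clI (x : R) : 0 <= cl x <= v0 by apply: clamp_itv; exact: ltW.
have qcl : continuous (fun x => q (cl x)).
  move=> x; apply: ct_comp; last exact: ct_clamp.
  by apply: qc; have /andP[a b] := clI x; rewrite a (le_lt_trans b).
have [B qB] : exists B, forall x : R, `|q (cl x)| <= B.
  have [|x _ xm] := @continuous_itv_min R (fun x => - `|q x|) 0 v0 (ltW v00).
    move=> x /andP[x0 xv]; have qx := qc x ltac:(rewrite x0 /=; lra).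
    by ct.
  exists `|q x| => t; rewrite -lerN2; exact: xm.
have [W [W0 Wlip Wd]] := @peano R (fun x _ => q (cl x)) B (fun x _ => qB x).
have W_der (x : R) : 0 < x < v0 -> is_derive x 1 W (q x).
  move=> /andP[x0 xv]; have <- : q (cl x) = q x.
    by rewrite /cl min_l ?max_r // ltW.
  apply: Wd => //; apply: (@ct_comp _ _ (fun q : R * R => q.1) (fun x => q (cl x))).
    exact: qcl.
  exact: cvg_fst.
have Wc := lipschitz_continuous Wlip.
have Vmono (s t : R) : 0 <= s -> s < t -> t <= z1 -> V s < V t.
  move=> s0' st tz; have [x _|x /andP[sx xt]|x /andP[sx xt] E] := @mvt R V
      (fun t => Num.sqrt (ph_cos2 ph (V t)) / ph_k ph (V t)) s t st.
  - exact: Vc.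
  - by apply: Vd; rewrite (le_lt_trans s0' sx) (lt_le_trans xt).
  - have x01 : 0 < x < z1 by rewrite (le_lt_trans s0' sx) (lt_le_trans xt).
    have /andP[Vx0 Vx1] := V01 x x01.
    rewrite -subr_gt0 E; apply: mulr_gt0; last by rewrite subr_gt0.
    apply: divr_gt0; last by apply: ph_k_gt0 => //; exact: ltW.
    by rewrite sqrtr_gt0 ph_cos2_gt0 // ltW.
have Wv (t : R) : - z1 <= t < 0 -> v t < v0 -> W (v t) = t + z1.
  move=> /andP[zt t0]; rewrite /v mE ?ltW // (addrC z1) => VT.
  set T := t + z1 in VT *; have T0 : 0 <= T by rewrite /T; lra.
  have Tz : T < z1 by rewrite /T; lra.
  move: T0; rewrite le_eqVlt => /predU1P[<-|T0]; first by rewrite V0 // W0.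
  have [x _|x /andP[x0 xT]|x _ E] := @mvt R (fun s => W (V s) - s) (fun=> 0) 0 T T0.
  - by ct.
  - have x01 : 0 < x < z1 by rewrite x0 (lt_trans xT).
    have /andP[Vx0 Vx1] := V01 x x01.
    have Vxv : V x < v0 by apply: lt_trans VT; apply: Vmono (ltW x0) xT (ltW Tz).
    have dW := W_der (V x) ltac:(by rewrite Vx0).
    have D := der_comp dW (Vd x x01).
    eapply der_eq; first exact: (der_add D (der_opp (der_id x 1))).
    have kx : ph_k ph (V x) != 0 by rewrite gt_eqF // ph_k_gt0 // ltW.
    have cx : Num.sqrt (ph_cos2 ph (V x)) != 0.
      by rewrite gt_eqF // sqrtr_gt0 ph_cos2_gt0 // ltW.
    by rewrite /= /q; field; rewrite kx.
  - by move: E; rewrite (V0 0 (lexx 0)) (W0 0 (lexx 0)) mul0r !subr0 => /subr0_eq.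
have vW (x : R) : 0 <= x < v0 -> exists2 t, - z1 <= t < 0 & v t = x.
  move=> /andP[x0 xv]; have [|||s] := @IVT R V 0 z1 x.
  - exact: ltW.
  - by apply: continuous_subspaceT; exact: Vc.
  - by rewrite V0 // Vz1 min_l ?max_r ?(ltW v10) // x0 ltW // (lt_trans xv).
  - rewrite in_itv /= => /andP[s0' sz] Vs.
    have sz' : s < z1.
      by rewrite lt_neqAle sz andbT; apply/eqP => E; rewrite E Vz1 in Vs; lra.
    exists (s - z1); first by apply/andP; split; lra.
    by rewrite /v mE; [rewrite addrC subrK | lra].
have vz1 : v z1 = 0 by apply: vpole; rewrite gtr0_norm.
apply: inhabits.
apply: (@Profile R kappa g z1 v k c z10 vc kc cc vN cN vpole vgt0 v2 k0 _ _
  v_der p_der v0 W q (cap_psi ph) v00 _ _ _ _ _ (cap_psi_axis ph)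
  W_der _ Wv vW).
- rewrite /c oppr_le0 ltW // /w vN vz1 /ph_cos2 /sn2 mul0r mulr0 subr0.
  exact: sqrtr1.
- by move=> t; rewrite c2 /ph_cos2 subrK.
- by apply: (ph_lt2 ga (ltW v00) (ltW v0v1)).
- by exists B.
- by move=> x /andP[x0 xv]; apply: qc; rewrite x0 (lt_trans xv).
- by move=> x /andP[x0 xv]; apply: ct_cap_psi; rewrite // x0 (lt_trans xv).
- by rewrite /q /ph_k lexx /ph_cos2 /sn2 mul0r mulr0 subr0 sqrtr1 divr1.
- by move=> x /andP[x0 xv]; apply: der_cap_q; rewrite // x0 (lt_trans xv).
Qed.

(** * From the prescribed function to the phase plane *)

Lemma C1_on_I_derivable R (H : R -> R) (y : R) :
  C1_on_I H -> -1 <= y <= 1 ->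
  exists l, forall e, 0 < e -> exists2 r, 0 < r & forall x, -1 <= x <= 1 ->
    `|x - y| < r -> `|H x - H y - l * (x - y)| <= e * `|x - y|.
Proof.
move=> [dH _ HdH] y1; exists (dH y) => e e0.
have /cvgrPdist_le/(_ e e0) [r /= r0 rH] := HdH y y1.
exists r => // x x1 xr.
have [->|xy] := eqVneq x y; first by rewrite !subrr mulr0 subr0 normr0 mulr0.
have xy0 : x - y != 0 by rewrite subr_eq0.
have := rH x; rewrite /= distrC => /(_ xr xy) H1.
have := H1 ltac:(by rewrite in_itv).
rewrite distrC => H2.
have -> : H x - H y - dH y * (x - y) =
   ((H x - H y) / (x - y) - dH y) * (x - y) by field.
by rewrite normrM ler_wpM2r.
Qed.

(** The derivative at [0] of an even function equals its own opposite. *)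
Lemma C1_even_flat R (H : R -> R) :
  C1_on_I H -> (forall y, -1 <= y <= 1 -> H y = H (- y)) ->
  forall e, 0 < e -> exists2 r, 0 < r & forall x, -1 <= x <= 1 ->
    `|x| < r -> `|H x - H 0| <= e * `|x|.
Proof.
move=> HC Heven; have [l Hl] := @C1_on_I_derivable R H 0 HC ltac:(lra).
have l0 : l = 0.
  apply/eqP/negPn/negP => l0.
  have n0 : 0 < `|l| / 2 by rewrite divr_gt0 // normr_gt0.
  have [r r0 rH] := Hl _ n0.
  pose x := Num.min 1 (r / 2).
  have x0 : 0 < x by rewrite lt_min ltr01 divr_gt0.
  have x1 : x <= 1 by rewrite ge_min lexx.
  have xr : x <= r / 2 by rewrite ge_min lexx orbT.
  have x1' : -1 <= x <= 1 by apply/andP; split; lra.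
  have A := rH x x1'; have B := rH (- x) ltac:(apply/andP; split; lra).
  rewrite !subr0 (gtr0_norm x0) in A; rewrite !subr0 normrN (gtr0_norm x0) in B.
  have {}A := A ltac:(lra); have {}B := B ltac:(lra).
  rewrite -Heven // in B.
  have : `|(H x - H 0 - l * - x) - (H x - H 0 - l * x)| <=
      `|l| / 2 * x + `|l| / 2 * x.
    by apply: le_trans (ler_normB _ _) _; exact: lerD.
  have -> : H x - H 0 - l * - x - (H x - H 0 - l * x) = 2 * l * x by ring.
  rewrite !normrM (gtr0_norm x0) ger0_norm //; nra.
move=> e /Hl [r r0 rH]; exists r => // x x1 xr.
by have := rH x x1; rewrite l0 mul0r !subr0; exact.
Qed.

Lemma sqrt_onem_itv R (x : R) : 0 <= Num.sqrt (1 - x ^+ 2) <= 1.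
Proof.
rewrite sqrtr_ge0 /= -[X in _ <= X](sqrtr1 R) ler_wsqrtr // gerBl.
exact: sqr_ge0.
Qed.

(** Multiplying by the sign of [H 1] amounts to reversing the normal. In the
    hyperbolic case [2 |H|] dominates the sine [x] of the slope angle, so that
    [H] cannot change sign, and compactness makes the domination uniform. *)
Lemma class_admissible R (kappa : R) (H : R -> R) :
  kappa = -1 \/ kappa = 1 -> class_C1_kappa kappa H -> H 1 != 0 ->
  admissible kappa (fun x => Num.sg (H 1) * H (Num.sqrt (1 - x ^+ 2))).
Proof.
move=> kE [HC Heven Hhyp] H1; set eps := Num.sg (H 1).
pose w (x : R) := Num.sqrt (1 - x ^+ 2).
have w01 (x : R) : -1 <= w x <= 1.
  by have /andP[a b] := sqrt_onem_itv x; rewrite b andbT (le_trans _ a).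
have wc : continuous w by move=> x; rewrite /w; ct.
pose g x := eps * H (w x).
have Hc (y : R) : -1 <= y <= 1 -> forall e, 0 < e -> exists2 r, 0 < r &
    forall x, -1 <= x <= 1 -> `|x - y| < r -> `|H x - H y| < e.
  move=> y1 e e0; have [l Hl] := C1_on_I_derivable HC y1.
  have [r r0 rH] := Hl 1 ltr01.
  have l1 : 0 < `|l| + 1 by rewrite ltr_wpDl.
  exists (Num.min r (e / (`|l| + 1))) => [|x x1].
    by rewrite lt_min r0 divr_gt0.
  rewrite lt_min => /andP[/(rH x x1) A]; rewrite ltr_pdivlMr // => B.
  rewrite -(subrK (l * (x - y)) (H x - H y)).
  apply: le_lt_trans (ler_normD _ _) _; rewrite normrM; apply: le_lt_trans B.
  have -> : `|x - y| * (`|l| + 1) = 1 * `|x - y| + `|l| * `|x - y| by ring.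
  by rewrite lerD2r.
have gc : continuous g.
  move=> x; have Hwc : continuous_at x (fun x => H (w x)).
    apply/continuous1_eps => e e0; have [r r0 rH] := Hc _ (w01 x) e e0.
    have [d d0 dw] := (continuous1_eps w x).1 (wc x) r r0.
    by exists d => // t td; apply: rH (w01 t) _; exact: dw.
  by rewrite /g; ct.
have g0 : 0 < g 0.
  by rewrite /g /w expr0n subr0 sqrtr1 /eps -normrEsg normr_gt0.
have w1 : w 1 = 0 by rewrite /w expr1n subrr sqrtr0.
have absg (x : R) : `|g x| = `|H (w x)|.
  by rewrite normrM /eps normr_sg H1 mul1r.
split=> //.
- have [|x _ xm] := @continuous_itv_min R (fun x => - `|g x|) (-1) 1 ltac:(lra).
    by move=> x _; ct.
  have {}xm (t : R) : -1 <= t <= 1 -> `|g t| <= `|g x|.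
    by move=> t1; rewrite -lerN2; exact: xm.
  exists `|g x| => t; have [t1|t1] := leP (t ^+ 2) 1.
    by apply: xm; rewrite -ler_norml -(expr1n _ 2) -(ler_pXn2r (n := 2)) ?nnegrE //
      ?expr1n ?real_normK ?num_real.
  rewrite -/(g t); have -> : g t = g 1.
    by rewrite /g w1 /w ler0_sqrtr // subr_le0 ltW.
  by apply: xm; lra.
- move=> e e0; have [r r0 rH] := C1_even_flat HC Heven e0.
  exists (r ^+ 2) => [|x x01 xr]; first exact: exprn_gt0.
  rewrite -/(w x) -/(w 1) w1 -mulrBr normrM normr_sg H1 mul1r.
  have w0 : 0 <= w x := sqrtr_ge0 _.
  rewrite -{2}(ger0_norm w0); apply: rH (w01 x) _.
  rewrite (ger0_norm w0) -(ltr_pXn2r (n := 2)) ?nnegrE ?(ltW r0) // sqr_sqrtr //.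
  by rewrite subr_ge0 exprn_ile1; case/andP: x01.
- move=> km1; have {}Hhyp := Hhyp km1.
  have gx (x : R) : 0 <= x <= 1 -> x < 2 * `|g x|.
    move=> /andP[x0 x1]; rewrite absg; apply: le_lt_trans (Hhyp _ (w01 x)).
    rewrite /w sqr_sqrtr ?subr_ge0 ?exprn_ile1 //.
    by rewrite opprB addrC subrK sqrtr_sqr ger0_norm.
  have gpos (x : R) : 0 <= x <= 1 -> 0 < g x.
    move=> /andP[x0 x1]; rewrite ltNge; apply/negP => gx0.
    have [|||c /andP[c0 cx] [gc0 _]] := @first_zero R (fun x => - g x) 0 x x0.
    + by move=> t _; ct.
    + by rewrite oppr_lt0.
    + by rewrite oppr_ge0.
    have := gx c; rewrite (ltW c0) (le_trans cx x1) => /(_ isT).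
    move/eqP: gc0; rewrite oppr_eq0 => /eqP ->; rewrite normr0 mulr0.
    by rewrite ltNge (ltW c0).
  have [|c c01 cm] := @continuous_itv_min R (fun x => 2 * g x - x) 0 1 ler01.
    by move=> t _; ct.
  exists (2 * g c - c).
    by have := gx c c01; rewrite (gtr0_norm (gpos c c01)) subr_gt0.
  by move=> x /cm; rewrite -/(w x) -/(g x); lra.
Qed.

(** * Functions of class C^k of two parameters *)

Lemma is_derive_partial R (V : normedModType R) (i : 'I_2)
    (X : 'rV[R]_2 -> V) (u : 'rV[R]_2) (l : V) :
  is_derive u (delta_mx 0 i) X l -> partial i X u = l.
Proof. by case. Qed.

Lemma open_near R (U : set 'rV[R]_2) (P : 'rV[R]_2 -> Prop)
    (u : 'rV[R]_2) : open U -> U u -> (forall w, U w -> P w) ->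
  \forall w \near u, P w.
Proof.
by move=> oU Uu UP; apply: filterS (open_nbhs_nbhs (conj oU Uu)) => w /UP.
Qed.

Lemma open_continuous_eq (T V : topologicalType) (U : set T) (X Y : T -> V)
    (u : T) : open U -> U u -> (forall w, U w -> X w = Y w) ->
  {for u, continuous X} -> {for u, continuous Y}.
Proof.
move=> oU Uu XY Xc; rewrite /prop_for /continuous_at -(XY u Uu).
apply: cvg_trans Xc; apply: near_eq_cvg.
by apply: filterS (open_nbhs_nbhs (conj oU Uu)) => w /XY.
Qed.

Lemma class_C_eq R (V : normedModType R) (k : nat)
    (U : set 'rV[R]_2) (X Y : 'rV[R]_2 -> V) : open U ->
  (forall u, U u -> X u = Y u) -> class_C k U X -> class_C k U Y.
Proof.
move=> oU; elim: k X Y => [|k IH] X Y XY /= [Xc Xd].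
all: have cY u (Uu : U u) : {for u, continuous Y}
  by exact: open_continuous_eq oU Uu XY (Xc u Uu).
  by split.
split=> // i; have [Xi Xk] := Xd i.
have XYn u (Uu : U u) : \near u, X u = Y u by exact: (open_near oU Uu).
split; first by move=> u Uu; apply: near_eq_derivable (XYn u Uu) (Xi u Uu).
apply: IH Xk => u Uu; rewrite /partial.
by apply: near_eq_derive; exact: XYn.
Qed.

Lemma class_C_step R (V : normedModType R) (k : nat)
    (U : set 'rV[R]_2) (X : 'rV[R]_2 -> V) (Y : 'I_2 -> 'rV[R]_2 -> V) :
  open U -> (forall u, U u -> {for u, continuous X}) ->
  (forall i u, U u -> is_derive u (delta_mx 0 i) X (Y i u)) ->
  (forall i, class_C k U (Y i)) -> class_C k.+1 U X.
Proof.
move=> oU Xc Xd Yk; split=> // i; split; first by move=> u Uu; case: (Xd i u Uu).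
apply: class_C_eq oU _ (Yk i) => u Uu.
by rewrite (is_derive_partial (Xd i u Uu)).
Qed.

Lemma class_C_derive R (V : normedModType R) (k : nat)
    (U : set 'rV[R]_2) (X : 'rV[R]_2 -> V) (i : 'I_2) (u : 'rV[R]_2) :
  class_C k.+1 U X -> U u -> is_derive u (delta_mx 0 i) X (partial i X u).
Proof. by move=> [_ /(_ i)[Xi _]] Uu; apply: DeriveDef => //; exact: Xi. Qed.

Lemma class_C_continuous R (V : normedModType R) (k : nat)
    (U : set 'rV[R]_2) (X : 'rV[R]_2 -> V) (u : 'rV[R]_2) :
  class_C k U X -> U u -> {for u, continuous X}.
Proof. by case: k => [|k] [Xc _]; exact: Xc. Qed.

Lemma class_C_partial R (V : normedModType R) (k : nat)
    (U : set 'rV[R]_2) (X : 'rV[R]_2 -> V) (i : 'I_2) :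
  class_C k.+1 U X -> class_C k U (partial i X).
Proof. by move=> [_ /(_ i)[]]. Qed.

Lemma class_C_lower R (V : normedModType R) (k : nat)
    (U : set 'rV[R]_2) (X : 'rV[R]_2 -> V) :
  class_C k.+1 U X -> class_C k U X.
Proof.
elim: k X => [|k IH] X XC; first by split=> // u; exact: class_C_continuous XC.
split=> [u|i]; first exact: class_C_continuous XC.
split; first by move=> u Uu; case: (class_C_derive i XC Uu).
by apply: IH; exact: class_C_partial.
Qed.

Lemma ct_addV R (T : topologicalType) (V : normedModType R)
    (X Y : T -> V) (t : T) : continuous_at t X -> continuous_at t Y ->
  continuous_at t (fun x => X x + Y x).
Proof. exact: cvgD. Qed.
Lemma ct_scaleV R (T : topologicalType) (V : normedModType R)
    (f : T -> R) (c : V) (t : T) : continuous_at t f ->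
  continuous_at t (fun x => f x *: c).
Proof. exact: cvgZr_tmp. Qed.

Lemma class_C_cst R (V : normedModType R) (k : nat)
    (U : set 'rV[R]_2) (c : V) : open U -> class_C k U (fun=> c).
Proof.
move=> oU; elim: k c => [|k IH] c.
  by split=> // u _; exact: cst_continuous.
have cc u (Uu : U u) : {for u, continuous (fun=> c : V)}.
  exact: cst_continuous.
have dc (i : 'I_2) u (Uu : U u) :
    is_derive u (delta_mx 0 i : 'rV[R]_2) (fun=> c) (0 : V) by exact: der_cst.
exact: (class_C_step oU cc dc (fun _ => IH 0)).
Qed.

Lemma class_C_add R (V : normedModType R) (k : nat)
    (U : set 'rV[R]_2) (X Y : 'rV[R]_2 -> V) : open U ->
  class_C k U X -> class_C k U Y -> class_C k U (fun u => X u + Y u).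
Proof.
move=> oU; elim: k X Y => [|k IH] X Y XC YC.
all: have cXY u : U u -> {for u, continuous (fun u => X u + Y u)}
  by move=> Uu; have cX := class_C_continuous XC Uu;
     have cY := class_C_continuous YC Uu; exact: (ct_addV cX cY).
  by split.
eapply (class_C_step (Y := fun i u => partial i X u + partial i Y u)) => //.
  by move=> i u Uu; exact: (der_add (class_C_derive i XC Uu) (class_C_derive i YC Uu)).
by move=> i; apply: IH; exact: class_C_partial.
Qed.

Lemma class_C_mul R (k : nat)
    (U : set 'rV[R]_2) (X Y : 'rV[R]_2 -> R) : open U ->
  class_C k U X -> class_C k U Y -> class_C k U (fun u => X u * Y u).
Proof.
move=> oU; elim: k X Y => [|k IH] X Y XC YC.
all: have cXY u : U u -> {for u, continuous (fun u => X u * Y u)}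
  by move=> Uu; have cX := class_C_continuous XC Uu;
     have cY := class_C_continuous YC Uu; exact: (ct_mul cX cY).
  by split.
eapply (class_C_step
  (Y := fun i u => partial i X u * Y u + X u * partial i Y u)) => //.
  by move=> i u Uu; exact: (der_mul (class_C_derive i XC Uu) (class_C_derive i YC Uu)).
move=> i; apply: class_C_add => //; apply: IH.
- exact: class_C_partial.
- exact: class_C_lower.
- exact: class_C_lower.
- exact: class_C_partial.
Qed.

Lemma class_C_inv R (k : nat) (U : set 'rV[R]_2)
    (X : 'rV[R]_2 -> R) : open U -> (forall u, U u -> X u != 0) ->
  class_C k U X -> class_C k U (fun u => (X u)^-1).
Proof.
move=> oU X0; elim: k X X0 => [|k IH] X X0 XC.
all: have cX u : U u -> {for u, continuous (fun u => (X u)^-1)}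
  by move=> Uu; exact: (ct_inv (X0 u Uu) (class_C_continuous XC Uu)).
  by split.
eapply (class_C_step
  (Y := fun i u => (- 1) * ((X u)^-1 * (X u)^-1) * partial i X u)) => //.
  move=> i u Uu; have D := class_C_derive i XC Uu.
  apply: der_eq; first exact: (der_inv (X0 u Uu) D).
  by rewrite mulN1r expr2 invfM.
have IX := IH X X0 (class_C_lower XC).
move=> i; apply: class_C_mul => //; last exact: class_C_partial.
by apply: class_C_mul => //; [exact: class_C_cst | exact: class_C_mul].
Qed.

Lemma class_C_sqrt R (k : nat) (U : set 'rV[R]_2)
    (X : 'rV[R]_2 -> R) : open U -> (forall u, U u -> 0 < X u) ->
  class_C k U X -> class_C k U (fun u => Num.sqrt (X u)).
Proof.
move=> oU X0; elim: k X X0 => [|k IH] X X0 XC.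
all: have cX u : U u -> {for u, continuous (fun u => Num.sqrt (X u))}
  by move=> Uu; exact: (ct_sqrt (class_C_continuous XC Uu)).
  by split.
eapply (class_C_step
  (Y := fun i u => 2^-1 * (Num.sqrt (X u))^-1 * partial i X u)) => //.
  move=> i u Uu; have D := class_C_derive i XC Uu.
  apply: der_eq; first exact: (der_sqrt (X0 u Uu) D).
  by rewrite invfM.
have IX := IH X X0 (class_C_lower XC).
move=> i; apply: class_C_mul => //; last exact: class_C_partial.
apply: class_C_mul => //; first exact: class_C_cst.
by apply: class_C_inv => // u /X0 ?; rewrite gt_eqF // sqrtr_gt0.
Qed.

Lemma der_coord R (u : 'rV[R]_2) (i j : 'I_2) :
  is_derive u (delta_mx 0 j) (fun w : 'rV[R]_2 => w 0 i) (i == j)%:R.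
Proof.
apply/is_derive1_line; eapply der_eq.
  have -> : (fun h : R => (h *: delta_mx 0 j + u : 'rV[R]_2) 0 i) =
     (fun h : R => h * (i == j)%:R + u 0 i).
    by apply/funext => h; rewrite !mxE eqxx.
  by eapply der_add; [eapply der_mul; [exact: der_id|exact: der_cst]|exact: der_cst].
by rewrite mul1r mulr0 !addr0.
Qed.

Lemma ct_coord R (u : 'rV[R]_2) (i : 'I_2) :
  {for u, continuous (fun w : 'rV[R]_2 => w 0 i)}.
Proof. exact: coord_continuous. Qed.
Arguments ct_coord {R} u i.

Lemma class_C_of_coord0 R (U : set 'rV[R]_2) (i : 'I_2)
    (f : R -> R) : (forall u : 'rV[R]_2, U u -> {for u 0 i, continuous f}) ->
  class_C 0 U (fun u => f (u 0 i)).
Proof.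
move=> fc; split=> // u Uu.
by apply: (ct_comp (f := fun w : 'rV[R]_2 => w 0 i)); [exact: fc|exact: ct_coord].
Qed.

Lemma class_C_of_coord R (k : nat) (U : set 'rV[R]_2) (i : 'I_2)
    (f df : R -> R) : open U ->
  (forall u : 'rV[R]_2, U u -> is_derive (u 0 i) 1 f (df (u 0 i))) ->
  class_C k U (fun u => df (u 0 i)) -> class_C k.+1 U (fun u => f (u 0 i)).
Proof.
move=> oU fd dfC.
eapply (class_C_step (Y := fun j u => df (u 0 i) * (i == j)%:R)) => //.
- move=> u Uu; apply: (ct_comp (f := fun w : 'rV[R]_2 => w 0 i)).
    exact: is_derive1_continuous (fd u Uu).
  exact: ct_coord.
- move=> j u Uu.
  exact: (@der_comp _ _ (fun w : 'rV[R]_2 => w 0 i) f _ _ _ _ (fd u Uu)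
    (der_coord u i j)).
- by move=> j; exact: (class_C_mul oU dfC (class_C_cst k _ oU)).
Qed.

Lemma class_C_coord R (k : nat) (U : set 'rV[R]_2) (i : 'I_2) :
  open U -> class_C k U (fun u => u 0 i).
Proof.
move=> oU; case: k => [|k].
  by split=> // u _; exact: ct_coord.
apply: (@class_C_of_coord R k U i id (fun=> 1)) => //; last exact: class_C_cst.
Qed.

(** * Coordinates on the ambient space *)

(** Written as a combination of constant vectors, so that differentiation and
    continuity reduce to sums and scalings. *)
Definition mk4 R (a b c d : R) : ambient R :=
  a *: (delta_mx 0 0, 0) + b *: (delta_mx 0 1, 0) + c *: (delta_mx 0 2, 0) +
  d *: (0, 1).

Lemma mk4_0 R (a b c d : R) : (mk4 a b c d).1 0 0 = a.
Proof. by rewrite /mk4 /= !mxE /= !mulr0 mulr1 !addr0. Qed.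

Lemma mk4_1 R (a b c d : R) : (mk4 a b c d).1 0 1 = b.
Proof. by rewrite /mk4 /= !mxE /= !mulr0 mulr1 !addr0 add0r. Qed.

Lemma mk4_2 R (a b c d : R) : (mk4 a b c d).1 0 2 = c.
Proof. by rewrite /mk4 /= !mxE /= !mulr0 mulr1 !add0r addr0. Qed.

Lemma mk4_3 R (a b c d : R) : (mk4 a b c d).2 = d.
Proof. by rewrite /mk4 /= /GRing.scale /= !mulr0 mulr1 !add0r. Qed.

Definition mk4E := (mk4_0, mk4_1, mk4_2, mk4_3).

Lemma ord3P (P : 'I_3 -> Prop) : P 0 -> P 1 -> P 2 -> forall j, P j.
Proof.
move=> P0 P1 P2 [[|[|[|//]]] j3].
- by rewrite (_ : Ordinal j3 = 0) //; exact: val_inj.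
- by rewrite (_ : Ordinal j3 = 1) //; exact: val_inj.
- by rewrite (_ : Ordinal j3 = 2) //; exact: val_inj.
Qed.

Lemma ambient_eq R (p q : ambient R) :
  p.1 0 0 = q.1 0 0 -> p.1 0 1 = q.1 0 1 -> p.1 0 2 = q.1 0 2 -> p.2 = q.2 ->
  p = q.
Proof.
case: p q => [x s] [y t] /= e0 e1 e2 ->; congr pair.
apply/rowP; exact: ord3P.
Qed.

Lemma mk4K R (q : ambient R) :
  mk4 (q.1 0 0) (q.1 0 1) (q.1 0 2) q.2 = q.
Proof. by apply: ambient_eq; rewrite mk4E. Qed.

Lemma der_scale R (V W : normedModType R) (f : V -> R) (c : W)
    (u e : V) (l : R) : is_derive u e f l ->
  is_derive u e (fun x => f x *: c) (l *: c).
Proof.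
case=> /= df dE.
have cl : h^-1 *: (f (h *: e + u) *: c - f u *: c) @[h --> 0^'] --> l *: c.
  have -> : (fun h => h^-1 *: (f (h *: e + u) *: c - f u *: c)) =
      (fun h => (h^-1 *: (f (h *: e + u) - f u)) *: c).
    by apply/funext => h; rewrite -scalerBl scalerA.
  by apply: cvgZr_tmp; rewrite -dE; exact: df.
by apply: DeriveDef; [apply/cvg_ex; exists (l *: c) | exact/cvg_lim].
Qed.

Lemma der_mk4 R (V : normedModType R) (a b c d : V -> R) (u e : V)
    (a' b' c' d' : R) : is_derive u e a a' -> is_derive u e b b' ->
  is_derive u e c c' -> is_derive u e d d' ->
  is_derive u e (fun x => mk4 (a x) (b x) (c x) (d x)) (mk4 a' b' c' d').
Proof.
move=> da db dc dd.
exact: (der_add (der_add (der_add (der_scale _ da) (der_scale _ db))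
  (der_scale _ dc)) (der_scale _ dd)).
Qed.

Lemma class_C_scale R (V : normedModType R) (k : nat)
    (U : set 'rV[R]_2) (f : 'rV[R]_2 -> R) (c : V) : open U ->
  class_C k U f -> class_C k U (fun u => f u *: c).
Proof.
move=> oU; elim: k f => [|k IH] f fC.
all: have cf u : U u -> {for u, continuous (fun u => f u *: c)}
  by move=> Uu; have cf := class_C_continuous fC Uu; apply: ct_scaleV; exact: cf.
  by split.
eapply (class_C_step (Y := fun i u => partial i f u *: c)) => //.
  by move=> i u Uu; exact: (der_scale c (class_C_derive i fC Uu)).
by move=> i; apply: IH; exact: class_C_partial.
Qed.

Lemma class_C_mk4 R (k : nat) (U : set 'rV[R]_2)
    (a b c d : 'rV[R]_2 -> R) : open U -> class_C k U a -> class_C k U b ->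
  class_C k U c -> class_C k U d ->
  class_C k U (fun u => mk4 (a u) (b u) (c u) (d u)).
Proof.
move=> oU aC bC cC dC.
exact: (class_C_add oU (class_C_add oU (class_C_add oU (class_C_scale _ oU aC)
  (class_C_scale _ oU bC)) (class_C_scale _ oU cC)) (class_C_scale _ oU dC)).
Qed.

Lemma ct_mk4 R (T : topologicalType) (a b c d : T -> R) (t : T) :
  continuous_at t a -> continuous_at t b -> continuous_at t c ->
  continuous_at t d ->
  continuous_at t (fun x => mk4 (a x) (b x) (c x) (d x)).
Proof. move=> ac bc cc dc; rewrite /mk4; apply: ct_addV; last exact: ct_scaleV.
apply: ct_addV; last exact: ct_scaleV.
by apply: ct_addV; exact: ct_scaleV.
Qed.

Lemma ct_ambient R (j : 'I_3) :
  continuous (fun q : ambient R => q.1 0 j).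
Proof.
move=> q; apply: (@continuous_comp _ _ _ fst (fun x : 'rV[R]_3 => x 0 j)).
  exact: cvg_fst.
exact: coord_continuous.
Qed.
Arguments ct_ambient {R} j _.

Lemma ct_height R : continuous (fun q : ambient R => q.2).
Proof. by move=> q; exact: cvg_snd. Qed.
Arguments ct_height {R} _.

Lemma form4_mk4 R (kappa : R) (a b c d a' b' c' d' : R) :
  form4 kappa (mk4 a b c d) (mk4 a' b' c' d') =
  a * a' + b * b' + kappa * (c * c') + d * d'.
Proof. by rewrite /form4 /form3 !mk4E. Qed.

(** * Surfaces as subsets of the ambient space *)

Lemma set_type_eq (T : Type) (A : set T) (s t : A) :
  set_val s = set_val t -> s = t.
Proof. exact: val_inj. Qed.

Lemma set_type_mem (T : Type) (A : set T) (s : A) : A (set_val s).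
Proof. exact: set_valP. Qed.

Lemma set_type_continuous (T : topologicalType) (A : set T) :
  continuous (set_val : A -> T).
Proof. exact: initial_continuous. Qed.

Lemma set_type_cvg (T X : topologicalType) (A : set T) (g : X -> A) (x : X) :
  {for x, continuous (fun y => set_val (g y))} -> {for x, continuous g}.
Proof.
move=> cg U [? /= [[W oW <-]]] /= Wgx /filterS; apply; apply: cg.
exact: open_nbhs_nbhs.
Qed.

Lemma set_type_embedding (T : topologicalType) (A : set T) :
  topological_embedding (set_val : A -> T).
Proof.
split; first exact: set_type_continuous; first by move=> s t; exact: set_type_eq.
by move=> U [B oB BU]; exists B.
Qed.

Lemma set_type_range (T : Type) (A : set T) : range (set_val : A -> T) = A.
Proof.
apply/seteqP; split=> [_ [s _ <-]|x Ax]; first exact: set_type_mem.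
by exists (exist _ x (mem_set Ax)).
Qed.

Lemma set_type_hausdorff (T : topologicalType) (A : set T) :
  hausdorff_space T -> hausdorff_space A.
Proof.
move=> hT s t st; apply: set_type_eq; apply: hT => U V Us Vt.
have [w [Uw Vw]] := st _ _ (set_type_continuous Us) (set_type_continuous Vt).
by exists (set_val w).
Qed.

Lemma set_type_compact (T : topologicalType) (A : set T) :
  compact A -> compact [set: A].
Proof.
move=> cA F PF _; have FA : F (set_val @^-1` A).
  by apply: filterE => s; exact: set_type_mem.
have [x [Ax clx]] := cA (set_val @ F) _ FA.
exists (exist _ x (mem_set Ax)); split=> // B U FB [? /= [[W oW <-]]] /= Wx WU.
have FB' : F (set_val @^-1` (set_val @` B)) by apply: filterS FB => s Bs; exists s.
have [_ [[s Bs <-] Ws]] := clx _ _ FB' (open_nbhs_nbhs (conj oW Wx)).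
by exists s; split=> //; exact: WU.
Qed.

(** Closed sets are compact, so their images are compact, hence closed. *)
Lemma compact_embedding (S T : topologicalType) (f : S -> T) :
  compact [set: S] -> hausdorff_space T -> continuous f -> injective f ->
  topological_embedding f.
Proof.
move=> cS hT fc fi; split=> // A oA.
exists (~` (f @` (~` A))).
  apply: closed_openC; apply: compact_closed => //.
  apply: continuous_compact; first exact: continuous_subspaceT.
  by apply: (subclosed_compact _ cS) => //; exact: open_closedC.
apply/seteqP; split=> s /=; last by move=> As [t nAt /fi ts]; rewrite ts in nAt.
by move=> nf; apply: contrapT => nA; apply: nf; exists s.
Qed.

(** A chart comes with the open set [W] that it covers and with a continuous
    inverse [Y], defined on the ambient space: this is what makes [X] open as a
    map into [A]. *)
Record patch R (A : set (ambient R)) (U : set 'rV[R]_2)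
    (X : 'rV[R]_2 -> ambient R) (W : set (ambient R))
    (Y : ambient R -> 'rV[R]_2) : Prop := Patch {
  patch_open : open U;
  patch_openW : open W;
  patch_in : forall u, U u -> A (X u) /\ W (X u);
  patch_K : forall u, U u -> Y (X u) = u;
  patch_inv : forall q, A q -> W q -> U (Y q) /\ X (Y q) = q;
  patch_cont : forall q, A q -> W q -> {for q, continuous Y};
  patch_C2 : class_C 2 U X;
  patch_immersion : forall u, U u -> forall a b : R,
    a *: partial 0 X u + b *: partial 1 X u = 0 -> a = 0 /\ b = 0 }.

(** The parametrization with values in the subspace; [s0] is a default value
    where [X] leaves [A]. *)
Definition patch_map R (A : set (ambient R)) (s0 : A)
    (X : 'rV[R]_2 -> ambient R) (u : 'rV[R]_2) : A :=
  if pselect (A (X u)) is left h then exist _ (X u) (mem_set h) else s0.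

Lemma patch_mapE R (A : set (ambient R)) (s0 : A) U X W Y u :
  patch A U X W Y -> U u -> set_val (patch_map s0 X u) = X u.
Proof.
move=> P Uu; rewrite /patch_map; case: pselect => //= nA.
by case: (patch_in P Uu).
Qed.

Lemma patch_partial R (A : set (ambient R)) (s0 : A) U X W Y i u :
  patch A U X W Y -> U u ->
  partial i (set_val \o patch_map s0 X) u = partial i X u.
Proof.
move=> P Uu; apply: near_eq_derive.
by apply: (open_near (patch_open P) Uu) => w Uw /=; rewrite (patch_mapE s0 P Uw).
Qed.

Lemma patch_partial2 R (A : set (ambient R)) (s0 : A) U X W Y
    i j u : patch A U X W Y -> U u ->
  partial i (partial j (set_val \o patch_map s0 X)) u = partial i (partial j X) u.
Proof.
move=> P Uu; apply: near_eq_derive.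
by apply: (open_near (patch_open P) Uu) => w Uw; exact: (patch_partial s0 j P Uw).
Qed.

Lemma patch_local_param R (A : set (ambient R)) (s0 : A) U X W Y :
  patch A U X W Y -> local_param (set_val : A -> ambient R) U (patch_map s0 X).
Proof.
move=> P; have oU := patch_open P.
have E u : U u -> set_val (patch_map s0 X u) = X u := patch_mapE s0 P.
split.
- exact: oU.
- move=> u Uu; apply: set_type_cvg.
  apply: (open_continuous_eq oU Uu (fun w Uw => esym (E w Uw))).
  exact: (class_C_continuous (patch_C2 P) Uu).
- move=> u w /set_mem Uu /set_mem Uw uw.
  by rewrite -(patch_K P Uu) -(patch_K P Uw) -!E // uw.
- move=> V oV VU; rewrite openE => _ [u Vu <-].
  have Uu := VU u Vu; have [AX WX] := patch_in P Uu.
  have Yc := patch_cont P AX WX.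
  have nV : nbhs (X u) (W `&` Y @^-1` V).
    apply: filterI; first exact: open_nbhs_nbhs (conj (patch_openW P) WX).
    by apply: Yc; rewrite (patch_K P Uu); exact: open_nbhs_nbhs.
  rewrite -(E u Uu) in nV.
  have nS : nbhs (patch_map s0 X u) (set_val @^-1` (W `&` Y @^-1` V)).
    exact: set_type_continuous.
  rewrite /interior; move: nS; apply: filterS => s [Ws Vs].
  exists (Y (set_val s)) => //.
  have [UY XY] := patch_inv P (set_type_mem s) Ws.
  by apply: set_type_eq; rewrite E.
- split; last first.
    move=> u Uu a b; rewrite !(patch_partial s0 _ P Uu).
    exact: patch_immersion P u Uu a b.
  by apply: class_C_eq oU _ (patch_C2 P) => u Uu; rewrite /= E.
Qed.

Lemma patch_cover R (A : set (ambient R)) (s0 : A) U X W Y (s : A) :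
  patch A U X W Y -> W (set_val s) ->
  [/\ U (Y (set_val s)), patch_map s0 X (Y (set_val s)) = s &
      X (Y (set_val s)) = set_val s].
Proof.
move=> P Ws; have [UY XY] := patch_inv P (set_type_mem s) Ws.
by split=> //; apply: set_type_eq; rewrite (patch_mapE s0 P UY).
Qed.

Lemma patch_normal R (kappa : R) (A : set (ambient R)) U X W Y
    (s : A) (v : ambient R) : patch A U X W Y -> W (set_val s) ->
  (forall i, form4 kappa (partial i X (Y (set_val s))) v = 0) ->
  normal_at kappa (set_val : A -> ambient R) s v.
Proof.
move=> P Ws nv; have [UY pY _] := patch_cover s P Ws.
exists U, (patch_map s X), (Y (set_val s)).
split; [exact: patch_local_param P | exact: UY | exact: pY | ].
by move=> i; rewrite (patch_partial s i P UY).
Qed.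

Lemma patch_mean_curvature R (kappa : R) (A : set (ambient R))
    U X W Y (eta : A -> ambient R) (s : A) (h : R) :
  patch A U X W Y -> W (set_val s) ->
  h = \tr (shape_operator kappa X (eta s) (Y (set_val s))) / 2 ->
  mean_curvature_at kappa (set_val : A -> ambient R) eta s h.
Proof.
move=> P Ws ->; have [UY pY _] := patch_cover s P Ws.
exists U, (patch_map s X), (Y (set_val s)).
split; [exact: patch_local_param P | exact: UY | exact: pY | ].
move: (Y _) UY {pY} => u UY.
have pe := fun i => patch_partial s i P UY.
have pe2 := fun i j => patch_partial2 s i j P UY.
move: (set_val \o _) pe pe2 => f pe pe2.
have eF : first_form kappa f u = first_form kappa X u.
  by rewrite /first_form; apply: eq_mx => i j; rewrite (pe i) (pe j).
have eS : second_form kappa f (eta s) u = second_form kappa X (eta s) u.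
  by rewrite /second_form; apply: eq_mx => i j; rewrite (pe2 i j).
by rewrite /shape_operator eF eS.
Qed.

Lemma compact_set_second_countable R (A : set (ambient R)) :
  compact A -> @second_countable A.
Proof.
move=> cA; have [[s0]|A0] := pselect (inhabited A); last first.
  exists set0; first exact: countable0.
  by split=> // x; case: A0; constructor.
pose T : pseudoPMetricType R := HB.pack (set_type A) (isPointed.Build (set_type A) s0).
exact: (@compact_second_countable R T (set_type_compact cA)).
Qed.

Lemma ambient_hausdorff R : hausdorff_space (ambient R).
Proof. exact: (@norm_hausdorff R (ambient R : normedModType R)). Qed.

Lemma set_type_immersed R (kappa : R) (A : set (ambient R)) :
  compact A -> A `<=` M2xR kappa ->
  (forall q, A q -> exists U X W Y, patch A U X W Y /\ W q) ->
  immersed_surface kappa (set_val : A -> ambient R).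
Proof.
move=> cA AM Ap; split.
- exact/set_type_hausdorff/ambient_hausdorff.
- exact: compact_set_second_countable.
- by move=> s; apply: AM; exact: set_type_mem.
- move=> s; have [U [X [W [Y [P Ws]]]]] := Ap _ (set_type_mem s).
  have [UY pY _] := patch_cover s P Ws.
  exists U, (patch_map s X); split; first exact: patch_local_param P.
  by exists (Y (set_val s)); [exact: UY | exact: pY].
Qed.

Lemma ord2P (P : 'I_2 -> Prop) : P 0 -> P 1 -> forall j, P j.
Proof.
move=> P0 P1 [[|[|//]] j2].
- by rewrite (_ : Ordinal j2 = 0) //; exact: val_inj.
- by rewrite (_ : Ordinal j2 = 1) //; exact: val_inj.
Qed.

Lemma form4C R (kappa : R) (v w : ambient R) :
  form4 kappa v w = form4 kappa w v.
Proof.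
by rewrite /form4 /form3; congr (_ + _ + kappa * _ + _); exact: mulrC.
Qed.

Lemma first_formE R (kappa : R) (X : 'rV[R]_2 -> ambient R)
    (u : 'rV[R]_2) (i j : 'I_2) :
  first_form kappa X u i j = form4 kappa (partial i X u) (partial j X u).
Proof. exact: mxE. Qed.

Lemma second_formE R (kappa : R) (X : 'rV[R]_2 -> ambient R)
    (v : ambient R) (u : 'rV[R]_2) (i j : 'I_2) :
  second_form kappa X v u i j = form4 kappa (partial i (partial j X) u) v.
Proof. exact: mxE. Qed.

Lemma trace_invmx_diag2 (R : fieldType) (A B : 'M[R]_2) :
  A 0 1 = 0 -> A 1 0 = 0 -> A 0 0 != 0 -> A 1 1 != 0 ->
  \tr (invmx A *m B) = B 0 0 / A 0 0 + B 1 1 / A 1 1.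
Proof.
move=> A01 A10 A0 A1.
pose d : 'rV[R]_2 := \row_j (A j j)^-1.
have DK : diag_mx d *m A = 1%:M.
  by apply/matrixP; apply: ord2P; apply: ord2P;
    rewrite mul_diag_mx !mxE /= ?A01 ?A10 ?mulr0 ?mulVf.
have inv : invmx A = diag_mx d.
  have [_ uA] := mulmx1_unit DK.
  by rewrite -[RHS]mulmx1 -(mulmxV uA) mulmxA DK mul1mx.
rewrite inv /mxtrace !big_ord_recl big_ord0 addr0.
rewrite (_ : lift ord0 ord0 = 1); last exact: val_inj.
by rewrite !mul_diag_mx !mxE /= mulrC (mulrC (A 1 1)^-1).
Qed.

(** The first form being diagonal, only the pure second derivatives contribute. *)
Lemma trace_shape_operator R (kappa E G a b : R)
    (X : 'rV[R]_2 -> ambient R) (v : ambient R) (u : 'rV[R]_2) :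
  form4 kappa (partial 0 X u) (partial 1 X u) = 0 ->
  form4 kappa (partial 0 X u) (partial 0 X u) = E -> E != 0 ->
  form4 kappa (partial 1 X u) (partial 1 X u) = G -> G != 0 ->
  form4 kappa (partial 0 (partial 0 X) u) v = a ->
  form4 kappa (partial 1 (partial 1 X) u) v = b ->
  \tr (shape_operator kappa X v u) = a / E + b / G.
Proof.
move=> F0 EE E0 GE G0 aE bE; rewrite /shape_operator.
have A00 := etrans (first_formE kappa X u 0 0) EE.
have A11 := etrans (first_formE kappa X u 1 1) GE.
have A01 := etrans (first_formE kappa X u 0 1) F0.
have A10 := etrans (first_formE kappa X u 1 0) (etrans (form4C _ _ _) F0).
have B00 := etrans (second_formE kappa X v u 0 0) aE.
have B11 := etrans (second_formE kappa X v u 1 1) bE.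
move: (first_form _ _ _) (second_form _ _ _ _) A00 A11 A01 A10 B00 B11.
move=> A B A00 A11 A01 A10 B00 B11.
by rewrite trace_invmx_diag2 ?A00 ?A11 ?B00 ?B11.
Qed.

(** * The chart at a pole *)

Definition mk2 R (a b : R) : 'rV[R]_2 :=
  a *: delta_mx 0 0 + b *: delta_mx 0 1.

Lemma mk2_0 R (a b : R) : mk2 a b 0 0 = a.
Proof. by rewrite /mk2 !mxE /= mulr1 mulr0 addr0. Qed.

Lemma mk2_1 R (a b : R) : mk2 a b 0 1 = b.
Proof. by rewrite /mk2 !mxE /= mulr1 mulr0 add0r. Qed.

Lemma mk2K R (u : 'rV[R]_2) : mk2 (u 0 0) (u 0 1) = u.
Proof. by apply/rowP; apply: ord2P; rewrite ?mk2_0 ?mk2_1. Qed.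

Lemma ct_mk2 R (T : topologicalType) (a b : T -> R) (t : T) :
  continuous_at t a -> continuous_at t b ->
  continuous_at t (fun x => mk2 (a x) (b x)).
Proof.
by move=> ac bc; rewrite /mk2; apply: ct_addV; exact: ct_scaleV.
Qed.

(** The variable [v], in the coordinates used at the poles. *)
Definition hsq R (u : 'rV[R]_2) : R :=
  (u 0 0 ^+ 2 + u 0 1 ^+ 2) / 2.

Lemma hsq_ge0 R (u : 'rV[R]_2) : 0 <= hsq u.
Proof. by rewrite divr_ge0 // addr_ge0 // sqr_ge0. Qed.

Lemma hsq_eq0 R (u : 'rV[R]_2) : hsq u = 0 -> forall i, u 0 i = 0.
Proof.
move=> h0; have : u 0 0 ^+ 2 + u 0 1 ^+ 2 == 0.
  by move/eqP: h0; rewrite mulf_eq0 invr_eq0 pnatr_eq0 orbF.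
rewrite paddr_eq0 ?sqr_ge0 // !sqrf_eq0 => /andP[/eqP a /eqP b].
by apply: ord2P.
Qed.

Lemma hsq_coord R (u : 'rV[R]_2) (i j : 'I_2) :
  `|u 0 i * u 0 j| <= 2 * hsq u.
Proof.
rewrite /hsq [leRHS]mulrC divfK ?pnatr_eq0 // ler_norml.
move: i j; apply: ord2P; apply: ord2P; apply/andP; split; nra.
Qed.

Lemma der_hsq R (u : 'rV[R]_2) (i : 'I_2) :
  is_derive u (delta_mx 0 i) (@hsq R) (u 0 i).
Proof.
have d0 := der_coord u 0 i; have d1 := der_coord u 1 i.
rewrite /hsq; eapply der_eq.
  by eapply der_mul; [eapply der_add; eapply der_exp; eassumption|exact: der_cst].
by move: i {d0 d1}; apply: ord2P; rewrite /=; field.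
Qed.

Lemma ct_hsq R : continuous (@hsq R).
Proof.
move=> u; have c0 := ct_coord u 0; have c1 := ct_coord u 1.
by rewrite /hsq; ct.
Qed.
Arguments ct_hsq {R} _.

Lemma ct_dist R (T : topologicalType) (f : T -> R) (t : T) :
  continuous_at t f <-> forall e, 0 < e -> \forall x \near t, `|f t - f x| < e.
Proof. exact: cvgrPdist_lt. Qed.

Lemma open_lt_fun R (T : topologicalType) (f : T -> R) (a : R) :
  continuous f -> open [set x | f x < a].
Proof. by move=> /continuousP fo; exact: (fo _ (@open_lt R a)). Qed.

Lemma open_hsq R (w0 : R) : open [set u : 'rV[R]_2 | hsq u < w0].
Proof. by apply: open_lt_fun; exact: ct_hsq. Qed.

Lemma hsq_line R (u : 'rV[R]_2) (i : 'I_2) (h : R) :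
  hsq u = 0 -> hsq (h *: delta_mx 0 i + u) = h ^+ 2 / 2.
Proof.
move=> /hsq_eq0 u0; rewrite /hsq !mxE !u0 !addr0 /=.
by move: i; apply: ord2P; rewrite /= !(mulr1, mulr0, expr0n) /= ?addr0 ?add0r.
Qed.

Section RadialC2.
Context (R : realType) (w0 B : R) (W q psi : R -> R).
Hypothesis Wlip : forall s t : R, `|W t - W s| <= B * `|t - s|.
Hypothesis qc : forall w : R, 0 <= w < w0 -> continuous_at w q.
Hypothesis psic : forall w : R, 0 <= w < w0 -> continuous_at w psi.
Hypothesis psi0 : psi 0 = 0.
Hypothesis Wd : forall w : R, 0 < w < w0 -> is_derive w 1 W (q w).
Hypothesis qd : forall w : R, 0 < w < w0 -> is_derive w 1 q (psi w / w).

Let U := [set u : 'rV[R]_2 | hsq u < w0].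

Lemma radial_itv (u : 'rV[R]_2) : U u -> 0 <= hsq u < w0.
Proof. by move=> Uu; rewrite hsq_ge0. Qed.

(** At the origin the Lipschitz bound on [W] suffices, [hsq] being quadratic. *)
Lemma radial_der (u : 'rV[R]_2) (i : 'I_2) : U u ->
  is_derive u (delta_mx 0 i) (fun u => W (hsq u)) (q (hsq u) * u 0 i).
Proof.
move=> Uu; have := hsq_ge0 u; rewrite le_eqVlt => /predU1P[u0|u0]; last first.
  exact: (der_comp (Wd (w := hsq u) ltac:(by rewrite u0)) (der_hsq u i)).
apply/is_derive1_line; rewrite (hsq_eq0 (esym u0)) mulr0.
apply: is_derive1_eps => e e0; have B0 : 0 <= B.
  by have := le_trans (normr_ge0 _) (Wlip 0 1); rewrite subr0 normr1 mulr1.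
exists (e / (B + 1)); first by rewrite divr_gt0 //; lra.
move=> h hr; rewrite add0r mulr0 subr0 scale0r add0r hsq_line // -u0.
apply: le_trans (Wlip _ _) _; rewrite subr0 ger0_norm; last first.
  by rewrite divr_ge0 // sqr_ge0.
rewrite ltr_pdivlMr in hr; last lra.
rewrite -(real_normK (num_real h)).
have := normr_ge0 h; nra.
Qed.

Lemma radial_grad_der (u : 'rV[R]_2) (i j : 'I_2) : U u ->
  is_derive u (delta_mx 0 j) (fun u => q (hsq u) * u 0 i)
    (q (hsq u) * (i == j)%:R + psi (hsq u) / hsq u * (u 0 i * u 0 j)).
Proof.
move=> Uu; have := hsq_ge0 u; rewrite le_eqVlt => /predU1P[u0|u0]; last first.
  have D := der_comp (qd (w := hsq u) ltac:(by rewrite u0)) (der_hsq u j).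
  by apply: der_eq (der_mul D (der_coord u i j)) _; rewrite /=; ring.
apply/is_derive1_line; rewrite !(hsq_eq0 (esym u0)) !mulr0 addr0.
apply: is_derive1_eps => e e0.
have q0 : continuous_at 0 q by apply: qc; rewrite lexx u0.
have [r r0 rq] := (continuous1_eps q 0).1 q0 e e0.
exists (Num.min 1 r) => [|h]; first by rewrite lt_min ltr01.
rewrite lt_min => /andP[h1 hr].
rewrite add0r scale0r add0r !hsq_line // !mxE !(hsq_eq0 (esym u0)) eqxx /=.
rewrite !addr0 mulr0 subr0 -u0.
have -> : q (h ^+ 2 / 2) * (h * (i == j)%:R) - h * (q 0 * (i == j)%:R) =
   (q (h ^+ 2 / 2) - q 0) * (h * (i == j)%:R) by ring.
rewrite normrM; apply: ler_pM => //.
  apply/ltW/rq; rewrite subr0 ger0_norm ?divr_ge0 ?sqr_ge0 //.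
  rewrite -(real_normK (num_real h)); have := normr_ge0 h; nra.
by rewrite normrM; case: (i == j); rewrite ?normr1 ?normr0 ?mulr1 ?mulr0.
Qed.

Lemma radial_hess_cont (u : 'rV[R]_2) (i j : 'I_2) : U u ->
  continuous_at u (fun u : 'rV[R]_2 =>
    q (hsq u) * (i == j)%:R + psi (hsq u) / hsq u * (u 0 i * u 0 j)).
Proof.
move=> Uu; have uI := radial_itv Uu.
have hc : continuous_at u (@hsq R) by exact: ct_hsq.
have qhc : continuous_at u (fun u => q (hsq u)) by apply: ct_comp; [exact: qc|].
have phc : continuous_at u (fun u => psi (hsq u)).
  by apply: ct_comp; [exact: psic|].
have ci := ct_coord u i; have cj := ct_coord u j.
have := hsq_ge0 u; rewrite le_eqVlt => /predU1P[u0|u0]; last first.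
  by ct; rewrite gt_eqF.
apply: ct_add; first by ct.
apply/ct_dist => e e0; rewrite !(hsq_eq0 (esym u0)) !mulr0.
have /ct_dist/(_ (e / 2) ltac:(lra)) := phc.
apply: filterS => x.
rewrite -u0 psi0 !sub0r !normrN => xe.
have := hsq_ge0 x; rewrite le_eqVlt => /predU1P[x0|x0].
  by rewrite -x0 invr0 mulr0 mul0r normr0.
rewrite normrM normrM normfV (gtr0_norm x0).
have := hsq_coord x i j; set P := `|_ * _| => HP.
rewrite mulrAC ltr_pdivrMr //.
have := normr_ge0 (psi (hsq x)); nra.
Qed.

(** A radial function [W (m / 2)], [m = a^2 + b^2], is of class C^2 at the origin
    as soon as [W'] has a limit at [0] and [w W''(w)] tends to [0]. *)
Lemma radial_class_C2 : class_C 2 U (fun u => W (hsq u)).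
Proof.
have oU : open U by exact: open_hsq.
apply: (class_C_step (Y := fun i u => q (hsq u) * u 0 i) oU).
- move=> u Uu; apply: ct_comp; last exact: ct_hsq.
  exact: (lipschitz_continuous Wlip).
- by move=> i u Uu; exact: radial_der.
- move=> i; apply: (class_C_step (Y := fun j u => q (hsq u) * (i == j)%:R +
    psi (hsq u) / hsq u * (u 0 i * u 0 j)) oU).
  + move=> u Uu; apply: ct_mul; last exact: ct_coord.
    by apply: ct_comp; [apply: qc; exact: radial_itv | exact: ct_hsq].
  + by move=> j u Uu; exact: radial_grad_der.
  + by move=> j; split=> // u Uu; exact: radial_hess_cont.
Qed.
End RadialC2.

(** The data of a rotational graph [z = h v] around a pole: a function of class
    C^1 in [v] whose derivative [q] satisfies [v q'(v) = psi v -> 0]. *)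
Record cap R (kappa w0 : R) (h q psi : R -> R) : Prop := Cap {
  cap_w0 : 0 < w0;
  cap_lt2 : forall w, 0 <= w < w0 -> kappa * w < 2;
  cap_lip : exists B, forall s t, `|h t - h s| <= B * `|t - s|;
  cap_qc : forall w, 0 <= w < w0 -> {for w, continuous q};
  cap_psic : forall w, 0 <= w < w0 -> {for w, continuous psi};
  cap_psi0 : psi 0 = 0;
  cap_hd : forall w : R, 0 < w < w0 -> is_derive w 1 h (q w);
  cap_qd : forall w : R, 0 < w < w0 -> is_derive w 1 q (psi w / w) }.

(** Lambert's azimuthal equal-area coordinates: half the squared norm of the
    parameter is [v], which makes the height [h v] a radial function without any
    change of variables. The sign [sg] selects the pole of the first factor. *)
Definition capX R (kappa sg : R) (h : R -> R) (u : 'rV[R]_2) :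
    ambient R :=
  let s := Num.sqrt (1 - kappa * hsq u / 2) in
  mk4 (u 0 0 * s) (u 0 1 * s) (sg * (1 - kappa * hsq u)) (h (hsq u)).

Definition capY R (sg : R) (q : ambient R) : 'rV[R]_2 :=
  let s := Num.sqrt ((1 + sg * q.1 0 2) / 2) in
  mk2 (q.1 0 0 / s) (q.1 0 1 / s).

Lemma cap_rad_gt0 R (kappa w0 : R) (h q psi : R -> R)
    (u : 'rV[R]_2) : cap kappa w0 h q psi -> hsq u < w0 ->
  0 < 1 - kappa * hsq u / 2.
Proof.
move=> c uw; have := cap_lt2 c (w := hsq u); rewrite hsq_ge0 uw => /(_ isT).
lra.
Qed.

Lemma capX_C2 R (kappa w0 sg : R) (h q psi : R -> R) :
  cap kappa w0 h q psi ->
  class_C 2 [set u : 'rV[R]_2 | hsq u < w0] (capX kappa sg h).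
Proof.
move=> c; set U := [set u | _]; have oU : open U by exact: open_hsq.
have cst k (x : R) : class_C k U (fun=> x) by exact: class_C_cst.
have coord k i : class_C k U (fun u => u 0 i) by exact: class_C_coord.
have sqC i : class_C 2 U (fun u => u 0 i ^+ 2).
  exact: (class_C_mul oU (coord 2 i) (coord 2 i)).
have hsqC : class_C 2 U (@hsq R).
  exact: (class_C_mul oU (class_C_add oU (sqC 0) (sqC 1)) (cst 2 _)).
have affC (x y : R) : class_C 2 U (fun u => x + y * hsq u).
  exact: (class_C_add oU (cst 2 x) (class_C_mul oU (cst 2 y) hsqC)).
have sC : class_C 2 U (fun u => Num.sqrt (1 - kappa * hsq u / 2)).
  apply: (class_C_sqrt oU); first by move=> u Uu; exact: cap_rad_gt0 c Uu.
  have -> : (fun u : 'rV[R]_2 => 1 - kappa * hsq u / 2) =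
      (fun u => 1 + - (kappa / 2) * hsq u).
    by apply/funext => u; rewrite mulNr mulrAC.
  exact: affC.
have xC : class_C 2 U (fun u => sg * (1 - kappa * hsq u)).
  have -> : (fun u : 'rV[R]_2 => sg * (1 - kappa * hsq u)) =
      (fun u => sg + - (sg * kappa) * hsq u).
    by apply/funext => u; rewrite mulrBr mulr1 mulNr mulrA.
  exact: affC.
have [B hl] := cap_lip c.
exact: (class_C_mk4 oU (class_C_mul oU (coord 2 0) sC)
  (class_C_mul oU (coord 2 1) sC) xC
  (radial_class_C2 hl (cap_qc c) (cap_psic c) (cap_psi0 c) (cap_hd c)
    (cap_qd c))).
Qed.

Lemma capX_partial R (kappa w0 sg : R) (h q psi : R -> R)
    (u : 'rV[R]_2) (i : 'I_2) : cap kappa w0 h q psi -> hsq u < w0 ->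
  let s := Num.sqrt (1 - kappa * hsq u / 2) in
  let ds := - kappa * u 0 i / (4 * s) in
  partial i (capX kappa sg h) u =
  mk4 ((i == 0)%:R * s + u 0 0 * ds) ((i == 1)%:R * s + u 0 1 * ds)
    (- sg * kappa * u 0 i) (q (hsq u) * u 0 i).
Proof.
move=> c uw s ds; apply: is_derive_partial.
have r0 := cap_rad_gt0 c uw; have s0 : s != 0 by rewrite gt_eqF // sqrtr_gt0.
have dh := der_hsq u i.
have dS : is_derive u (delta_mx 0 i)
    (fun u => Num.sqrt (1 - kappa * hsq u / 2)) ds.
  eapply der_eq.
    eapply der_sqrt; first exact: r0.
    by eapply der_add; [exact: der_cst | eapply der_opp; eapply der_mul;
      [eapply der_mul; [exact: der_cst | exact: dh] | exact: der_cst]].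
  by rewrite /= -/s /ds; field.
have [B hl] := cap_lip c.
have dW := radial_der hl (cap_hd c) i uw.
have [d0 d1] := (der_coord u 0 i, der_coord u 1 i).
refine (der_mk4 _ _ _ dW).
- by apply: der_eq (der_mul d0 dS) _; rewrite eq_sym.
- by apply: der_eq (der_mul d1 dS) _; rewrite eq_sym.
- eapply der_eq.
    by eapply der_mul; [exact: der_cst | eapply der_add; [exact: der_cst |
      eapply der_opp; eapply der_mul; [exact: der_cst | exact: dh]]].
  by rewrite /=; ring.
Qed.

Lemma capX_immersion R (kappa w0 sg : R) (h q psi : R -> R)
    (u : 'rV[R]_2) (a b : R) :
  kappa ^+ 2 = 1 -> sg ^+ 2 = 1 -> cap kappa w0 h q psi -> hsq u < w0 ->
  a *: partial 0 (capX kappa sg h) u + b *: partial 1 (capX kappa sg h) u = 0 ->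
  a = 0 /\ b = 0.
Proof.
move=> k2 sg2 c uw; rewrite !(capX_partial sg _ c uw) /=.
set s := Num.sqrt _ => E.
have s0 : s != 0 by rewrite gt_eqF // sqrtr_gt0 (cap_rad_gt0 c uw).
have e0 : a * (s + u 0 0 * (- kappa * u 0 0 / (4 * s))) +
    b * (u 0 0 * (- kappa * u 0 1 / (4 * s))) = 0.
  have := congr1 (fun q : ambient R => q.1 0 0) E.
  by rewrite /= mxE mxE [X in _ + X]mxE !mk4_0 mxE mul1r mul0r add0r.
have e1 : a * (u 0 1 * (- kappa * u 0 0 / (4 * s))) +
    b * (s + u 0 1 * (- kappa * u 0 1 / (4 * s))) = 0.
  have := congr1 (fun q : ambient R => q.1 0 1) E.
  by rewrite /= mxE mxE [X in _ + X]mxE !mk4_1 mxE mul1r mul0r add0r.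
have e2 : a * (- sg * kappa * u 0 0) + b * (- sg * kappa * u 0 1) = 0.
  have := congr1 (fun q : ambient R => q.1 0 2) E.
  by rewrite /= mxE mxE [X in _ + X]mxE !mk4_2 mxE.
have n0 : sg * kappa != 0.
  by rewrite -sqrf_eq0 exprMn k2 sg2 mulr1 oner_eq0.
have l0 : a * u 0 0 + b * u 0 1 = 0.
  apply: (mulfI n0); rewrite mulr0 -[RHS]oppr0 -e2; ring.
have as0 : a * s = 0.
  have -> : a * s = a * (s + u 0 0 * (- kappa * u 0 0 / (4 * s))) +
    b * (u 0 0 * (- kappa * u 0 1 / (4 * s))) +
    u 0 0 * kappa / (4 * s) * (a * u 0 0 + b * u 0 1) by field.
  by rewrite e0 l0 mulr0 addr0.
have bs0 : b * s = 0.
  have -> : b * s = a * (u 0 1 * (- kappa * u 0 0 / (4 * s))) +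
    b * (s + u 0 1 * (- kappa * u 0 1 / (4 * s))) +
    u 0 1 * kappa / (4 * s) * (a * u 0 0 + b * u 0 1) by field.
  by rewrite e1 l0 mulr0 addr0.
by split; apply/eqP; [move/eqP: as0 | move/eqP: bs0];
  rewrite mulf_eq0 (negbTE s0) orbF.
Qed.

Lemma cap_patch R (kappa w0 sg : R) (h q psi : R -> R)
    (A W : set (ambient R)) :
  kappa ^+ 2 = 1 -> sg ^+ 2 = 1 -> cap kappa w0 h q psi -> open W ->
  (forall u, hsq u < w0 -> A (capX kappa sg h u) /\ W (capX kappa sg h u)) ->
  (forall p, A p -> W p -> let v := kappa * (1 - sg * p.1 0 2) in
     [/\ 0 <= v < w0, p.1 0 0 ^+ 2 + p.1 0 1 ^+ 2 = v * (2 - kappa * v) &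
         p.2 = h v]) ->
  patch A [set u | hsq u < w0] (capX kappa sg h) W (capY sg).
Proof.
move=> k2 sg2 c oW XA Ap.
have rad (p : ambient R) : let v := kappa * (1 - sg * p.1 0 2) in
    (1 + sg * p.1 0 2) / 2 = 1 - kappa * v / 2.
  by rewrite /= mulrA -expr2 k2; field.
have rad0 (p : ambient R) : A p -> W p -> 0 < (1 + sg * p.1 0 2) / 2.
  move=> pA pW; have [v0 _ _] := Ap p pA pW.
  by rewrite rad; have := cap_lt2 c v0; lra.
split.
- exact: open_hsq.
- exact: oW.
- exact: XA.
- move=> u Uu; rewrite /capY /capX mk4_0 mk4_1 mk4_2 mulrA -expr2 sg2 mul1r.
  have -> : (1 + (1 - kappa * hsq u)) / 2 = 1 - kappa * hsq u / 2 by field.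
  have s0 : Num.sqrt (1 - kappa * hsq u / 2) != 0.
    by rewrite gt_eqF // sqrtr_gt0 (cap_rad_gt0 c Uu).
  by rewrite !mulfK // mk2K.
- move=> p Ap' Wp; have r0 := rad0 p Ap' Wp.
  have [v0 pv ph] := Ap p Ap' Wp; move: (rad p) v0 pv ph => /=.
  set v := kappa * (1 - sg * p.1 0 2) => rE v0 pv ph.
  have s0 : Num.sqrt ((1 + sg * p.1 0 2) / 2) != 0 by rewrite gt_eqF // sqrtr_gt0.
  have hv : hsq (capY sg p) = v.
    rewrite /hsq /capY mk2_0 mk2_1 !expr_div_n sqr_sqrtr ?(ltW r0) //.
    rewrite -mulrDl pv rE; field.
    by rewrite rE in r0; rewrite gt_eqF //; lra.
  split; first by rewrite /= hv; case/andP: v0.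
  rewrite /capX hv -rE /capY mk2_0 mk2_1 !divfK // -ph -[RHS]mk4K.
  congr mk4; rewrite /v !mulrA -expr2 k2 mul1r opprB addrC subrK.
  by rewrite mulrA -expr2 sg2 mul1r.
- move=> p Ap' Wp; have r0 := rad0 p Ap' Wp.
  have c0 := ct_ambient 0 p; have c1 := ct_ambient 1 p; have c2 := ct_ambient 2 p.
  have s0 : Num.sqrt ((1 + sg * p.1 0 2) / 2) != 0 by rewrite gt_eqF // sqrtr_gt0.
  by rewrite /prop_for /capY /=; apply: ct_mk2; ct.
- exact: capX_C2 c.
- move=> u Uu a b; exact: (capX_immersion k2 sg2 c Uu).
Qed.

Lemma der_snd R (V : normedModType R) (X : V -> ambient R)
    (u e : V) (l : ambient R) :
  is_derive u e X l -> is_derive u e (fun w => (X w).2) l.2.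
Proof.
case=> /= dX lE.
have cl : h^-1 *: ((X (h *: e + u)).2 - (X u).2) @[h --> 0^'] --> l.2.
  rewrite -lE; apply: (@cvg_comp _ _ _ _ (fun q : ambient R => q.2) _ _ _ dX).
  exact: cvg_snd.
by apply: DeriveDef; [apply/cvg_ex; exists l.2 | exact/cvg_lim].
Qed.

(** At the pole the first form is the identity and the tangent plane is
    horizontal, so that the trace is the Laplacian of the height. *)
Lemma capX_curvature R (kappa w0 sg c : R) (h q psi : R -> R)
    (u : 'rV[R]_2) : cap kappa w0 h q psi -> hsq u = 0 ->
  (forall i, form4 kappa (partial i (capX kappa sg h) u) (mk4 0 0 0 c) = 0) /\
  \tr (shape_operator kappa (capX kappa sg h) (mk4 0 0 0 c) u) = 2 * (c * q 0).
Proof.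
move=> cp u0; have uw : hsq u < w0 by rewrite u0 (cap_w0 cp).
set X := capX _ _ _; set U := [set u : 'rV[R]_2 | hsq u < w0].
have Pi (i : 'I_2) : partial i X u = mk4 (i == 0)%:R (i == 1)%:R 0 0.
  rewrite (capX_partial sg i cp uw) u0 !(hsq_eq0 u0) !mulr0 !mul0r !addr0 subr0.
  by rewrite sqrtr1 !mulr1.
have Z i : (partial i (partial i X) u).2 = q 0.
  have D := class_C_derive i (class_C_partial i (capX_C2 sg cp)) uw.
  have [B hl] := cap_lip cp.
  have D1 := radial_grad_der (cap_qc cp) (cap_qd cp) i i uw.
  rewrite u0 !(hsq_eq0 u0) eqxx !mulr0 mulr1 addr0 in D1.
  have E : \near u, q (hsq u) * u 0 i = (partial i X u).2.
    have oU : open U by exact: open_hsq.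
    apply: (@open_near R U (fun w => q (hsq w) * w 0 i = (partial i X w).2) u oU uw).
    by move=> w Uw; rewrite (capX_partial sg i cp Uw) mk4_3.
  by rewrite -(derive_val (is_derive := der_snd D)) -(near_eq_derive _ E)
    (derive_val (is_derive := D1)).
have F (v : ambient R) : form4 kappa v (mk4 0 0 0 c) = c * v.2.
  by rewrite /form4 /form3 !mk4E !mulr0 !addr0 add0r mulrC.
split; first by move=> i; rewrite F Pi mk4_3 mulr0.
have T i : form4 kappa (partial i (partial i X) u) (mk4 0 0 0 c) = c * q 0.
  by rewrite F Z.
have E01 : form4 kappa (partial 0 X u) (partial 1 X u) = 0.
  by rewrite !Pi form4_mk4 /=; ring.
have E00 : form4 kappa (partial 0 X u) (partial 0 X u) = 1.
  by rewrite !Pi form4_mk4 /=; ring.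
have E11 : form4 kappa (partial 1 X u) (partial 1 X u) = 1.
  by rewrite !Pi form4_mk4 /=; ring.
rewrite (@trace_shape_operator R kappa 1 1 _ _ X _ u E01 E00 (oner_neq0 R) E11 (oner_neq0 R) (T 0) (T 1)).
by rewrite divr1 mulr_natl mulr2n.
Qed.

(** * The chart away from the poles *)

Lemma kappa_sqr R (kappa : R) :
  kappa = -1 \/ kappa = 1 -> kappa ^+ 2 = 1.
Proof. by case=> ->; rewrite ?sqrrN expr1n. Qed.

Definition pr_S R (kappa : R) (g : R -> R) (P : profile kappa g)
  (t : R) : R := sn kappa (pr_v P t).

Definition pr_C R (kappa : R) (g : R -> R) (P : profile kappa g)
  (t : R) : R := 1 - kappa * pr_v P t.

Definition pr_p R (kappa : R) (g : R -> R) (P : profile kappa g)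
  (t : R) : R := pr_c P t / (pr_k P t * pr_S P t).

(** The derivative of [pr_p], as prescribed by the mean curvature. *)
Definition pr_dp R (kappa : R) (g : R -> R) (P : profile kappa g)
  (t : R) : R :=
  (pr_k P t * pr_C P t - 2 * g (pr_k P t * pr_S P t)) / (pr_k P t * pr_S P t) ^+ 3.

(** The revolution surface of the profile, with the angle measured from the
    direction [(e0, e1)]: a point can always be placed at angle [0]. *)
Definition tubeX R (e0 e1 : R) (S C : R -> R) (u : 'rV[R]_2) :
    ambient R :=
  let t := u 0 0 in let a := u 0 1 in
  mk4 (S t * (e0 * cos a - e1 * sin a)) (S t * (e1 * cos a + e0 * sin a))
    (C t) t.

Definition tubeY R (e0 e1 : R) (S : R -> R) (q : ambient R) :
    'rV[R]_2 :=
  mk2 q.2 (asin ((e0 * q.1 0 1 - e1 * q.1 0 0) / S q.2)).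

Definition tubeU R (z1 : R) : set 'rV[R]_2 :=
  [set u : 'rV[R]_2 | `|u 0 0| < z1 /\ - (pi / 2) < u 0 1 < pi / 2].

Definition tubeW R (z1 e0 e1 : R) : set (ambient R) :=
  [set q : ambient R | `|q.2| < z1 /\ 0 < e0 * q.1 0 0 + e1 * q.1 0 1].

(** Described by equations that include the poles, from which closedness and
    rotational symmetry can be read off. *)
Definition revolution R (kappa : R) (g : R -> R)
    (P : profile kappa g) : set (ambient R) :=
  [set q : ambient R | [/\ `|q.2| <= pr_z1 P, q.1 0 2 = pr_C P q.2 &
     q.1 0 0 ^+ 2 + q.1 0 1 ^+ 2 = pr_S P q.2 ^+ 2]].

(** The unit normal, pointing upwards where [c > 0]. *)
Definition revolution_normal R (kappa : R) (g : R -> R)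
    (P : profile kappa g) (q : ambient R) : ambient R :=
  let k := pr_k P q.2 in
  mk4 (- (k * pr_C P q.2) * q.1 0 0) (- (k * pr_C P q.2) * q.1 0 1)
    (kappa * k * pr_S P q.2 ^+ 2) (pr_c P q.2).

Lemma pr_S_gt0 R (kappa : R) (g : R -> R) (P : profile kappa g)
    (t : R) :
  `|t| < pr_z1 P -> 0 < pr_S P t.
Proof. by move=> tz; apply: sn_gt0; [exact: pr_v_gt0 | exact: pr_v_lt2]. Qed.

Lemma pr_v_ge0 R (kappa : R) (g : R -> R) (P : profile kappa g)
    (t : R) :
  0 <= pr_v P t.
Proof.
by have [/pr_v_pole ->//|/pr_v_gt0/ltW] := leP (pr_z1 P) `|t|.
Qed.

Lemma pr_S2 R (kappa : R) (g : R -> R) (P : profile kappa g)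
    (t : R) :
  pr_S P t ^+ 2 = sn2 kappa (pr_v P t).
Proof.
by rewrite sqr_sn // mulr_ge0 ?pr_v_ge0 // subr_ge0 ltW // pr_v_lt2.
Qed.

Lemma pr_CS R (kappa : R) (g : R -> R) (P : profile kappa g)
    (t : R) :
  kappa ^+ 2 = 1 -> pr_C P t ^+ 2 + kappa * pr_S P t ^+ 2 = 1.
Proof.
move=> k2; rewrite pr_S2 /pr_C /sn2; set v := pr_v P t.
have -> : (1 - kappa * v) ^+ 2 + kappa * (v * (2 - kappa * v)) =
  1 + v ^+ 2 * (kappa ^+ 2 - kappa ^+ 2) by ring.
by rewrite subrr mulr0 addr0.
Qed.

Lemma pr_unitS R (kappa : R) (g : R -> R) (P : profile kappa g)
    (t : R) :
  pr_c P t ^+ 2 + (pr_k P t * pr_S P t) ^+ 2 = 1.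
Proof. by rewrite exprMn pr_S2; exact: pr_unit. Qed.

Lemma der_pr_v R (kappa : R) (g : R -> R) (P : profile kappa g)
    (t : R) :
  `|t| < pr_z1 P -> is_derive t 1 (pr_v P) (pr_S P t * pr_p P t).
Proof.
move=> tz; apply: der_eq (pr_v_der tz) _.
have k0 := pr_k_gt0 P t; have S0 := pr_S_gt0 tz.
by rewrite /pr_p; field; rewrite !gt_eqF.
Qed.

Lemma der_pr_S R (kappa : R) (g : R -> R) (P : profile kappa g)
    (t : R) :
  `|t| < pr_z1 P -> is_derive t 1 (pr_S P) (pr_C P t * pr_p P t).
Proof.
move=> tz; have S0 := pr_S_gt0 tz.
have D := der_comp (der_sn (pr_v_gt0 tz) (pr_v_lt2 P t)) (der_pr_v tz).
apply: der_eq D _; rewrite -/(pr_C P t) -/(pr_S P t).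
by field; rewrite gt_eqF.
Qed.

Lemma der_pr_C R (kappa : R) (g : R -> R) (P : profile kappa g)
    (t : R) :
  `|t| < pr_z1 P ->
  is_derive t 1 (pr_C P) (- kappa * (pr_S P t * pr_p P t)).
Proof.
move=> tz; have D := der_pr_v tz.
rewrite /pr_C; eapply der_eq; first by der.
by rewrite /=; ring.
Qed.

Lemma der_pr_p R (kappa : R) (g : R -> R) (P : profile kappa g)
    (t : R) :
  `|t| < pr_z1 P -> is_derive t 1 (pr_p P) (pr_dp P t).
Proof. exact: pr_p_der. Qed.

Lemma ct_pr_S R (kappa : R) (g : R -> R) (P : profile kappa g)
    (t : R) :
  continuous_at t (pr_S P).
Proof. by apply: ct_comp; [exact: ct_sn | exact: pr_v_cont]. Qed.
Arguments ct_pr_S {R kappa g} P t.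

Lemma ct_pr_C R (kappa : R) (g : R -> R) (P : profile kappa g)
    (t : R) :
  continuous_at t (pr_C P).
Proof. by have vc := @pr_v_cont _ _ _ P t; rewrite /pr_C; ct. Qed.
Arguments ct_pr_C {R kappa g} P t.

Lemma ct_pr_dp R (kappa : R) (g : R -> R) (P : profile kappa g)
    (t : R) :
  continuous g -> `|t| < pr_z1 P -> continuous_at t (pr_dp P).
Proof.
move=> gc tz; have Sc := ct_pr_S P t; have Cc := ct_pr_C P t.
have kc := @pr_k_cont _ _ _ P t.
have gkc : continuous_at t (fun t => g (pr_k P t * pr_S P t)).
  by apply: ct_comp; [exact: gc | ct].
rewrite /pr_dp; ct; rewrite expf_neq0 // mulf_neq0 // gt_eqF //.
  exact: pr_k_gt0.
exact: pr_S_gt0.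
Qed.

Lemma open_tubeU R (z1 : R) : open (tubeU z1).
Proof.
have -> : tubeU z1 = [set u : 'rV[R]_2 | `|u 0 0| < z1] `&` [set u : 'rV[R]_2 | `|u 0 1| < pi / 2].
  by apply/seteqP; split=> u /= [a b]; split=> //; move: b; rewrite ltr_norml.
by apply: openI; apply: open_lt_fun => u; apply: ct_norm; exact: ct_coord.
Qed.

Lemma tubeX_C2 R (kappa : R) (g : R -> R) (P : profile kappa g)
    (e0 e1 : R) : continuous g ->
  class_C 2 (tubeU (pr_z1 P)) (tubeX e0 e1 (pr_S P) (pr_C P)).
Proof.
move=> gc; set U := tubeU _; have oU : open U by exact: open_tubeU.
have cst k (x : R) : class_C k U (fun=> x) by exact: class_C_cst.
have pC : class_C 1 U (fun u => pr_p P (u 0 0)).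
  apply: (class_C_of_coord (df := pr_dp P) oU).
    by move=> u [tz _]; exact: der_pr_p.
  by apply: class_C_of_coord0 => u [tz _]; exact: ct_pr_dp.
have S1 : class_C 1 U (fun u => pr_S P (u 0 0)).
  apply: (class_C_of_coord (df := fun t => pr_C P t * pr_p P t) oU).
    by move=> u [tz _]; exact: der_pr_S.
  apply: (@class_C_of_coord0 R U 0 (fun t => pr_C P t * pr_p P t)) => u [tz _].
  apply: ct_mul; first exact: ct_pr_C.
  exact: is_derive1_continuous (der_pr_p tz).
have C1 : class_C 1 U (fun u => pr_C P (u 0 0)).
  apply: (class_C_of_coord (df := fun t => - kappa * (pr_S P t * pr_p P t)) oU).
    by move=> u [tz _]; exact: der_pr_C.
  apply: (@class_C_of_coord0 R U 0 (fun t => - kappa * (pr_S P t * pr_p P t))).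
  move=> u [tz _]; apply: ct_mul; first exact: ct_cst.
  apply: ct_mul; first exact: ct_pr_S.
  exact: is_derive1_continuous (der_pr_p tz).
have S2 : class_C 2 U (fun u => pr_S P (u 0 0)).
  apply: (class_C_of_coord (df := fun t => pr_C P t * pr_p P t) oU).
    by move=> u [tz _]; exact: der_pr_S.
  exact: (class_C_mul oU C1 pC).
have C2 : class_C 2 U (fun u => pr_C P (u 0 0)).
  apply: (class_C_of_coord (df := fun t => - kappa * (pr_S P t * pr_p P t)) oU).
    by move=> u [tz _]; exact: der_pr_C.
  exact: (class_C_mul oU (cst 1%N _) (class_C_mul oU S1 pC)).
have [cosC sinC] : (forall k, class_C k U (fun u => cos (u 0 1))) /\
    (forall k, class_C k U (fun u => sin (u 0 1))).
  suff H k : class_C k U (fun u => cos (u 0 1)) /\ class_C k U (fun u => sin (u 0 1)).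
    by split=> k; case: (H k).
  elim: k => [|k [IHc IHs]]; split.
  - by apply: class_C_of_coord0 => u _; exact: continuous_cos.
  - by apply: class_C_of_coord0 => u _; exact: continuous_sin.
  - apply: (class_C_of_coord (df := fun a => -1 * sin a) oU).
      by move=> u _; apply: der_eq (is_derive_cos _) _; rewrite mulN1r.
    exact: (class_C_mul oU (cst k _) IHs).
  - apply: (class_C_of_coord (df := cos) oU) => //.
have AC : class_C 2 U (fun u => e0 * cos (u 0 1) - e1 * sin (u 0 1)).
  have -> : (fun u : 'rV[R]_2 => e0 * cos (u 0 1) - e1 * sin (u 0 1)) =
      (fun u => e0 * cos (u 0 1) + - e1 * sin (u 0 1)).
    by apply/funext => u; rewrite mulNr.
  exact: (class_C_add oU (class_C_mul oU (cst 2 e0) (cosC 2))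
    (class_C_mul oU (cst 2 _) (sinC 2))).
have BC := class_C_add oU (class_C_mul oU (cst 2 e1) (cosC 2))
    (class_C_mul oU (cst 2 e0) (sinC 2)).
have tC : class_C 2 U (fun u => u 0 0) by exact: class_C_coord.
exact (class_C_mk4 oU (class_C_mul oU S2 AC) (class_C_mul oU S2 BC) C2 tC).
Qed.

Lemma der_tube_comp R (f : R -> R) (F : R -> R) (f' F' : R)
    (u : 'rV[R]_2) (i : 'I_2) :
  is_derive (u 0 0) 1 f f' -> is_derive (u 0 1) 1 F F' ->
  is_derive u (delta_mx 0 i) (fun u => f (u 0 0) * F (u 0 1))
    ((i == 0)%:R * (f' * F (u 0 1)) + (i == 1)%:R * (f (u 0 0) * F')).
Proof.
move=> df dF.
have D0 := @der_comp _ _ (fun w : 'rV[R]_2 => w 0 0) f _ _ _ _ df (der_coord u 0 i).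
have D1 := @der_comp _ _ (fun w : 'rV[R]_2 => w 0 1) F _ _ _ _ dF (der_coord u 1 i).
apply: der_eq (der_mul D0 D1) _.
by rewrite ![_ == i]eq_sym /=; ring.
Qed.

Lemma mk4_scale R (x a b c d : R) :
  x *: mk4 a b c d = mk4 (x * a) (x * b) (x * c) (x * d).
Proof. by rewrite /mk4 !scalerDr !scalerA. Qed.

Lemma tubeXE R (e0 e1 : R) (S C : R -> R) (u : 'rV[R]_2) :
  let X := tubeX e0 e1 S C u in let a := u 0 1 in
  [/\ X.1 0 0 = S (u 0 0) * (e0 * cos a - e1 * sin a),
      X.1 0 1 = S (u 0 0) * (e1 * cos a + e0 * sin a),
      X.1 0 2 = C (u 0 0) & X.2 = u 0 0].
Proof. by split; rewrite mk4E. Qed.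

Lemma der_tube R (f h l A B : R -> R) (f' h' l' A' B' : R)
    (u : 'rV[R]_2) (i : 'I_2) :
  is_derive (u 0 0) 1 f f' -> is_derive (u 0 0) 1 h h' ->
  is_derive (u 0 0) 1 l l' ->
  is_derive (u 0 1) 1 A A' -> is_derive (u 0 1) 1 B B' ->
  is_derive u (delta_mx 0 i)
    (fun u => mk4 (f (u 0 0) * A (u 0 1)) (f (u 0 0) * B (u 0 1))
       (h (u 0 0)) (l (u 0 0)))
    (if i == 0 then mk4 (f' * A (u 0 1)) (f' * B (u 0 1)) h' l'
     else mk4 (f (u 0 0) * A') (f (u 0 0) * B') 0 0).
Proof.
move=> df dh dl dA dB.
have dX := der_tube_comp i df dA; have dY := der_tube_comp i df dB.
have dZ := @der_comp _ _ (fun w : 'rV[R]_2 => w 0 0) h _ _ _ _ dh (der_coord u 0 i).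
have dT := @der_comp _ _ (fun w : 'rV[R]_2 => w 0 0) l _ _ _ _ dl (der_coord u 0 i).
apply: der_eq (der_mk4 dX dY dZ dT) _.
move: i {dX dY dZ dT}; apply: ord2P; rewrite /= ?(mul1r, mul0r, mulr1, mulr0).
  by rewrite !addr0.
by rewrite !add0r.
Qed.

Lemma der_frameA R (e0 e1 a : R) :
  is_derive a 1 (fun a => e0 * cos a - e1 * sin a)
    (- (e1 * cos a + e0 * sin a)).
Proof.
have dc := is_derive_cos a; have ds := is_derive_sin a.
by eapply der_eq; [der | rewrite /=; ring].
Qed.

Lemma der_frameB R (e0 e1 a : R) :
  is_derive a 1 (fun a => e1 * cos a + e0 * sin a) (e0 * cos a - e1 * sin a).
Proof.
have dc := is_derive_cos a; have ds := is_derive_sin a.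
by eapply der_eq; [der | rewrite /=; ring].
Qed.

Lemma tubeX_partial0 R (kappa : R) (g : R -> R)
    (P : profile kappa g) (e0 e1 : R) (u : 'rV[R]_2) :
  `|u 0 0| < pr_z1 P -> let t := u 0 0 in let a := u 0 1 in
  partial 0 (tubeX e0 e1 (pr_S P) (pr_C P)) u =
  mk4 (pr_C P t * pr_p P t * (e0 * cos a - e1 * sin a))
    (pr_C P t * pr_p P t * (e1 * cos a + e0 * sin a))
    (- kappa * (pr_S P t * pr_p P t)) 1.
Proof.
move=> tz t a; apply: is_derive_partial.
exact: (der_tube 0 (der_pr_S tz) (der_pr_C tz) (der_id _ _)
  (der_frameA e0 e1 a) (der_frameB e0 e1 a)).
Qed.

Lemma tubeX_partial1 R (kappa : R) (g : R -> R)
    (P : profile kappa g) (e0 e1 : R) (u : 'rV[R]_2) :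
  `|u 0 0| < pr_z1 P -> let t := u 0 0 in let a := u 0 1 in
  partial 1 (tubeX e0 e1 (pr_S P) (pr_C P)) u =
  mk4 (pr_S P t * - (e1 * cos a + e0 * sin a))
    (pr_S P t * (e0 * cos a - e1 * sin a)) 0 0.
Proof.
move=> tz t a; apply: is_derive_partial.
exact: (der_tube 1 (der_pr_S tz) (der_pr_C tz) (der_id _ _)
  (der_frameA e0 e1 a) (der_frameB e0 e1 a)).
Qed.

Lemma partial_near R (V : normedModType R) (U : set 'rV[R]_2)
    (X Y : 'rV[R]_2 -> V) (i : 'I_2) (u : 'rV[R]_2) (l : V) :
  open U -> U u -> (forall w, U w -> X w = Y w) ->
  is_derive u (delta_mx 0 i) Y l -> partial i X u = l.
Proof.
move=> oU Uu XY dY; rewrite /partial.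
rewrite (near_eq_derive _ (open_near oU Uu XY)).
exact: is_derive_partial dY.
Qed.

Lemma tubeX_partial00 R (kappa : R) (g : R -> R)
    (P : profile kappa g) (e0 e1 : R) (u : 'rV[R]_2) :
  tubeU (pr_z1 P) u -> let t := u 0 0 in let a := u 0 1 in
  let ddS := - kappa * (pr_S P t * pr_p P t) * pr_p P t + pr_C P t * pr_dp P t in
  let ddC := - kappa * (pr_C P t * pr_p P t * pr_p P t + pr_S P t * pr_dp P t) in
  partial 0 (partial 0 (tubeX e0 e1 (pr_S P) (pr_C P))) u =
  mk4 (ddS * (e0 * cos a - e1 * sin a)) (ddS * (e1 * cos a + e0 * sin a)) ddC 0.
Proof.
move=> Uu t a ddS ddC; have [tz _] := Uu.
have dS : is_derive t 1 (fun t => pr_C P t * pr_p P t) ddS.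
  exact: (der_mul (der_pr_C tz) (der_pr_p tz)).
have dC : is_derive t 1 (fun t => - kappa * (pr_S P t * pr_p P t)) ddC.
  have D := der_mul (der_pr_S tz) (der_pr_p tz).
  by apply: der_eq (der_mul (der_cst _ _ (- kappa)) D) _; rewrite mul0r add0r.
apply: (partial_near (@open_tubeU R (pr_z1 P)) Uu) (der_tube 0 dS dC
  (der_cst t 1 (1 : R)) (der_frameA e0 e1 a) (der_frameB e0 e1 a)).
by move=> w [wz _]; exact: tubeX_partial0.
Qed.

Lemma tubeX_partial11 R (kappa : R) (g : R -> R)
    (P : profile kappa g) (e0 e1 : R) (u : 'rV[R]_2) :
  tubeU (pr_z1 P) u -> let t := u 0 0 in let a := u 0 1 in
  partial 1 (partial 1 (tubeX e0 e1 (pr_S P) (pr_C P))) u =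
  mk4 (pr_S P t * - (e0 * cos a - e1 * sin a))
    (pr_S P t * - (e1 * cos a + e0 * sin a)) 0 0.
Proof.
move=> Uu t a; have [tz _] := Uu.
apply: (partial_near (@open_tubeU R (pr_z1 P)) Uu) (der_tube 1 (der_pr_S tz)
  (der_cst t 1 (0 : R)) (der_cst t 1 (0 : R))
  (der_opp (der_frameB e0 e1 a)) (der_frameA e0 e1 a)).
by move=> w [wz _]; exact: tubeX_partial1.
Qed.

Lemma comb_2 R (x y : R) (a b : ambient R) :
  (x *: a + y *: b).2 = x * a.2 + y * b.2.
Proof. by []. Qed.

Lemma tubeX_immersion R (kappa : R) (g : R -> R)
    (P : profile kappa g) (e0 e1 x y : R) (u : 'rV[R]_2) :
  e0 ^+ 2 + e1 ^+ 2 = 1 -> tubeU (pr_z1 P) u ->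
  x *: partial 0 (tubeX e0 e1 (pr_S P) (pr_C P)) u +
  y *: partial 1 (tubeX e0 e1 (pr_S P) (pr_C P)) u = 0 -> x = 0 /\ y = 0.
Proof.
move=> ee [tz _]; rewrite (tubeX_partial0 e0 e1 tz) (tubeX_partial1 e0 e1 tz) /=.
have S0 := pr_S_gt0 tz; set a := u 0 1; set S := pr_S P _ in S0 *.
set ca := cos a; set sa := sin a.
have cs : ca ^+ 2 + sa ^+ 2 = 1 := cos2Dsin2 a.
move=> E; have x0 : x = 0.
  have := congr1 (fun q : ambient R => q.2) E.
  by rewrite comb_2 !mk4_3 mulr1 mulr0 addr0.
split=> //; rewrite x0 !scale0r !add0r in E.
have E0 : y * (S * - (e1 * ca + e0 * sa)) = 0.
  have := congr1 (fun q : ambient R => q.1 0 0) E.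
  by rewrite mxE mk4_0 mxE.
have E1 : y * (S * (e0 * ca - e1 * sa)) = 0.
  have := congr1 (fun q : ambient R => q.1 0 1) E.
  by rewrite mxE mk4_1 mxE.
have : (y * S) ^+ 2 = 0.
  have -> : (y * S) ^+ 2 = (y * S) ^+ 2 * ((e0 ^+ 2 + e1 ^+ 2) *
      (ca ^+ 2 + sa ^+ 2)) by rewrite ee cs !mulr1.
  have -> : (y * S) ^+ 2 * ((e0 ^+ 2 + e1 ^+ 2) * (ca ^+ 2 + sa ^+ 2)) =
     (y * (S * - (e1 * ca + e0 * sa))) ^+ 2 + (y * (S * (e0 * ca - e1 * sa))) ^+ 2.
    by ring.
  by rewrite E0 E1 expr0n addr0.
by move/eqP; rewrite sqrf_eq0 mulf_eq0 (gt_eqF S0) orbF => /eqP.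
Qed.

Lemma tube_patch R (kappa : R) (g : R -> R) (P : profile kappa g)
    (e0 e1 : R) : continuous g -> e0 ^+ 2 + e1 ^+ 2 = 1 ->
  patch (revolution P) (tubeU (pr_z1 P)) (tubeX e0 e1 (pr_S P) (pr_C P))
    (tubeW (pr_z1 P) e0 e1) (tubeY e0 e1 (pr_S P)).
Proof.
move=> gc ee.
have key (q : ambient R) : revolution P q -> tubeW (pr_z1 P) e0 e1 q ->
    let s := (e0 * q.1 0 1 - e1 * q.1 0 0) / pr_S P q.2 in
    let c := (e0 * q.1 0 0 + e1 * q.1 0 1) / pr_S P q.2 in
    [/\ 0 < c, c ^+ 2 + s ^+ 2 = 1 & -1 < s < 1].
  move=> [_ _ qS] [qz qe] s c; have S0 := pr_S_gt0 qz.
  have c0 : 0 < c by rewrite divr_gt0.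
  have cs : c ^+ 2 + s ^+ 2 = 1.
    rewrite /c /s !expr_div_n -mulrDl.
    have -> : (e0 * q.1 0 0 + e1 * q.1 0 1) ^+ 2 +
      (e0 * q.1 0 1 - e1 * q.1 0 0) ^+ 2 =
      (e0 ^+ 2 + e1 ^+ 2) * (q.1 0 0 ^+ 2 + q.1 0 1 ^+ 2) by ring.
    by rewrite ee mul1r qS divff // expf_neq0 // gt_eqF.
  split=> //; rewrite -ltr_norml -(ltr_pXn2r (n := 2)) ?nnegrE ?ler01 //.
  rewrite expr1n real_normK ?num_real // -cs ltrDr exprn_gt0 //.
split.
- exact: open_tubeU.
- have c0 := @ct_ambient R 0; have c1 := @ct_ambient R 1; have c2 := @ct_height R.
  have -> : tubeW (pr_z1 P) e0 e1 = [set q : ambient R | `|q.2| < pr_z1 P] `&`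
      [set q : ambient R | - (e0 * q.1 0 0 + e1 * q.1 0 1) < 0].
    by apply/seteqP; split=> q /= [a b]; split=> //; move: b; rewrite oppr_lt0.
  apply: openI; apply: open_lt_fun => q.
    by apply: ct_norm; exact: c2.
  have h0 := c0 q; have h1 := c1 q.
  by ct.
- move=> u [uz ua]; have S0 := pr_S_gt0 uz; have cs := cos2Dsin2 (u 0 1).
  have [X0 X1 X2 X3] := tubeXE e0 e1 (pr_S P) (pr_C P) u.
  move: (tubeX _ _ _ _ _) X0 X1 X2 X3 => X X0 X1 X2 X3.
  rewrite /revolution /tubeW /= X0 X1 X2 X3; split.
    split=> //; first exact: ltW.
    transitivity (pr_S P (u 0 0) ^+ 2 * ((e0 ^+ 2 + e1 ^+ 2) *
      (cos (u 0 1) ^+ 2 + sin (u 0 1) ^+ 2))); first by ring.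
    by rewrite ee cs !mulr1.
  split=> //; have -> : e0 * (pr_S P (u 0 0) * (e0 * cos (u 0 1) - e1 * sin (u 0 1))) +
    e1 * (pr_S P (u 0 0) * (e1 * cos (u 0 1) + e0 * sin (u 0 1))) =
    (e0 ^+ 2 + e1 ^+ 2) * pr_S P (u 0 0) * cos (u 0 1) by ring.
  by rewrite ee mul1r mulr_gt0 // cos_gt0_pihalf.
- move=> u [uz /andP[a1 a2]]; have S0 := pr_S_gt0 uz.
  have [X0 X1 _ X3] := tubeXE e0 e1 (pr_S P) (pr_C P) u.
  rewrite /tubeY X0 X1 X3.
  have -> : (e0 * (pr_S P (u 0 0) * (e1 * cos (u 0 1) + e0 * sin (u 0 1))) -
    e1 * (pr_S P (u 0 0) * (e0 * cos (u 0 1) - e1 * sin (u 0 1)))) /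
    pr_S P (u 0 0) = (e0 ^+ 2 + e1 ^+ 2) * sin (u 0 1).
    by field; rewrite gt_eqF.
  rewrite ee mul1r sinK ?mk2K // in_itv /=; apply/andP; split; exact: ltW.
- move=> q Aq Wq; have [c0 cs /andP[s1 s2]] := key q Aq Wq.
  have [qz qC qS] := Aq; have [qz' qe] := Wq; have S0 := pr_S_gt0 qz'.
  set s := (e0 * q.1 0 1 - _) / _ in cs s1 s2.
  set c := (e0 * q.1 0 0 + _) / _ in c0 cs.
  have sI : s \in `[(-1), 1] by rewrite in_itv /= (ltW s1) (ltW s2).
  split.
    rewrite /tubeU /tubeY /= mk2_0 mk2_1 -/s; split=> //.
    by rewrite asin_gtNpi2 ?asin_ltpi2 // ?s1 ?s2 ltW.
  rewrite /tubeX /tubeY mk2_0 mk2_1 -/s asinK //.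
  have -> : cos (asin s) = c.
    rewrite cos_asin; last by rewrite !ltW.
    by rewrite -cs addrK sqrtr_sqr gtr0_norm.
  have x0 : pr_S P q.2 * (e0 * c - e1 * s) = q.1 0 0.
    transitivity ((e0 ^+ 2 + e1 ^+ 2) * q.1 0 0); last by rewrite ee mul1r.
    by rewrite /c /s; field; rewrite gt_eqF.
  have x1 : pr_S P q.2 * (e1 * c + e0 * s) = q.1 0 1.
    transitivity ((e0 ^+ 2 + e1 ^+ 2) * q.1 0 1); last by rewrite ee mul1r.
    by rewrite /c /s; field; rewrite gt_eqF.
  by rewrite x0 x1 -qC; exact: mk4K.
- move=> q Aq Wq; have [_ _ sI] := key q Aq Wq; have [qz' _] := Wq.
  have c0 := ct_ambient 0 q; have c1 := ct_ambient 1 q; have c2 := ct_height q.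
  have Sc : continuous_at q (fun q : ambient R => pr_S P q.2).
    by apply: ct_comp; [exact: ct_pr_S | exact: c2].
  rewrite /prop_for /tubeY; apply: ct_mk2; first exact: c2.
  apply: ct_comp; first exact: continuous_asin.
  by ct; rewrite gt_eqF // pr_S_gt0.
- exact: tubeX_C2.
- by move=> u Uu x y; exact: tubeX_immersion.
Qed.

(** The coordinates are orthogonal, and the two terms of the trace are the
    curvatures of the profile and of the horizontal circle; by the equation for
    [pr_dp] the terms in [k C] cancel. *)
Lemma tube_curvature R (kappa : R) (g : R -> R)
    (P : profile kappa g) (e0 e1 eps : R) (u : 'rV[R]_2) :
  kappa ^+ 2 = 1 -> e0 ^+ 2 + e1 ^+ 2 = 1 -> tubeU (pr_z1 P) u -> u 0 1 = 0 ->
  let X := tubeX e0 e1 (pr_S P) (pr_C P) in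
  let v := eps *: revolution_normal P (X u) in
  (forall i, form4 kappa (partial i X u) v = 0) /\
  \tr (shape_operator kappa X v u) =
    2 * (eps * g (pr_k P (u 0 0) * pr_S P (u 0 0))).
Proof.
move=> k2 ee Uu u1 X v; have [tz _] := Uu.
have X0 := tubeX_partial0 (P := P) e0 e1 tz.
have X1 := tubeX_partial1 (P := P) e0 e1 tz.
have X00 := tubeX_partial00 e0 e1 Uu; have X11 := tubeX_partial11 e0 e1 Uu.
cbv zeta in X0, X1, X00, X11.
rewrite u1 cos0 sin0 !mulr1 !mulr0 subr0 addr0 in X0 X1 X00 X11.
have vE : v = mk4 (eps * (- (pr_k P (u 0 0) * pr_C P (u 0 0)) * (pr_S P (u 0 0) * e0)))
    (eps * (- (pr_k P (u 0 0) * pr_C P (u 0 0)) * (pr_S P (u 0 0) * e1)))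
    (eps * (kappa * pr_k P (u 0 0) * pr_S P (u 0 0) ^+ 2)) (eps * pr_c P (u 0 0)).
  rewrite /v /revolution_normal /X /tubeX mk4_0 mk4_1 mk4_3 u1 cos0 sin0.
  rewrite !mulr1 !mulr0 subr0 addr0.
  exact: mk4_scale.
have S0 := pr_S_gt0 tz; have k0 := pr_k_gt0 P (u 0 0).
have CS := pr_CS P (u 0 0) k2; have unit := pr_unitS P (u 0 0).
move: X0 X1 X00 X11 vE; rewrite -/X /pr_dp /pr_p.
set t := u 0 0 in S0 k0 CS unit *; set G := g _.
move: (pr_S P t) (pr_C P t) (pr_k P t) (pr_c P t) S0 k0 CS unit G => S C k c.
move=> S0 k0 CS unit G X0 X1 X00 X11 vE.
have Sn : S != 0 by rewrite gt_eqF.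
have kn : k != 0 by rewrite gt_eqF.
have cE : c ^+ 2 = 1 - (k * S) ^+ 2 by rewrite -unit addrK.
have CE : C ^+ 2 = 1 - kappa * S ^+ 2 by rewrite -CS addrK.
have eE : e1 ^+ 2 = 1 - e0 ^+ 2 by rewrite -ee addrAC subrr add0r.
have n0 : form4 kappa (partial 0 X u) v = 0.
  rewrite X0 vE form4_mk4.
  transitivity (eps * c * (1 - (C ^+ 2 * (e0 ^+ 2 + e1 ^+ 2) +
    kappa * S ^+ 2 * kappa ^+ 2))); first by field; rewrite ?Sn ?kn.
  by rewrite ee k2 !mulr1 CS subrr mulr0.
have n1 : form4 kappa (partial 1 X u) v = 0.
  by rewrite X1 vE form4_mk4; ring.
split; first by apply: ord2P.
have F0 : form4 kappa (partial 0 X u) (partial 1 X u) = 0.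
  by rewrite X0 X1 form4_mk4; ring.
have E0 : form4 kappa (partial 0 X u) (partial 0 X u) = ((k * S) ^+ 2)^-1.
  rewrite X0 form4_mk4.
  transitivity ((c ^+ 2 * (C ^+ 2 * (e0 ^+ 2 + e1 ^+ 2) +
    kappa * S ^+ 2 * kappa ^+ 2) + (k * S) ^+ 2) / (k * S) ^+ 2).
    by field; rewrite ?Sn ?kn.
  by rewrite ee k2 !mulr1 CS mulr1 unit mul1r.
have G0 : form4 kappa (partial 1 X u) (partial 1 X u) = S ^+ 2.
  rewrite X1 form4_mk4; transitivity (S ^+ 2 * (e0 ^+ 2 + e1 ^+ 2)); first by ring.
  by rewrite ee mulr1.
have A0 : form4 kappa (partial 0 (partial 0 X) u) v =
    - eps * (k * C - 2 * G) / (k * S) ^+ 2.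
  rewrite X00 vE form4_mk4.
  transitivity (- eps * (k * C - 2 * G) / (k * S) ^+ 2 *
     (C ^+ 2 * (e0 ^+ 2 + e1 ^+ 2) + kappa * S ^+ 2 * kappa ^+ 2) +
     eps * C * c ^+ 2 / k * kappa * (e0 ^+ 2 + e1 ^+ 2 - kappa ^+ 2)).
    by field; rewrite ?Sn ?kn.
  by rewrite ee k2 !mulr1 CS mulr1 subrr mulr0 addr0.
have B0 : form4 kappa (partial 1 (partial 1 X) u) v = eps * (k * C * S ^+ 2).
  rewrite X11 vE form4_mk4.
  transitivity (eps * (k * C * S ^+ 2) * (e0 ^+ 2 + e1 ^+ 2)); first by ring.
  by rewrite ee mulr1.
have nE : ((k * S) ^+ 2)^-1 != 0 by rewrite invr_eq0 expf_neq0 // mulf_neq0.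
have nG : S ^+ 2 != 0 by rewrite expf_neq0.
rewrite (@trace_shape_operator R kappa _ _ _ _ X v u F0 E0 nE G0 nG A0 B0).
by field; rewrite ?Sn ?kn.
Qed.

(** * Compactness, spheres and rotations *)

Lemma closed_le_fun R (T : topologicalType) (f : T -> R) (a : R) :
  continuous f -> closed [set x | f x <= a].
Proof. by move=> fc; apply: (preimage_closed _ (@closed_le R a)) => x _; exact: fc. Qed.

Lemma closed_eq_fun R (T : topologicalType) (f : T -> R) (a : R) :
  continuous f -> closed [set x | f x = a].
Proof. by move=> fc; apply: (preimage_closed _ (@closed_eq R a)) => x _; exact: fc. Qed.

Lemma compact_ambient R (A : set (ambient R)) (b : R) : closed A ->
  (forall q, A q -> [/\ q.1 0 0 ^+ 2 <= b, q.1 0 1 ^+ 2 <= b,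
     q.1 0 2 ^+ 2 <= b & q.2 ^+ 2 <= b]) -> compact A.
Proof.
move=> cA Ab; pose I : set R := `[- (b + 1), b + 1]%classic.
have cI : compact I by exact: segment_compact.
have inI (x : R) : x ^+ 2 <= b -> I x.
  move=> xb; rewrite /I /= in_itv /= -ler_norml.
  have := real_normK (num_real x); have := normr_ge0 x; nra.
apply: (subclosed_compact cA (compact_setX (rV_compact (fun _ : 'I_3 => cI)) cI)).
move=> q /Ab [q0 q1 q2 q3]; split; last exact: inI.
by apply: ord3P; exact: inI.
Qed.

Lemma form3_axis R (kappa : R) (x : 'rV[R]_3) :
  form3 kappa x (delta_mx 0 2) = kappa * x 0 2.
Proof. by rewrite /form3 !mxE /= !mulr0 !add0r mulr1. Qed.

(** A rotation about the third axis preserves [x2] and [x0^2 + x1^2], hence any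
    set described by these quantities and the height. *)
Lemma rotational_axis R (kappa : R) (D : set (ambient R)) :
  kappa = -1 \/ kappa = 1 ->
  (forall p q : ambient R, D p ->
     p.1 0 0 ^+ 2 + p.1 0 1 ^+ 2 = q.1 0 0 ^+ 2 + q.1 0 1 ^+ 2 ->
     p.1 0 2 = q.1 0 2 -> p.2 = q.2 -> D q) ->
  rotational kappa D.
Proof.
move=> kE DE; have k0 : kappa != 0.
  by case: kE => ->; rewrite ?oppr_eq0 oner_neq0.
exists (delta_mx 0 2).
  by split; [rewrite form3_axis !mxE /= mulr1 | rewrite !mxE /= ltr01].
move=> A [Af Adet Ap].
have pres (x : 'rV[R]_3) : (x *m A) 0 2 = x 0 2 /\
    (x *m A) 0 0 ^+ 2 + (x *m A) 0 1 ^+ 2 = x 0 0 ^+ 2 + x 0 1 ^+ 2.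
  have E2 : (x *m A) 0 2 = x 0 2.
    by apply: (mulfI k0); rewrite -!form3_axis -{1}Ap Af.
  split=> //; have := Af x x; rewrite /form3 E2 => /addIr.
  by rewrite -!expr2.
have uA : A \in unitmx by rewrite unitmxE Adet unitr1.
apply/seteqP; split=> [_ [q Dq <-]|q Dq].
  have [E2 E1] := pres q.1.
  by apply: (DE q) => //=; rewrite ?E1 ?E2.
exists (q.1 *m invmx A, q.2); last by rewrite /= mulmxKV //; case: (q).
have [E2 E1] := pres (q.1 *m invmx A); rewrite mulmxKV // in E1 E2.
by apply: (DE q) => //=; rewrite ?E1 ?E2.
Qed.

(** * The surface of revolution of a profile *)

Lemma pr_pole_S R (kappa : R) (g : R -> R) (P : profile kappa g)
    (t : R) : pr_z1 P <= `|t| -> pr_S P t = 0.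
Proof. by move=> tz; rewrite /pr_S pr_v_pole // /sn /sn2 mul0r sqrtr0. Qed.

Lemma ct_height_fun R (f : R -> R) : continuous f ->
  continuous (fun q : ambient R => f q.2).
Proof. by move=> fc q; apply: ct_comp; [exact: fc | exact: ct_height]. Qed.

Lemma revolution_compact R (kappa : R) (g : R -> R)
    (P : profile kappa g) : compact (revolution P).
Proof.
have Sc : continuous (fun q : ambient R => pr_S P q.2).
  by apply: ct_height_fun => t; exact: ct_pr_S.
have Cc : continuous (fun q : ambient R => pr_C P q.2).
  by apply: ct_height_fun => t; exact: ct_pr_C.
have c0 := @ct_ambient R 0; have c1 := @ct_ambient R 1.
have c2 := @ct_ambient R 2; have c3 := @ct_height R.
have cl : closed (revolution P).
  have -> : revolution P = [set q : ambient R | `|q.2| <= pr_z1 P] `&`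
     ([set q : ambient R | q.1 0 2 - pr_C P q.2 = 0] `&`
      [set q : ambient R | q.1 0 0 ^+ 2 + q.1 0 1 ^+ 2 - pr_S P q.2 ^+ 2 = 0]).
    apply/seteqP; split=> q; first by move=> [a b c]; rewrite /= b c !subrr.
    by move=> [a [/subr0_eq b /subr0_eq c]].
  apply: closedI; first by apply: closed_le_fun => q; exact: (ct_norm (c3 q)).
  apply: closedI; apply: closed_eq_fun => q.
    by have h2 := c2 q; have hC := Cc q; ct.
  by have h0 := c0 q; have h1 := c1 q; have hS := Sc q; ct.
have zz : - pr_z1 P <= pr_z1 P by have := pr_z1_gt0 P; lra.
have [|x _ xm] := @continuous_itv_min R
    (fun t => - (pr_S P t ^+ 2 + pr_C P t ^+ 2)) _ _ zz.
  by move=> t _; have hS := ct_pr_S P t; have hC := ct_pr_C P t; ct.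
set m := pr_S P x ^+ 2 + pr_C P x ^+ 2 in xm.
apply: (compact_ambient (b := m + pr_z1 P ^+ 2) cl) => q [qz q2 qS].
have : pr_S P q.2 ^+ 2 + pr_C P q.2 ^+ 2 <= m.
  by rewrite -lerN2; apply: xm; rewrite -ler_norml.
have zq : q.2 ^+ 2 <= pr_z1 P ^+ 2.
  rewrite -(real_normK (num_real q.2)) ler_pXn2r ?nnegrE //.
  exact: ltW (pr_z1_gt0 P).
rewrite -qS -q2.
have := sqr_ge0 (q.1 0 0); have := sqr_ge0 (q.1 0 1).
have := sqr_ge0 (q.1 0 2); have := sqr_ge0 (q.2).
move: zq; move: (q.2 ^+ 2) (q.1 0 2 ^+ 2) (q.1 0 1 ^+ 2) (q.1 0 0 ^+ 2)
  (pr_z1 P ^+ 2) => a b c d e.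
by clear; split; lra.
Qed.

Lemma revolution_M2xR R (kappa : R) (g : R -> R)
    (P : profile kappa g) : kappa = -1 \/ kappa = 1 ->
  revolution P `<=` M2xR kappa.
Proof.
move=> kE q [qz q2 qS]; have k2 := kappa_sqr kE; split.
  rewrite /form3 -!expr2 qS q2.
  transitivity (kappa * (pr_C P q.2 ^+ 2 + kappa * pr_S P q.2 ^+ 2)).
    by rewrite mulrDr mulrA -expr2 k2 mul1r addrC.
  by rewrite pr_CS // mulr1.
move=> km; rewrite q2 /pr_C {1}km mulN1r opprK.
by have := pr_v_ge0 P q.2; lra.
Qed.

(** The parametrization around the pole of height [- sg * z1]. *)
Definition pole_height R (kappa : R) (g : R -> R)
    (P : profile kappa g) (sg w : R) : R := sg * (pr_W P w - pr_z1 P).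

Definition pole_W R (kappa : R) (g : R -> R)
    (P : profile kappa g) (sg : R) : set (ambient R) :=
  [set q : ambient R | sg * q.2 < 0 /\ kappa * (1 - 1 * q.1 0 2) < pr_v0 P].

Lemma pole_cap R (kappa : R) (g : R -> R) (P : profile kappa g)
    (sg : R) : kappa = -1 \/ kappa = 1 ->
  cap kappa (pr_v0 P) (pole_height P sg) (fun w => sg * pr_q P w)
    (fun w => sg * pr_psi P w).
Proof.
move=> kE; split.
- exact: pr_v0_gt0.
- move=> w /andP[w0]; move: (pr_v0 P) (pr_v0_lt P) => v0 h wv.
  by case: kE => k1; rewrite k1 in h *; lra.
- have [B Wl] := pr_W_lip P; exists (`|sg| * B) => s t.
  rewrite /pole_height -mulrBr normrM -mulrA; apply: ler_wpM2l => //.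
  by rewrite opprB addrA subrK; exact: Wl.
- by move=> w wv; have qc := pr_q_cont wv; ct.
- by move=> w wv; have qc := pr_psi_cont wv; ct.
- by rewrite pr_psi0 mulr0.
- move=> w wv; have D := pr_W_der wv.
  rewrite /pole_height; eapply der_eq; first by der.
  by rewrite /=; ring.
- move=> w wv; have D := pr_q_der wv.
  by eapply der_eq; [der | rewrite /=; ring].
Qed.

Lemma pole_patch R (kappa : R) (g : R -> R) (P : profile kappa g)
    (sg : R) : kappa = -1 \/ kappa = 1 -> sg = 1 \/ sg = -1 ->
  patch (revolution P) [set u | hsq u < pr_v0 P]
    (capX kappa 1 (pole_height P sg)) (pole_W P sg) (capY 1).
Proof.
move=> kE sgE; have k2 := kappa_sqr kE.
have sg2 : sg * sg = 1 by case: sgE => ->; rewrite ?mulrNN mulr1.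
have vsg (t : R) : pr_v P (sg * t) = pr_v P t.
  by case: sgE => ->; rewrite ?mul1r // mulN1r pr_v_even.
have nsg (t : R) : `|sg * t| = `|t|.
  by case: sgE => ->; rewrite ?mul1r // mulN1r normrN.
apply: (cap_patch k2 (expr1n _ _) (pole_cap P sg kE)).
- have c2 := @ct_ambient R 2; have c3 := @ct_height R.
  have -> : pole_W P sg = [set q : ambient R | sg * q.2 < 0] `&`
      [set q : ambient R | kappa * (1 - 1 * q.1 0 2) < pr_v0 P] by [].
  apply: openI; apply: open_lt_fun => q.
    by have h3 := c3 q; ct.
  by have h2 := c2 q; ct.
- move=> u uw; have [t /andP[t1 t2] vt] := @pr_vW _ _ _ P (hsq u)
    ltac:(by rewrite hsq_ge0).
  have Wt : pr_W P (hsq u) = t + pr_z1 P.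
    by rewrite -vt; apply: pr_Wv; rewrite ?t1 // vt.
  have hE : pole_height P sg (hsq u) = sg * t by rewrite /pole_height Wt addrK.
  have r0 := cap_rad_gt0 (pole_cap P sg kE) uw.
  rewrite /capX; set s := Num.sqrt _.
  have s2 : s ^+ 2 = 1 - kappa * hsq u / 2 by rewrite sqr_sqrtr // ltW.
  set X := mk4 _ _ _ _.
  have X0 : X.1 0 0 = u 0 0 * s by exact: mk4_0.
  have X1 : X.1 0 1 = u 0 1 * s by exact: mk4_1.
  have X2 : X.1 0 2 = 1 * (1 - kappa * hsq u) by exact: mk4_2.
  have X3 : X.2 = sg * t by rewrite -hE; exact: mk4_3.
  clearbody X; split; rewrite /revolution /pole_W /= ?X0 ?X1 X2 X3.
    split.
    + by rewrite nsg ler_norml t1 (le_trans (ltW t2) (ltW (pr_z1_gt0 P))).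
    + by rewrite /pr_C vsg vt mul1r.
    + by rewrite pr_S2 vsg vt /sn2 !exprMn s2 /hsq; field.
  rewrite mulrA sg2 !mul1r; split=> //.
  by rewrite opprB addrC subrK mulrA -expr2 k2 mul1r.
- move=> p [pz p2 pS] [p3 pv] v.
  have vE : v = pr_v P p.2.
    by rewrite /v p2 /pr_C mul1r opprB addrC subrK mulrA -expr2 k2 mul1r.
  split.
  + by rewrite vE pr_v_ge0 -vE.
  + by rewrite pS pr_S2 vE.
  + rewrite /pole_height vE -vsg pr_Wv ?vsg -?vE //.
      by rewrite addrK mulrA sg2 mul1r.
    rewrite p3 andbT; have : `|sg * p.2| <= pr_z1 P by rewrite nsg.
    by rewrite ler_norml => /andP[].
Qed.

(** * The surface of revolution is an embedded sphere *)

Lemma form4_d_z R (kappa : R) (v : ambient R) :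
  form4 kappa v (d_z R) = v.2.
Proof.
have z (j : 'I_3) : (0 : 'rV[R]_3) 0 j = 0 by exact: mxE.
by rewrite /form4 /form3 /d_z !z !mulr0 !addr0 add0r mulr1.
Qed.

(** Every point lies in a chart in which the curvature equation can be read off:
    the tube chart centred at the point, or the chart of the pole. *)
Lemma revolution_chart R (kappa : R) (g : R -> R)
    (P : profile kappa g) (eps : R) (q : ambient R) :
  kappa = -1 \/ kappa = 1 -> continuous g -> revolution P q ->
  let v := eps *: revolution_normal P q in
  exists U X W Y, [/\ patch (revolution P) U X W Y, W q,
    forall i, form4 kappa (partial i X (Y q)) v = 0 &
    \tr (shape_operator kappa X v (Y q)) =
      2 * (eps * g (pr_k P q.2 * pr_S P q.2))].
Proof.
move=> kE gc Aq v; have k2 := kappa_sqr kE; have [qz q2 qS] := Aq.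
have [qlt|qge] := ltP `|q.2| (pr_z1 P).
  have S0 := pr_S_gt0 qlt; have Sn : pr_S P q.2 != 0 by rewrite gt_eqF.
  pose e0 := q.1 0 0 / pr_S P q.2; pose e1 := q.1 0 1 / pr_S P q.2.
  have ee : e0 ^+ 2 + e1 ^+ 2 = 1.
    by rewrite !expr_div_n -mulrDl qS divff // expf_neq0.
  have Pt := tube_patch P gc ee.
  have Wq : tubeW (pr_z1 P) e0 e1 q.
    split=> //; have -> : e0 * q.1 0 0 + e1 * q.1 0 1 =
        (q.1 0 0 ^+ 2 + q.1 0 1 ^+ 2) / pr_S P q.2 by rewrite /e0 /e1; field.
    by rewrite qS divr_gt0 // exprn_gt0.
  have [UY XY] := patch_inv Pt Aq Wq.
  have Y0 : tubeY e0 e1 (pr_S P) q 0 0 = q.2 by exact: mk2_0.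
  have Y1 : tubeY e0 e1 (pr_S P) q 0 1 = 0.
    rewrite /tubeY mk2_1; have -> : e0 * q.1 0 1 - e1 * q.1 0 0 = 0.
      by rewrite /e0 /e1; field.
    rewrite mul0r -[in LHS](sin0 R) sinK // in_itv /=.
    by rewrite oppr_le0 divr_ge0 ?pi_ge0.
  have [nv tr] := tube_curvature eps k2 ee UY Y1.
  rewrite XY Y0 in nv tr.
  exists (tubeU (pr_z1 P)), (tubeX e0 e1 (pr_S P) (pr_C P)),
    (tubeW (pr_z1 P) e0 e1), (tubeY e0 e1 (pr_S P)).
  by split; [exact: Pt | exact: Wq | exact: nv | exact: tr].
have z0 := pr_z1_gt0 P.
have zE : `|q.2| = pr_z1 P by apply/eqP; rewrite eq_le qz.
have [sg [sgE q3]] : exists sg : R, (sg = 1 \/ sg = -1) /\ q.2 = - (sg * pr_z1 P).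
  move: zE; have [q0|q0] := leP 0 q.2.
    by rewrite ger0_norm // => ->; exists (-1); rewrite mulN1r opprK; split; [right|].
  rewrite ltr0_norm // => E; exists 1; rewrite mul1r -E opprK.
  by split; [left|].
have sg2 : sg * sg = 1 by case: sgE => ->; rewrite ?mulrNN mulr1.
have Sq : pr_S P q.2 = 0 by exact: pr_pole_S.
have vq : pr_v P q.2 = 0 by exact: pr_v_pole.
have xx : q.1 0 0 ^+ 2 + q.1 0 1 ^+ 2 = 0 by rewrite qS Sq expr0n.
have [x0 x1] : q.1 0 0 = 0 /\ q.1 0 1 = 0.
  move/eqP: xx; rewrite paddr_eq0 ?sqr_ge0 // !sqrf_eq0.
  by move=> /andP[/eqP ? /eqP ?].
have cq : pr_c P q.2 = sg.
  rewrite q3 pr_c_odd; case: sgE => ->.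
    by rewrite mul1r -pr_c_odd pr_c_pole.
  by rewrite mulN1r pr_c_pole.
have vE : v = mk4 0 0 0 (eps * sg).
  by rewrite /v /revolution_normal x0 x1 Sq cq expr0n !mulr0 mk4_scale !mulr0.
have Wq : pole_W P sg q.
  split; first by rewrite q3 mulrN mulrA sg2 mul1r oppr_lt0.
  by rewrite q2 /pr_C vq mulr0 subr0 mulr1 subrr mulr0 pr_v0_gt0.
have Y0 : hsq (capY 1 q) = 0.
  by rewrite /hsq /capY mk2_0 mk2_1 x0 x1 !mul0r expr0n addr0 mul0r.
have [nv tr] := capX_curvature 1 (eps * sg) (pole_cap P sg kE) Y0.
rewrite -vE in nv tr.
exists [set u | hsq u < pr_v0 P], (capX kappa 1 (pole_height P sg)),
  (pole_W P sg), (capY 1).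
split; [exact: pole_patch | exact: Wq | exact: nv | rewrite tr].
rewrite pr_q0 Sq mulr0; congr (2 * _).
transitivity (eps * (sg * sg) * g 0); first by ring.
by rewrite sg2 mulr1.
Qed.

Lemma revolution_H_surface R (kappa : R) (g H : R -> R)
    (P : profile kappa g) (eps : R) :
  kappa = -1 \/ kappa = 1 -> continuous g -> eps ^+ 2 = 1 ->
  (forall t, H (eps * pr_c P t) = eps * g (pr_k P t * pr_S P t)) ->
  H_surface kappa H (set_val : revolution P -> ambient R)
    (fun s => eps *: revolution_normal P (set_val s)).
Proof.
move=> kE gc e2 HE; have k2 := kappa_sqr kE.
split.
- apply: set_type_immersed.
  + exact: revolution_compact.
  + exact: revolution_M2xR.
  + move=> q Aq; have [U [X [W [Y [Pt Wq _ _]]]]] := revolution_chart 1 kE gc Aq.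
    by exists U, X, W, Y; split; [exact: Pt | exact: Wq].
- split.
    have nc : continuous (fun q : ambient R => eps *: revolution_normal P q).
      move=> q; have c0 := ct_ambient 0 q; have c1 := ct_ambient 1 q.
      have kc := ct_height_fun (@pr_k_cont _ _ _ P) (x := q).
      have cc := ct_height_fun (@pr_c_cont _ _ _ P) (x := q).
      have Sc := ct_height_fun (ct_pr_S P) (x := q).
      have Cc := ct_height_fun (ct_pr_C P) (x := q).
      have -> : (fun q : ambient R => eps *: revolution_normal P q) = (fun q =>
          mk4 (eps * (- (pr_k P q.2 * pr_C P q.2) * q.1 0 0))
            (eps * (- (pr_k P q.2 * pr_C P q.2) * q.1 0 1))
            (eps * (kappa * pr_k P q.2 * pr_S P q.2 ^+ 2)) (eps * pr_c P q.2)).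
        by apply/funext => x; exact: mk4_scale.
      by apply: ct_mk4; ct.
    move=> s; apply: (@continuous_comp _ _ _ set_val
      (fun q : ambient R => eps *: revolution_normal P q)).
      exact: set_type_continuous.
    exact: nc.
  move=> s; have Aq := set_type_mem s; have [qz q2 qS] := Aq.
  set q := set_val s in Aq qz q2 qS *.
  have CS := pr_CS P q.2 k2; have unit := pr_unitS P q.2.
  have vE : eps *: revolution_normal P q =
      mk4 (eps * (- (pr_k P q.2 * pr_C P q.2) * q.1 0 0))
        (eps * (- (pr_k P q.2 * pr_C P q.2) * q.1 0 1))
        (eps * (kappa * pr_k P q.2 * pr_S P q.2 ^+ 2)) (eps * pr_c P q.2).
    exact: mk4_scale.
  split.
  + rewrite vE /tangent_M2xR /= /form3 mk4_0 mk4_1 mk4_2 q2.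
    transitivity (eps * pr_k P q.2 * pr_C P q.2 *
      (kappa ^+ 2 * pr_S P q.2 ^+ 2 - (q.1 0 0 ^+ 2 + q.1 0 1 ^+ 2))).
      by ring.
    by rewrite k2 qS mul1r subrr mulr0.
  + rewrite vE form4_mk4.
    transitivity (eps ^+ 2 * (pr_c P q.2 ^+ 2 + pr_k P q.2 ^+ 2 *
      (pr_C P q.2 ^+ 2 * (q.1 0 0 ^+ 2 + q.1 0 1 ^+ 2) +
       kappa * pr_S P q.2 ^+ 2 * kappa ^+ 2 * pr_S P q.2 ^+ 2))); first by ring.
    rewrite qS k2 e2 mul1r mulr1 -mulrDl CS mul1r -exprMn; exact: unit.
  + have [U [X [W [Y [Pt Wq nv _]]]]] := revolution_chart eps kE gc Aq.
    exact: (patch_normal Pt Wq nv).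
- move=> s; have Aq := set_type_mem s.
  have [U [X [W [Y [Pt Wq _ tr]]]]] := revolution_chart eps kE gc Aq.
  apply: (patch_mean_curvature Pt Wq).
  rewrite tr [RHS]mulrAC divff ?pnatr_eq0 // mul1r -HE; congr H.
  by rewrite /angle form4_d_z /revolution_normal mk4_scale mk4_3.
Qed.

(** The revolution surface is mapped to the round sphere by rescaling the
    horizontal circles; the map is continuous at the poles because the circles
    shrink to points there on both sides. *)
Lemma revolution_is_sphere R (kappa : R) (g : R -> R)
    (P : profile kappa g) : is_sphere R (revolution P : Type).
Proof.
set z1 := pr_z1 P; have z0 : 0 < z1 := pr_z1_gt0 P.
pose r (t : R) := Num.sqrt (1 - (t / z1) ^+ 2).
pose G (q : ambient R) : 'rV[R]_3 :=
  (mk4 (q.1 0 0 * (r q.2 / pr_S P q.2)) (q.1 0 1 * (r q.2 / pr_S P q.2))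
    (q.2 / z1) 0).1.
have rc : continuous r by move=> t; rewrite /r; ct; rewrite gt_eqF.
have rpole t : z1 <= `|t| -> r t = 0.
  move=> tz; rewrite /r ler0_sqrtr // subr_le0 -(real_normK (num_real _)).
  rewrite normrM normfV (gtr0_norm z0) -(expr1n _ 2) ler_pXn2r ?nnegrE ?ler01 //.
    by rewrite ler_pdivlMr // mul1r.
  by rewrite divr_ge0 // ltW.
have r2 t : `|t| <= z1 -> r t ^+ 2 = 1 - (t / z1) ^+ 2.
  move=> tz; rewrite sqr_sqrtr // subr_ge0 -(real_normK (num_real _)).
  rewrite exprn_ile1 // normrM normfV (gtr0_norm z0) ler_pdivrMr // mul1r //.
have rgt0 t : `|t| < z1 -> 0 < r t.
  move=> tz; rewrite sqrtr_gt0 subr_gt0 -(real_normK (num_real _)).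
  rewrite exprn_ilt1 // normrM normfV (gtr0_norm z0) ltr_pdivrMr // mul1r //.
have S0 t : `|t| < z1 -> 0 < pr_S P t by exact: pr_S_gt0.
have bound (q : ambient R) (x : R) : x ^+ 2 <= pr_S P q.2 ^+ 2 ->
    `|x * (r q.2 / pr_S P q.2)| <= r q.2.
  move=> xS; have Sge : 0 <= pr_S P q.2 by exact: sqrtr_ge0.
  have xS' : `|x| <= pr_S P q.2.
    by rewrite -(ler_pXn2r (n := 2)) ?nnegrE // real_normK // num_real.
  have rge : 0 <= r q.2 by exact: sqrtr_ge0.
  have [S00|Sn] := eqVneq (pr_S P q.2) 0.
    by rewrite S00 invr0 !mulr0 normr0.
  rewrite !normrM normfV (ger0_norm rge) (ger0_norm Sge) mulrCA.
  by rewrite ler_piMr // ler_pdivrMr ?mul1r // lt_neqAle eq_sym Sn.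
have Gc : continuous (fun s : revolution P => G (set_val s)).
  have key (j : 'I_3) : j = 0 \/ j = 1 -> forall s : revolution P, continuous_at s
      (fun s : revolution P => (set_val s).1 0 j *
        (r (set_val s).2 / pr_S P (set_val s).2)).
    move=> jE s.
    have cv := @set_type_continuous _ (revolution P) s.
    have comp (f : ambient R -> R) : continuous f ->
        continuous_at s (fun s : revolution P => f (set_val s)).
      by move=> fc; apply: (@continuous_comp _ _ _ set_val f); [exact: cv | exact: fc].
    have cj := comp _ (ct_ambient j).
    have cr := comp _ (ct_height_fun rc).
    have cS := comp _ (ct_height_fun (ct_pr_S P)).
    have [qlt|qge] := ltP `|(set_val s).2| z1.
      by ct; rewrite gt_eqF // S0.
    apply/ct_dist => e e0; move/ct_dist: cr => /(_ e e0); apply: filterS => t.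
    rewrite (rpole _ qge) mul0r mulr0 !sub0r !normrN.
    apply: le_lt_trans; rewrite [leRHS]ger0_norm ?sqrtr_ge0 //; apply: bound.
    have [_ _ <-] := set_type_mem t.
    by case: jE => ->; rewrite ?lerDl ?lerDr sqr_ge0.
  move=> s; rewrite /G.
  apply: (@continuous_comp _ _ _ (fun s : revolution P => _) fst); last exact: cvg_fst.
  apply: ct_mk4; [by apply: key; left | by apply: key; right | | exact: ct_cst].
  apply: (@continuous_comp _ _ _ set_val (fun q : ambient R => q.2 / z1)).
    exact: set_type_continuous.
  by apply: ct_mul; [exact: ct_height | exact: ct_cst].
have G0 q : G q 0 0 = q.1 0 0 * (r q.2 / pr_S P q.2) by exact: mk4_0.
have G1 q : G q 0 1 = q.1 0 1 * (r q.2 / pr_S P q.2) by exact: mk4_1.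
have G2 q : G q 0 2 = q.2 / z1 by exact: mk4_2.
have pole_x (q : ambient R) : revolution P q -> z1 <= `|q.2| ->
    q.1 0 0 = 0 /\ q.1 0 1 = 0.
  move=> [_ _ qS] qz; move/eqP: qS; rewrite pr_pole_S // expr0n.
  rewrite paddr_eq0 ?sqr_ge0 // !sqrf_eq0.
  by move=> /andP[/eqP ? /eqP ?].
exists (fun s : revolution P => G (set_val s)).
  apply: compact_embedding.
  - exact/set_type_compact/revolution_compact.
  - exact: norm_hausdorff.
  - exact: Gc.
  - move=> s t E; apply: set_type_eq.
    have As := set_type_mem s; have At := set_type_mem t.
    move: (set_val s) (set_val t) As At E => p q Ap Aq E.
    have [_ p2 _] := Ap; have [_ q2 _] := Aq.
    have z : p.2 = q.2.
      have : G p 0 2 = G q 0 2 by rewrite E.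
      by rewrite !G2; apply: mulIf; rewrite invr_eq0 gt_eqF.
    have [qlt|qge] := ltP `|q.2| z1; last first.
      have [q0 q1] := pole_x q Aq qge; have [p0 p1] := pole_x p Ap ltac:(by rewrite z).
      by apply: ambient_eq; rewrite ?p0 ?q0 ?p1 ?q1 // p2 q2 z.
    have ln : r q.2 / pr_S P q.2 != 0 by rewrite gt_eqF // divr_gt0 ?rgt0 ?S0.
    apply: ambient_eq; rewrite ?p2 ?q2 ?z //.
      by apply: (mulIf ln); rewrite -[in LHS]z -!G0 E.
    by apply: (mulIf ln); rewrite -[in LHS]z -!G1 E.
apply/seteqP; split=> [_ [s _ <-]|w [w1 _]].
  split; last by move=> E; exfalso; move: E; clear; lra.
  have Aq := set_type_mem s; move: (set_val s) Aq => q Aq; have [qz q2 qS] := Aq.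
  rewrite /form3 G0 G1 G2 mul1r -!expr2.
  have [qlt|qge] := ltP `|q.2| z1; last first.
    have [q0 q1] := pole_x q Aq qge.
    have := r2 _ qz; rewrite (rpole _ qge) q0 q1 !mul0r !expr0n /= => E.
    by rewrite !add0r; apply/eqP; rewrite eq_sym -subr_eq0 -E.
  have Sn : pr_S P q.2 != 0 by rewrite gt_eqF // S0.
  transitivity ((q.1 0 0 ^+ 2 + q.1 0 1 ^+ 2) * (r q.2 / pr_S P q.2) ^+ 2 +
    (q.2 / z1) ^+ 2); first by ring.
  by rewrite qS -exprMn mulrCA divff // mulr1 r2 // subrK.
pose t := z1 * w 0 2.
have w1' : w 0 0 ^+ 2 + w 0 1 ^+ 2 + w 0 2 ^+ 2 = 1.
  by rewrite -[RHS]w1 /form3 mul1r -!expr2.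
have tz : t / z1 = w 0 2 by rewrite /t mulrAC divff ?mul1r // gt_eqF.
have wle : `|w 0 2| <= 1.
  rewrite -(ler_pXn2r (n := 2)) ?nnegrE // expr1n real_normK ?num_real //.
  by rewrite -w1' lerDr addr_ge0 // sqr_ge0.
have tle : `|t| <= z1 by rewrite normrM (gtr0_norm z0) ler_piMr // ltW.
have rt : r t ^+ 2 = w 0 0 ^+ 2 + w 0 1 ^+ 2.
  by rewrite r2 // tz -w1' addrK.
pose q : ambient R := mk4 (w 0 0 * (pr_S P t / r t)) (w 0 1 * (pr_S P t / r t))
  (pr_C P t) t.
have q0E : q.1 0 0 = w 0 0 * (pr_S P t / r t) by exact: mk4_0.
have q1E : q.1 0 1 = w 0 1 * (pr_S P t / r t) by exact: mk4_1.
have q2E : q.1 0 2 = pr_C P t by exact: mk4_2.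
have q3E : q.2 = t by exact: mk4_3.
clearbody q.
suff [Aq GE] : revolution P q /\ G q = w by exists (exist _ q (mem_set Aq)).
have AqE : (w 0 0 ^+ 2 + w 0 1 ^+ 2) * (pr_S P t / r t) ^+ 2 = pr_S P t ^+ 2 ->
    revolution P q.
  move=> E; split; [by rewrite q3E | by rewrite q2E q3E |].
  by rewrite q0E q1E q3E -E; ring.
have GE : w 0 0 * (pr_S P t / r t) * (r t / pr_S P t) = w 0 0 ->
    w 0 1 * (pr_S P t / r t) * (r t / pr_S P t) = w 0 1 -> G q = w.
  move=> E0 E1; apply/rowP; apply: ord3P.
  - by rewrite [LHS]G0 q0E q3E.
  - by rewrite [LHS]G1 q1E q3E.
  - by rewrite [LHS]G2 q3E.
have [tlt|tge] := ltP `|t| z1.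
  have rn : r t != 0 by rewrite gt_eqF // rgt0.
  have Sn : pr_S P t != 0 by rewrite gt_eqF // S0.
  have inv : pr_S P t / r t * (r t / pr_S P t) = 1.
    by rewrite mulrA divfK // divff.
  split; last by apply: GE; rewrite -mulrA inv mulr1.
  by apply: AqE; rewrite -rt -exprMn mulrCA divff // mulr1.
have r0 := rpole t tge; have St : pr_S P t = 0 by exact: pr_pole_S.
have [w0 w1z] : w 0 0 = 0 /\ w 0 1 = 0.
  move/eqP: rt; rewrite r0 expr0n eq_sym paddr_eq0 ?sqr_ge0 // !sqrf_eq0.
  by move=> /andP[/eqP ? /eqP ?].
split; first by apply: AqE; rewrite w0 w1z St !expr0n addr0 mul0r.
by apply: GE; rewrite ?w0 ?w1z !mul0r.
Qed.

Lemma revolution_rotational R (kappa : R) (g : R -> R)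
    (P : profile kappa g) : kappa = -1 \/ kappa = 1 ->
  rotational kappa (revolution P).
Proof.
move=> kE; apply: rotational_axis => // p q [pz p2 pS] E E2 E3.
by split; rewrite -?E3 -?E2 -?E.
Qed.

(** * The slice *)

(** When [H 1 = 0], a horizontal slice, whose angle function is constantly [1],
    is the required sphere. *)
Definition slice R : set (ambient R) :=
  [set q : ambient R | M2 1 q.1 /\ q.2 = 0].

Lemma M2_1E R (x : 'rV[R]_3) :
  M2 1 x <-> x 0 0 ^+ 2 + x 0 1 ^+ 2 + x 0 2 ^+ 2 = 1.
Proof.
rewrite /M2 /form3 /= mul1r -!expr2; split=> [[]//|E]; split=> //.
by move=> F; exfalso; move: F; clear; lra.
Qed.

Lemma slice_cap R :
  cap 1 2 (fun=> 0 : R) (fun=> 0) (fun=> 0).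
Proof.
split.
- exact: ltr0Sn.
- by move=> w /andP[_]; rewrite mul1r.
- by exists 0 => s t; rewrite subrr normr0 mul0r.
- by move=> w _; exact: ct_cst.
- by move=> w _; exact: ct_cst.
- by [].
- by move=> w _; exact: der_cst.
- by move=> w _; rewrite mul0r; exact: der_cst.
Qed.

Lemma slice_patch R (sg : R) : sg ^+ 2 = 1 ->
  patch (@slice R) [set u | hsq u < 2] (capX 1 sg (fun=> 0))
    [set q : ambient R | 1 * (1 - sg * q.1 0 2) < 2] (capY sg).
Proof.
move=> sg2; apply: (cap_patch (expr1n _ _) sg2 (slice_cap R)).
- by apply: open_lt_fun => q; have c2 := @ct_ambient R 2 q; ct.
- move=> u uw; have r0 := cap_rad_gt0 (slice_cap R) uw.
  have s2 := sqr_sqrtr (ltW r0).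
  rewrite /capX; set s := Num.sqrt _ in s2 *; set X := mk4 _ _ _ _.
  have X0 : X.1 0 0 = u 0 0 * s by exact: mk4_0.
  have X1 : X.1 0 1 = u 0 1 * s by exact: mk4_1.
  have X2 : X.1 0 2 = sg * (1 - 1 * hsq u) by exact: mk4_2.
  have X3 : X.2 = 0 by exact: mk4_3.
  clearbody X; split.
    split=> //; apply/M2_1E; rewrite X0 X1 X2 !exprMn s2 sg2 -mulrDl.
    by rewrite /hsq; field.
  by rewrite /= X2 mulrA -expr2 sg2 !mul1r opprB addrC subrK.
- move=> p [/M2_1E pM p3] /= pw; split=> //.
    apply/andP; split=> //; rewrite mul1r subr_ge0.
    have : (sg * p.1 0 2) ^+ 2 <= 1.
      by rewrite exprMn sg2 mul1r -pM lerDr addr_ge0 ?sqr_ge0.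
    by move: (sg * _) => x; clear; nra.
  rewrite !mul1r.
  transitivity (1 - sg ^+ 2 * p.1 0 2 ^+ 2); last by ring.
  by rewrite sg2 mul1r -pM addrK.
Qed.

(** The slice is totally geodesic and [d_z] is normal to it. *)
Lemma slice_curvature R (sg : R) (u : 'rV[R]_2) :
  hsq u < 2 ->
  (forall i, form4 1 (partial i (capX 1 sg (fun=> 0)) u) (d_z R) = 0) /\
  \tr (shape_operator 1 (capX 1 sg (fun=> 0)) (d_z R) u) = 0.
Proof.
move=> uw; have cp := slice_cap R.
have flat i w : hsq w < 2 -> (partial i (capX 1 sg (fun=> 0)) w).2 = 0.
  by move=> ww; rewrite (capX_partial sg i cp ww) mk4_3 mul0r.
split; first by move=> i; rewrite form4_d_z; exact: flat.
set X := capX _ _ _ in flat *.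
have Z i j : (partial i (partial j X) u).2 = 0.
  have D := class_C_derive i (class_C_partial j (capX_C2 sg cp)) uw.
  have E : \near u, (0 : R) = (partial j X u).2.
    apply: (@open_near R [set w | hsq w < 2] _ u _ uw); first exact: open_hsq.
    by move=> w ww; rewrite (flat j w ww).
  by rewrite -(derive_val (is_derive := der_snd D)) -(near_eq_derive _ E) derive_cst.
have S0 : second_form 1 X (d_z R) u = 0.
  apply/matrixP => i j; rewrite (second_formE 1 X (d_z R) u i j).
  by rewrite form4_d_z Z mxE.
by rewrite /shape_operator S0 mulmx0 mxtrace0.
Qed.

Lemma slice_chart R (q : ambient R) : slice q ->
  exists U X W Y, [/\ patch (@slice R) U X W Y, W q,
    forall i, form4 1 (partial i X (Y q)) (d_z R) = 0 &
    \tr (shape_operator 1 X (d_z R) (Y q)) = 0].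
Proof.
move=> Aq.
have [sg [sg2 Wq]] : exists sg : R, sg ^+ 2 = 1 /\ 1 * (1 - sg * q.1 0 2) < 2.
  have [q0|q0] := leP 0 (q.1 0 2).
    by exists 1; rewrite expr1n; split=> //; move: q0; clear; lra.
  by exists (-1); rewrite sqrrN expr1n; split=> //; move: q0; clear; lra.
have Pt := slice_patch sg2; have [UY XY] := patch_inv Pt Aq Wq.
have [nv tr] := slice_curvature sg UY.
exists [set u | hsq u < 2], (capX 1 sg (fun=> 0)),
  [set q : ambient R | 1 * (1 - sg * q.1 0 2) < 2], (capY sg).
by split; [exact: Pt | exact: Wq | exact: nv | exact: tr].
Qed.

Lemma slice_compact R : compact (@slice R).
Proof.
have c0 := @ct_ambient R 0; have c1 := @ct_ambient R 1.
have c2 := @ct_ambient R 2; have c3 := @ct_height R.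
have cl : closed (@slice R).
  have -> : @slice R = [set q : ambient R |
      q.1 0 0 ^+ 2 + q.1 0 1 ^+ 2 + q.1 0 2 ^+ 2 = 1] `&`
      [set q : ambient R | q.2 = 0].
    by apply/seteqP; split=> q [/M2_1E a b].
  apply: closedI; apply: closed_eq_fun => q; last exact: c3.
  by have h0 := c0 q; have h1 := c1 q; have h2 := c2 q; ct.
apply: (compact_ambient (b := 1) cl) => q [/M2_1E qM q3].
have := sqr_ge0 (q.1 0 0); have := sqr_ge0 (q.1 0 1).
have := sqr_ge0 (q.1 0 2); rewrite q3 expr0n ler01.
move: qM; move: (q.1 0 2 ^+ 2) (q.1 0 1 ^+ 2) (q.1 0 0 ^+ 2) => a b c.
by clear; split; lra.
Qed.

Lemma slice_H_surface R (H : R -> R) : H 1 = 0 ->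
  H_surface 1 H (set_val : @slice R -> ambient R) (fun=> d_z R).
Proof.
move=> H1; split.
- apply: set_type_immersed; [exact: slice_compact | by move=> q [] |].
  move=> q Aq; have [U [X [W [Y [Pt Wq _ _]]]]] := slice_chart Aq.
  by exists U, X, W, Y; split; [exact: Pt | exact: Wq].
- split; first exact: cst_continuous.
  move=> s; split.
  + have z (j : 'I_3) : (0 : 'rV[R]_3) 0 j = 0 by exact: mxE.
    by rewrite /tangent_M2xR /= /form3 !z !mul0r mulr0 !addr0.
  + by rewrite form4_d_z.
  + have [U [X [W [Y [Pt Wq nv _]]]]] := slice_chart (set_type_mem s).
    exact: (patch_normal Pt Wq nv).
- move=> s; have [U [X [W [Y [Pt Wq _ tr]]]]] := slice_chart (set_type_mem s).
  apply: (patch_mean_curvature Pt Wq).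
  by rewrite tr mul0r /angle form4_d_z.
Qed.

Lemma slice_is_sphere R : is_sphere R (@slice R : Type).
Proof.
exists (fun s : @slice R => (set_val s).1).
  apply: compact_embedding.
  - exact/set_type_compact/slice_compact.
  - exact: norm_hausdorff.
  - move=> s; apply: (@continuous_comp _ _ _ set_val fst).
      exact: set_type_continuous.
    exact: cvg_fst.
  - move=> s t E; apply: set_type_eq.
    have [_ s3] := set_type_mem s; have [_ t3] := set_type_mem t.
    by apply: ambient_eq; rewrite ?E // s3 t3.
apply/seteqP; split=> [_ [s _ <-]|x Mx]; first by have [] := set_type_mem s.
by exists (exist _ (x, 0 : R) (mem_set (conj Mx erefl))).
Qed.

Lemma slice_rotational R : rotational 1 (@slice R).
Proof.
apply: rotational_axis; first by right.
move=> p q [/M2_1E pM p3] E E2 E3; split; last by rewrite -E3.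
by apply/M2_1E; rewrite -E -E2.
Qed.

(** * The theorem *)

Theorem theorem4p1 (R : realType) (kappa : R) (H : R -> R)
    (kappaE : kappa = -1 \/ kappa = 1)
    (H_class : class_C1_kappa kappa H)
    (H_zeros : isolated_finite_zeros H) :
  exists (S : topologicalType) (f eta : S -> ambient R),
    [/\ H_surface kappa H f eta, is_sphere R S, topological_embedding f &
        rotational kappa (range f)].
Proof.
have [H1|H1] := eqVneq (H 1) 0.
  have k1 : kappa = 1.
    case: kappaE => // km; have [_ _ /(_ km 1)] := H_class.
    by rewrite H1 normr0 mulr0 ltNge sqrtr_ge0 ge0_cp // lexx => /(_ isT).
  rewrite k1; exists (@slice R : topologicalType), set_val, (fun=> d_z R).
  split; [exact: slice_H_surface | exact: slice_is_sphere
    | exact: set_type_embedding | rewrite set_type_range; exact: slice_rotational].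
set eps := Num.sg (H 1).
have e2 : eps ^+ 2 = 1 by rewrite /eps sqr_sg H1.
have [g gE adm] : exists2 g : R -> R,
    forall x, g x = eps * H (Num.sqrt (1 - x ^+ 2)) & admissible kappa g.
  by eexists; last exact: class_admissible kappaE H_class H1.
have [P] := profile_exists adm.
(* [c] and [k S] are the cosine and the sine of the slope angle, and [H] is even *)
have HE t : H (eps * pr_c P t) = eps * g (pr_k P t * pr_S P t).
  have -> : g (pr_k P t * pr_S P t) = eps * H `|pr_c P t|.
    by rewrite gE -sqrtr_sqr -[in LHS](pr_unitS P t) addrK.
  rewrite mulrA -expr2 e2 mul1r.
  have Hev y : y ^+ 2 <= 1 -> H y = H `|y|.
    move=> y1; have [y0|y0] := leP 0 y; first by rewrite ger0_norm.
    have [_ ev _] := H_class; rewrite ltr0_norm // ev //.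
    by rewrite -ler_norml -(ler_pXn2r (n := 2)) ?nnegrE ?normr_ge0 ?ler01 //
      real_normK ?num_real // expr1n.
  have c1 : pr_c P t ^+ 2 <= 1 by rewrite -(pr_unitS P t) lerDl sqr_ge0.
  rewrite Hev ?exprMn ?e2 ?mul1r // normrM.
  by rewrite (_ : `|eps| = 1) ?mul1r // /eps normr_sg H1.
exists (revolution P : topologicalType), set_val,
  (fun s => eps *: revolution_normal P (set_val s)).
split.
- exact: (revolution_H_surface kappaE (adm_cont adm) e2 HE).
- exact: revolution_is_sphere.
- exact: set_type_embedding.
- by rewrite set_type_range; exact: revolution_rotational.
Qed.
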